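(* Let $d\ge 1$ and let $\tau:\mathbb R\to\mathbb R\cup\{-\infty\}$ be a function satisfying: (a) $\tau$ is concave and non-decreasing, $\tau(1)=0$ and $-d\le \tau(0)\le 0$; (b) $\mathrm{dom}(\tau)$ equals either $\mathbb R$ or $\mathbb R_+$, and $\tau^*$ is non-negative on its domain. Let $D\in[\tau'(1^+),\tau'(1^-)]$. Then there exists a homogeneously multifractal measure $\mu\in\mathcal M^+_c(\mathbb R^d)$, exact dimensional with dimension $D$, such that $\tau_\mu=\tau$ and $\mu$ strongly satisfies the multifractal formalism, i.e. $f^H_\mu(\alpha)=\tau_\mu^*(\alpha)$ for every $\alpha\in\mathbb R\cup\{\infty\}$.
   Context: $\mathcal M^+_c(\mathbb R^d)$ is the set of positive, finite, compactly supported Borel measures on $\mathbb R^d$; $\mathrm{supp}(\mu)$ is the topological support; $B(x,r)$ is the closed ball. Lower and upper local dimensions: $\underline d(\mu,x)=\liminf_{r\to0^+}\frac{\log\mu(B(x,r))}{\log r}$, $\overline d(\mu,x)=\limsup_{r\to0^+}\frac{\log\mu(B(x,r))}{\log r}$. For $\alpha\in\mathbb R\cup\{\infty\}$: $\underline E(\mu,\alpha)=\{x\in\mathrm{supp}(\mu):\underline d(\mu,x)=\alpha\}$, $E(\mu,\alpha)=\{x\in\mathrm{supp}(\mu):\underline d(\mu,x)=\overline d(\mu,x)=\alpha\}$, and $f^H_\mu(\alpha)=\dim_H E(\mu,\alpha)$, $\underline f^H_\mu(\alpha)=\dim_H\underline E(\mu,\alpha)$ (lower Hausdorff spectrum), with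 $\dim_H\emptyset=-\infty$. The $L^q$-spectrum is $\tau_\mu(q)=\liminf_{r\to0^+}\frac{\log\sup\{\sum_i\mu(B(x_i,r))^q\}}{\log r}$, the supremum over all centered packings of $\mathrm{supp}(\mu)$ by closed balls of radius $r$ (families of pairwise disjoint closed balls $B(x_i,r)$ with $x_i\in\mathrm{supp}(\mu)$). $\mathrm{dom}(h)=\{x:h(x)>-\infty\}$. For $\tau:\mathbb R\to\mathbb R\cup\{-\infty\}$ with $0\in\mathrm{dom}(\tau)$, the extended concave Legendre–Fenchel transform is $\tau^*(\alpha)=\inf\{\alpha q-\tau(q):q\in\mathrm{dom}(\tau)\}$ for $\alpha\in\mathbb R$ and $\tau^*(\infty)=\inf\{\infty\cdot q-\tau(q):q\in\mathrm{dom}(\tau)\cap\mathbb R_-\}$, with conventions $\infty\cdot q=-\infty$ for $q<0$ and $\infty\cdot0=0$. $\tau'(1^\pm)$ denote one-sided derivatives at $1$. $\mu$ is exact dimensional with dimension $D$ if $\lim_{r\to0^+}\frac{\log\mu(B(x,r))}{\log r}=D$ for $\mu$-a.e. $x$. $\mu$ is homogeneously multifractal (HM) if the lower Hausdorff spectrum of the restriction of $\mu$ to any closed ball whose interior intersects $\mathrm{supp}(\mu)$ equals $\underline f^H_\mu$. *)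

(* Defs.v *)
From HB Require Import structures.
From mathcomp Require Import all_boot all_order all_algebra.
From mathcomp Require Import all_classical all_reals all_analysis.
Set Implicit Arguments. Unset Strict Implicit. Unset Printing Implicit Defensive.
Import Order.TTheory GRing.Theory Num.Theory.
Import numFieldNormedType.Exports.
Local Open Scope classical_set_scope.
Local Open Scope ring_scope.

Section Defs.
Variables (R : realType) (d : nat).
Notation V := 'rV[R]_d.

Definition edist (x y : V) : R := Num.sqrt (\sum_(i < d) (x ord0 i - y ord0 i) ^+ 2).
Definition cball (x : V) (r : R) : set V := [set y | edist x y <= r].

Definition BorelV : measurableType _ := g_sigma_algebraType (@open V).

Definition supp (mu : set V -> \bar R) : set V :=
  [set x | forall U : set V, open U -> U x -> (0 < mu U)%E].

Definition eln (x : \bar R) : \bar R :=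
  match x with
  | r%:E => if 0 < r then (ln r)%:E else -oo%E
  | +oo%E => +oo%E
  | -oo%E => -oo%E
  end.

Definition liminf0 (f : R -> \bar R) : \bar R :=
  ereal_sup [set ereal_inf (f @` [set r | 0 < r < δ]) | δ in [set δ : R | 0 < δ]].
Definition limsup0 (f : R -> \bar R) : \bar R :=
  ereal_inf [set ereal_sup (f @` [set r | 0 < r < δ]) | δ in [set δ : R | 0 < δ]].

Definition ratio (mu : set V -> \bar R) (x : V) (r : R) : \bar R :=
  (eln (mu (cball x r)) * ((ln r)^-1)%:E)%E.

Definition ldim (mu : set V -> \bar R) (x : V) := liminf0 (ratio mu x).
Definition udim (mu : set V -> \bar R) (x : V) := limsup0 (ratio mu x).

Definition lowE (mu : set V -> \bar R) (a : \bar R) : set V :=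
  [set x | supp mu x /\ ldim mu x = a].
Definition Eset (mu : set V -> \bar R) (a : \bar R) : set V :=
  [set x | supp mu x /\ ldim mu x = a /\ udim mu x = a].

Definition diam (A : set V) : \bar R :=
  ereal_sup [set (edist p.1 p.2)%:E | p in A `*` A].

Definition hcontent (s δ : R) (E : set V) : \bar R :=
  ereal_inf [set (\sum_(0 <= i <oo) ((fine (diam (U i))) `^ s)%:E)%E
            | U in [set U : nat -> set V |
                    E `<=` \bigcup_i U i /\ forall i, (diam (U i) <= δ%:E)%E]].

Definition hmeasure (s : R) (E : set V) : \bar R :=
  ereal_sup [set hcontent s δ E | δ in [set δ : R | 0 < δ]].

Definition hdim (E : set V) : \bar R :=
  if asbool (E = set0) then -oo%E
  else ereal_inf [set s%:E | s in [set s : R | 0 < s /\ hmeasure s E = 0%E]].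

Definition fH (mu : set V -> \bar R) (a : \bar R) := hdim (Eset mu a).
Definition lfH (mu : set V -> \bar R) (a : \bar R) := hdim (lowE mu a).

(* centered packings of supp mu by closed balls of radius r (finite families:
   for compactly supported mu every such packing is finite) *)
Definition packing (mu : set V -> \bar R) (r : R) (s : seq V) : Prop :=
  (forall x, x \in s -> supp mu x) /\
  (forall i j, (i < j < size s)%N ->
     cball (nth 0 s i) r `&` cball (nth 0 s j) r = set0).

Definition Spack (mu : set V -> \bar R) (r q : R) : \bar R :=
  ereal_sup [set (\sum_(x <- s) ((fine (mu (cball x r))) `^ q)%:E)%E
            | s in [set s | packing mu r s]].

Definition Lq (mu : set V -> \bar R) (q : R) : \bar R :=
  liminf0 (fun r => (eln (Spack mu r q) * ((ln r)^-1)%:E)%E).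

Definition HM (mu : set V -> \bar R) : Prop :=
  forall (x0 : V) (r : R), (interior (cball x0 r) `&` supp mu) !=set0 ->
    forall a : \bar R, a != -oo%E ->
      lfH (fun A => mu (A `&` cball x0 r)) a = lfH mu a.

Definition exact_dim (mu : {measure set BorelV -> \bar R}) (D : R) : Prop :=
  {ae mu, forall x : BorelV, ldim mu x = D%:E /\ udim mu x = D%:E}.

End Defs.

(* extended concave Legendre-Fenchel transform; the value at -oo is
   irrelevant (never used) *)
Definition LF (R : realType) (tau : R -> \bar R) (a : \bar R) : \bar R :=
  match a with
  | r%:E => ereal_inf [set ((r * q)%:E - tau q)%E | q in [set q | tau q != -oo%E]]
  | +oo%E => ereal_inf [set ((if (q < 0)%R then -oo else 0)%E - tau q)%E
                       | q in [set q | tau q != -oo%E /\ q <= 0]]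
  | -oo%E => -oo%E
  end.

Definition concave_ext (R : realType) (tau : R -> \bar R) : Prop :=
  forall x y t : R, 0 < t < 1 ->
    (t%:E * tau x + (1 - t)%:E * tau y <= tau (t * x + (1 - t) * y)%R)%E.

Definition nondecr_ext (R : realType) (tau : R -> \bar R) : Prop :=
  forall x y : R, x <= y -> (tau x <= tau y)%E.

Definition rderiv1 (R : realType) (tau : R -> \bar R) : R :=
  lim ((fun h : R => (fine (tau (1 + h)) - fine (tau 1)) / h) @ 0^'+).
Definition lderiv1 (R : realType) (tau : R -> \bar R) : R :=
  lim ((fun h : R => (fine (tau (1 + h)) - fine (tau 1)) / h) @ 0^'-).

(* Main.v *)
(* The measure lives on a Cantor set whose level k divides each cube by M_k and keeps m_k^d well
   separated subcubes. The cylinder of a word w gets the mass prod_k p_k(w_k), so that the L^q sums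
   factor into the sums over i of p_k(i)^q, and every question is one about the asymptotics of the
   weights p_k against ln M_k.
   Put Q = 2^(k+1), which is M_k up to a power of k. The letters of level k are of three kinds:
   about Q^D letters of weight about Q^-D, which carry all the mass but a summable part; for each
   grid exponent j/(k+1), about Q^b letters of weight about Q^-(j/(k+1)), where b is the supremum of
   tau^* on the cell [j/(k+1), (j+1)/(k+1)); and light letters that bring the number of letters to
   about Q^-tau(0). The light letters have as exponent the slope of a supporting line of tau at 0 if
   dom tau is the whole line, and an exponent tending to infinity if dom tau is the half line. By
   concave duality the L^q spectrum is then tau.
   Upper bounds on dimensions come from counting the cylinders of exponent at most a, lower bounds
   from the mass distribution principle on the words using only letters of exponent a, and exact
   dimensionality from Borel-Cantelli applied to the letters not of the first kind.
   The restriction to a ball differs locally from the measure only at points x of the sphere. Such an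
   x can be moved towards the interior along a coordinate by changing one of its digits, at
   arbitrarily small scales; the cylinders reached carry enough mass for the upper bounds to persist.
   If no digit allows this, then x is isolated and has no mass. *)

Require Import Defs.
From mathcomp Require Import all_boot all_order all_algebra.
From mathcomp Require Import all_classical all_reals all_analysis.
From mathcomp Require Import ring lra.
From mathcomp Require Import zify.
Import Defs.
Import Order.TTheory GRing.Theory Num.Theory.
Import numFieldNormedType.Exports.
Local Open Scope classical_set_scope.
Local Open Scope ring_scope.
Set Implicit Arguments.
Unset Strict Implicit.

(** * Words and coding of the unit interval *)

Section Words.

(** One measure must realise uncountably many exponents at once. This is why exponents are
    discretised afresh at each level: a real a is followed through the cells of index floor(a
    (k+1)). The supremum over a cell leaves at least Q^b letters with b = tau^*(a) for every a in
    it, and Young's inequality, being linear in a, survives the supremum. Since tau(1) = 0 gives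
    tau^*(a) <= a, and Q = 2^(k+1) turns the width of a cell into a factor 2, each cell weighs O(1);
    a polynomial factor then makes the cells summable without changing an exponent. The first kind
    of letters contributes Q^(D(1-q)), which never exceeds Q^(-tau(q)) because D is a slope of
    support at 1. M_k grows exponentially, so powers of k are negligible, yet ln M_k is o(ln M_0 +
    ... + ln M_(k-1)), so radii between consecutive scales do no harm. The measure is the image of
    Lebesgue measure under a coding of [0, 1) by words. The same coding with other weights serves
    for the lower bounds, so the mass distribution principle works with Lebesgue measure only. *)

Definition agree (n : nat) (w w' : nat -> nat) := forall k, (k < n)%N -> w k = w' k.

Definition valid (N : nat -> nat) (w : nat -> nat) := forall k, (w k < N k)%N.

Fixpoint words (N : nat -> nat) (n : nat) : seq (seq nat) :=
  if n is n'.+1 then [seq rcons s i | s <- words N n', i <- iota 0 (N n')]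
  else [:: [::]].

Lemma agreeS n w w' : agree n.+1 w w' -> agree n w w'.
Proof. by move=> h k kn; apply: h; apply: ltnW. Qed.

Lemma agreeW m n w w' : (m <= n)%N -> agree n w w' -> agree m w w'.
Proof. by move=> mn h k kn; apply: h; apply: leq_trans mn. Qed.

Lemma agree_sym n w w' : agree n w w' -> agree n w' w.
Proof. by move=> h k kn; rewrite h. Qed.

Variable N : nat -> nat.

Lemma words_size n s : s \in words N n -> size s = n.
Proof.
elim: n s => [|n IH] s /=; first by rewrite inE => /eqP ->.
by case/allpairsP => -[a i] [/= /IH <- _ ->]; rewrite size_rcons.
Qed.

Lemma words_valid n s k : s \in words N n -> (k < n)%N -> (nth 0%N s k < N k)%N.
Proof.
elim: n s k => [|n IH] s k //=.
case/allpairsP => -[a i] [/= ha]; rewrite mem_iota add0n => /andP[_ iN] ->.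
rewrite ltnS nth_rcons (words_size ha) => kn.
by case: (ssrnat.ltngtP k n) kn => // [kn _|-> //]; exact: IH.
Qed.

Lemma words_valid_seq n s :
  (forall k, (0 < N k)%N) -> s \in words N n -> valid N (nth 0%N s).
Proof.
move=> N0 hs k; case: (ltnP k n) => kn; first exact: words_valid hs kn.
by rewrite nth_default ?N0// (words_size hs).
Qed.

Lemma mkseq_words n w : valid N w -> mkseq w n \in words N n.
Proof.
move=> wv; elim: n => [|n IH] /=; first by rewrite inE.
apply/allpairsP; exists (mkseq w n, w n); split => //=.
  by rewrite mem_iota add0n wv.
by rewrite -addn1 /mkseq iotaD map_cat /= cats1 add0n.
Qed.

Lemma agree_mkseq n w : agree n w (nth 0%N (mkseq w n)).
Proof. by move=> k kn; rewrite nth_mkseq. Qed.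

Lemma words_uniq n : uniq (words N n).
Proof.
elim: n => [|n IH] //=; apply: allpairs_uniq => //; first exact: iota_uniq.
by move=> [a i] [b j] _ _ /= /rcons_inj [-> ->].
Qed.

Lemma words_agree n s s' : s \in words N n -> s' \in words N n ->
  agree n (nth 0%N s) (nth 0%N s') -> s = s'.
Proof.
move=> hs hs' h; apply: (@eq_from_nth _ 0%N); first by rewrite (words_size hs) (words_size hs').
by move=> i; rewrite (words_size hs) => /h.
Qed.

Lemma sum_words (R : realType) (f : nat -> nat -> R) n :
  \sum_(s <- words N n) \prod_(k < n) f k (nth 0%N s k) =
  \prod_(k < n) \sum_(0 <= i < N k) f k i.
Proof.
elim: n => [|n IH]; first by rewrite /= big_seq1 !big_ord0.
rewrite big_ord_recr/= -IH big_allpairs_dep/= mulr_suml big_seq [RHS]big_seq.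
apply: eq_bigr => s hs; rewrite mulr_sumr.
apply: congr_big; [by rewrite /index_iota subn0|by []|] => i _.
rewrite big_ord_recr/= nth_rcons (words_size hs) ltnn eqxx; congr (_ * _).
by apply: eq_bigr => k _; rewrite nth_rcons (words_size hs) ltn_ord.
Qed.

Lemma ler_sum_uniq (R : realType) (T : eqType) (s1 s2 : seq T) (F : T -> R) :
  uniq s1 -> uniq s2 -> {subset s1 <= s2} -> (forall x, 0 <= F x) ->
  \sum_(x <- s1) F x <= \sum_(x <- s2) F x.
Proof.
move=> u1 u2 s12 F0; have P : perm_eq s1 [seq x <- s2 | x \in s1].
  apply: uniq_perm => //; first exact: filter_uniq.
  by move=> x; rewrite mem_filter; case: (boolP (x \in s1)) => // /s12.
rewrite (perm_big _ P)/= big_filter big_mkcond/=.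
by apply: ler_sum => x _; case: ifP.
Qed.

End Words.

Section Coding.
Variable R : realType.
Variable N : nat -> nat.
Variable p : nat -> nat -> R.
Hypothesis p_ge0 : forall k i, (i < N k)%N -> 0 <= p k i.
Hypothesis p_sum : forall k, \sum_(0 <= i < N k) p k i = 1.

Definition cylmass (w : nat -> nat) n : R := \prod_(k < n) p k (w k).
Definition cyllow (w : nat -> nat) n : R :=
  \sum_(k < n) cylmass w k * \sum_(0 <= i < w k) p k i.

(* The digits of t in the expansion for which the cylinder of the word w is the
   interval [cyllow w n, cyllow w n + cylmass w n); the pair is that interval. *)
Definition digit (t : R) k (cm : R * R) : nat :=
  find (fun i => t < cm.1 + cm.2 * \sum_(0 <= j < i.+1) p k j) (iota 0 (N k)).
Fixpoint state (t : R) n : R * R :=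
  if n is k.+1 then
    let cm := state t k in let i := digit t k cm in
    (cm.1 + cm.2 * \sum_(0 <= j < i) p k j, cm.2 * p k i)
  else (0, 1).
Definition code t k := digit t k (state t k).

Lemma cylmass0 w : cylmass w 0 = 1. Proof. by rewrite /cylmass big_ord0. Qed.
Lemma cylmassS w n : cylmass w n.+1 = cylmass w n * p n (w n).
Proof. by rewrite /cylmass big_ord_recr. Qed.
Lemma cyllowS w n :
  cyllow w n.+1 = cyllow w n + cylmass w n * \sum_(0 <= i < w n) p n i.
Proof. by rewrite /cyllow big_ord_recr. Qed.

Lemma cylmass_agree n w w' : agree n w w' -> cylmass w n = cylmass w' n.
Proof. by move=> h; apply: eq_bigr => k _; rewrite h. Qed.

Lemma cyllow_agree n w w' : agree n w w' -> cyllow w n = cyllow w' n.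
Proof.
move=> h; apply: eq_bigr => k _; rewrite h// (@cylmass_agree k w w')//.
by apply: agreeW h; apply: ltnW.
Qed.

Lemma N_gt0 k : (0 < N k)%N.
Proof.
rewrite lt0n; apply/eqP => N0; move: (p_sum k); rewrite N0 big_geq// => /eqP.
by rewrite eq_sym oner_eq0.
Qed.

Lemma cylmass_ge0 w n : valid N w -> 0 <= cylmass w n.
Proof. by move=> wv; apply: prodr_ge0 => k _; apply: p_ge0. Qed.

Lemma psum_mono k i j : (i <= j)%N -> (j <= N k)%N ->
  \sum_(0 <= l < i) p k l <= \sum_(0 <= l < j) p k l.
Proof.
move=> ij jN; rewrite (@big_cat_nat _ _ _ i 0 j)//= ler_wpDr//.
rewrite big_seq; apply: sumr_ge0 => l; rewrite mem_index_iota => /andP[_ lj].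
by apply: p_ge0; apply: leq_trans jN.
Qed.

Lemma stateE t n : state t n = (cyllow (code t) n, cylmass (code t) n).
Proof.
elim: n => [|n IH] /=; first by rewrite /cyllow/cylmass !big_ord0.
by rewrite cyllowS cylmassS /code IH.
Qed.

(** The search in [digit] succeeds because the partial sums end at 1. The intervals are half-open,
    so the upper inequality is strict and the cylinder of a coded word never has mass 0, even when
    some weights vanish. *)
Lemma code_in t n : 0 <= t < 1 ->
  [/\ cyllow (code t) n <= t, t < cyllow (code t) n + cylmass (code t) n,
      (code t n < N n)%N & 0 < cylmass (code t) n].
Proof.
move=> /andP[t0 t1].
have key k : cyllow (code t) k <= t -> t < cyllow (code t) k + cylmass (code t) k ->
  [/\ cyllow (code t) k.+1 <= t, t < cyllow (code t) k.+1 + cylmass (code t) k.+1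
   & (code t k < N k)%N].
  move=> h1 h2.
  set P := (fun i => t < cyllow (code t) k + cylmass (code t) k * \sum_(0 <= j < i.+1) p k j).
  have cE : code t k = find P (iota 0 (N k)).
    by rewrite {1}/code /digit stateE.
  have hP : has P (iota 0 (N k)).
    apply/hasP; exists (N k).-1; first by rewrite mem_iota add0n prednK ?N_gt0//=.
    by rewrite /P prednK ?N_gt0// p_sum mulr1.
  have kN : (code t k < N k)%N by move: hP; rewrite has_find -cE size_iota.
  have := nth_find 0%N hP; rewrite -cE nth_iota// add0n /P => hi.
  split => //.
    rewrite cyllowS; case E : (code t k) => [|i]; first by rewrite big_geq// mulr0 addr0.
    have := @before_find _ 0%N P (iota 0 (N k)) i.
    rewrite -cE E leqnn nth_iota; last by rewrite -E; apply: leq_trans kN; rewrite E.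
    by rewrite add0n /P => /(_ isT)/negbT; rewrite -leNgt.
  by rewrite cyllowS cylmassS -addrA -mulrDr -big_nat_recr.
have main : forall k, cyllow (code t) k <= t /\ t < cyllow (code t) k + cylmass (code t) k.
  elim=> [|k [h1 h2]]; last by have [] := key k h1 h2.
  by rewrite /cyllow big_ord0 cylmass0 add0r.
have [h1 h2] := main n; have [_ _ h3] := key n h1 h2; split => //.
by rewrite -(ltrD2l (cyllow (code t) n)) addr0; apply: le_lt_trans h2.
Qed.

Lemma code_valid t : 0 <= t < 1 -> valid N (code t).
Proof. by move=> h k; have [] := code_in k h. Qed.

(** Letters of weight 0 are never coded; [hdim_lower] uses this to confine the coded words to chosen
    letters. *)
Lemma p_code_gt0 t k : 0 <= t < 1 -> 0 < p k (code t k).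
Proof.
move=> h; have [_ _ kN _] := code_in k h.
have [_ _ _] := code_in k.+1 h; rewrite cylmassS => h1.
rewrite lt0r p_ge0// andbT; apply: contraTN h1 => /eqP ->.
by rewrite mulr0 ltxx.
Qed.

Lemma cyl_nested w n t : valid N w ->
  cyllow w n.+1 <= t < cyllow w n.+1 + cylmass w n.+1 ->
  cyllow w n <= t < cyllow w n + cylmass w n.
Proof.
move=> wv /andP[h1 h2]; have m0 := cylmass_ge0 n wv.
apply/andP; split.
  apply: le_trans h1; rewrite cyllowS lerDl mulr_ge0// big_seq sumr_ge0// => i.
  rewrite mem_index_iota => /andP[_ iw]; apply: p_ge0.
  exact: ltn_trans (wv n).
apply: lt_le_trans h2 _; rewrite cyllowS cylmassS -addrA lerD2l -mulrDr.
rewrite -big_nat_recr//= -[leRHS]mulr1 ler_wpM2l// -(p_sum n).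
exact: psum_mono.
Qed.

Lemma cyl_disjoint w w' n t : valid N w -> valid N w' ->
  cyllow w n <= t < cyllow w n + cylmass w n ->
  cyllow w' n <= t < cyllow w' n + cylmass w' n -> agree n w w'.
Proof.
move=> wv wv'; elim: n => [|n IH] h h'; first by move=> k.
have ag := IH (cyl_nested wv h) (cyl_nested wv' h').
move=> k; rewrite ltnS leq_eqVlt => /orP[/eqP ->|]; last exact: ag.
move: h h'; rewrite !cyllowS !cylmassS (cyllow_agree ag) (cylmass_agree ag).
have m0 := cylmass_ge0 n wv'.
rewrite -!addrA -!mulrDr -!big_nat_recr//= => /andP[h1 h2] /andP[h3 h4].
have aux i j : (i < j)%N -> (j <= N n)%N ->
   cyllow w' n + cylmass w' n * \sum_(0 <= l < j) p n l <= t ->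
   t < cyllow w' n + cylmass w' n * \sum_(0 <= l < i.+1) p n l -> False.
  move=> ij jN a b; have := lt_le_trans b (le_trans _ a); rewrite ltxx => c.
  by move: (c isT isT) || apply: notF; apply: c; rewrite lerD2l ler_wpM2l// psum_mono.
case: (ssrnat.ltngtP (w n) (w' n)) => // ww; exfalso.
  by apply: (aux _ _ ww) => //; apply: ltnW.
by apply: (aux _ _ ww) => //; apply: ltnW.
Qed.

Definition cylset n w : set R := [set t | 0 <= t < 1 /\ agree n (code t) w].

(** By nesting, a number of the interval of [w] lies in [0, 1); there the disjointness of the
    intervals of one level forces its code to follow [w]. *)
Lemma cylset_itv n w : valid N w ->
  cylset n w = [set` `[cyllow w n, cyllow w n + cylmass w n[%R].
Proof.
move=> wv; apply/seteqP; split => t /=; rewrite in_itv/=.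
  move=> [t01 ag]; have [h1 h2 _ _] := code_in n t01.
  by rewrite -(cyllow_agree ag) -(cylmass_agree ag) h1 h2.
move=> h; have t01 : 0 <= t < 1.
  elim: n h => [|n IH] h; last by apply: IH; apply: cyl_nested.
  by move: h; rewrite /cyllow big_ord0 cylmass0 add0r.
split => //; have [h1 h2 _ _] := code_in n t01.
by apply: (@cyl_disjoint _ _ n t) => //; [apply: code_valid|rewrite h1 h2].
Qed.

Lemma measurable_cylset n w : valid N w -> measurable (cylset n w).
Proof. by move=> wv; rewrite cylset_itv. Qed.

Lemma lebesgue_cylset n w : valid N w ->
  lebesgue_measure (cylset n w) = (cylmass w n)%:E.
Proof.
move=> wv; rewrite cylset_itv// lebesgue_measure_itv/= lte_fin.
rewrite -{1}[cyllow w n]addr0 ltrD2l -EFinB.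
have := cylmass_ge0 n wv; rewrite le_eqVlt => /orP[/eqP <-|m0].
  by rewrite ltxx.
by rewrite m0 addrAC subrr add0r.
Qed.

(** The Borel-Cantelli estimate for one level: the set is a finite union of cylinders of level n +
    1, and the prefixes of length n have total mass 1. *)
Lemma lebesgue_digit n (J : pred nat) :
  measurable [set t : R | 0 <= t < 1 /\ ~~ J (code t n)] /\
  (lebesgue_measure [set t : R | (0 <= t < 1)%R /\ ~~ J (code t n)] <=
    (\sum_(0 <= i < N n | ~~ J i) p n i)%:E)%E.
Proof.
have N0 := N_gt0.
set X := [set t | _].
pose L := [seq rcons s i | s <- words N n, i <- [seq i <- iota 0 (N n) | ~~ J i]].
have Lw s : s \in L -> s \in words N n.+1.
  move=> /allpairsP[[a i] [/= ha]]; rewrite mem_filter => /andP[_ hi] ->.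
  by apply/allpairsP; exists (a, i).
have XE : X `<=` \big[setU/set0]_(s <- L) cylset n.+1 (nth 0%N s).
  move=> t [t01 Jt]; rewrite -bigcup_seq.
  exists (mkseq (code t) n.+1); last by split=> //; exact: agree_mkseq.
  apply/allpairsP; exists (mkseq (code t) n, code t n); split => /=.
  - by apply: mkseq_words; apply: code_valid.
  - by rewrite mem_filter Jt mem_iota add0n code_valid.
  - by rewrite -addn1 /mkseq iotaD map_cat /= cats1 add0n.
have XE2 : X = \big[setU/set0]_(s <- L) cylset n.+1 (nth 0%N s).
  apply/seteqP; split => // t; rewrite -bigcup_seq => -[s /= /allpairsP[[a i] /= [ha]]].
  rewrite mem_filter => /andP[Ji _] -> [t01 ag]; split => //.
  by rewrite ag// nth_rcons (words_size ha) ltnn eqxx.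
have mX s : s \in L -> measurable (cylset n.+1 (nth 0%N s)).
  by move=> /Lw /words_valid_seq h; apply: measurable_cylset; exact: h.
split; first by rewrite XE2 big_seq; apply: bigsetU_measurable.
apply: (@le_trans _ _ (\sum_(s <- L) (cylmass (nth 0%N s) n.+1)%:E)%E).
  have -> : (\sum_(s <- L) (cylmass (nth 0%N s) n.+1)%:E =
             \sum_(s <- L) lebesgue_measure (cylset n.+1 (nth 0%N s)))%E.
    rewrite big_seq [RHS]big_seq; apply: eq_bigr => s /Lw /words_valid_seq h.
    by rewrite lebesgue_cylset//; exact: h.
  rewrite XE2; elim: (L) mX => [|s l IH] mX; first by rewrite !big_nil measure0.
  have ml : measurable (\big[setU/set0]_(j <- l) cylset n.+1 (nth 0%N j)).
    by rewrite big_seq; apply: bigsetU_measurable => /= j jl; apply: mX; rewrite inE jl orbT.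
  rewrite !big_cons; apply: le_trans (measureU2 _ _ _) _ => //.
    by apply: mX; rewrite mem_head.
  by apply: leeD => //; apply: IH => j jl; apply: mX; rewrite inE jl orbT.
rewrite sumEFin lee_fin /L big_allpairs_dep/=.
have E : \sum_(s <- words N n) cylmass (nth 0%N s) n = 1.
  by rewrite /cylmass sum_words; apply: big1 => k _.
rewrite -[leRHS]mul1r -E mulr_suml [leLHS]big_seq [leRHS]big_seq.
apply: ler_sum => s hs; rewrite big_filter mulr_sumr /index_iota subn0.
apply: ler_sum => i _; rewrite cylmassS nth_rcons (words_size hs) ltnn eqxx.
rewrite (@cylmass_agree n (nth 0%N (rcons s i)) (nth 0%N s))//.
by move=> k kn; rewrite nth_rcons (words_size hs) kn.
Qed.

Lemma sum_cylmass_powR q n :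
  \sum_(s <- words N n) (cylmass (nth 0%N s) n) `^ q =
  \prod_(k < n) \sum_(0 <= i < N k) (p k i) `^ q.
Proof.
rewrite -(sum_words N (fun k i => p k i `^ q)) big_seq [RHS]big_seq.
apply: eq_bigr => s hs.
have wv : valid N (nth 0%N s) by apply: words_valid_seq hs; exact: N_gt0.
elim: n {hs} => [|n IH]; first by rewrite cylmass0 powR1 big_ord0.
by rewrite cylmassS big_ord_recr/= powRM ?IH// ?cylmass_ge0// p_ge0.
Qed.

End Coding.

(** * Euclidean distance *)

Section EuclideanDistance.
Variables (R : realType) (d : nat).
Implicit Types x y z : 'rV[R]_d.

(** The sum of the squares of [B * a i - C * b i] equals B (A B - C^2), which settles the case B >
    0; if B = 0, all [b i] vanish. *)
Lemma cauchy_schwarz (I : finType) (a b : I -> R) :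
  \sum_i a i * b i <= Num.sqrt (\sum_i a i ^+ 2) * Num.sqrt (\sum_i b i ^+ 2).
Proof.
set A := \sum_i a i ^+ 2; set B := \sum_i b i ^+ 2; set C := \sum_i a i * b i.
have A0 : 0 <= A by apply: sumr_ge0 => i _; exact: sqr_ge0.
have B0 : 0 <= B by apply: sumr_ge0 => i _; exact: sqr_ge0.
rewrite -sqrtrM//; apply: le_trans (ler_norm _) _.
rewrite -sqrtr_sqr; apply: ler_wsqrtr.
have h : 0 <= B * (A * B - C ^+ 2).
  have : 0 <= \sum_i (B * a i - C * b i) ^+ 2.
    by apply: sumr_ge0 => i _; exact: sqr_ge0.
  have -> : \sum_i (B * a i - C * b i) ^+ 2 = B * (A * B - C ^+ 2).
    transitivity (\sum_i (B ^+ 2 * a i ^+ 2 - 2 * B * C * (a i * b i) + C ^+ 2 * b i ^+ 2)).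
      by apply: eq_bigr => i _; ring.
    rewrite big_split/= sumrB -!mulr_sumr -/A -/B -/C; ring.
  by [].
have [B1|] := ltP 0 B; first by move: h; rewrite pmulr_rge0// subr_ge0.
move=> B1; have B2 : B = 0 by apply/eqP; rewrite eq_le B1.
have b0 i : b i = 0.
  apply/eqP; rewrite -sqrf_eq0; apply/eqP.
  by apply: (psumr_eq0P _ B2) => // j _; exact: sqr_ge0.
have -> : C = 0 by rewrite /C big1// => i _; rewrite b0 mulr0.
by rewrite expr0n/= mulr_ge0.
Qed.

Lemma edist_ge0 x y : 0 <= edist x y. Proof. exact: sqrtr_ge0. Qed.

Lemma edistxx x : edist x x = 0.
Proof. by rewrite /edist big1 ?sqrtr0// => i _; rewrite subrr expr0n. Qed.

Lemma edistC x y : edist x y = edist y x.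
Proof. by congr Num.sqrt; apply: eq_bigr => i _; rewrite -sqrrN opprB. Qed.

Lemma edist_sqr x y : edist x y ^+ 2 = \sum_(i < d) (x ord0 i - y ord0 i) ^+ 2.
Proof. by rewrite sqr_sqrtr// sumr_ge0// => i _; exact: sqr_ge0. Qed.

Lemma edist_triangle y x z : edist x z <= edist x y + edist y z.
Proof.
rewrite -(@ler_pXn2r _ 2)//= ?nnegrE ?addr_ge0 ?edist_ge0//.
rewrite sqrrD !edist_sqr.
have -> : \sum_(i < d) (x ord0 i - z ord0 i) ^+ 2 =
  \sum_(i < d) (x ord0 i - y ord0 i) ^+ 2 +
  2 * (\sum_(i < d) (x ord0 i - y ord0 i) * (y ord0 i - z ord0 i)) +
  \sum_(i < d) (y ord0 i - z ord0 i) ^+ 2.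
  rewrite mulr_sumr -!big_split/=; apply: eq_bigr => i _; ring.
rewrite lerD2r lerD2l -[leRHS]mulr_natl ler_pM2l//.
exact: cauchy_schwarz.
Qed.

Lemma edist_coord x y i : `|x ord0 i - y ord0 i| <= edist x y.
Proof.
rewrite -sqrtr_sqr; apply: ler_wsqrtr.
rewrite (bigD1 i)//= lerDl sumr_ge0// => j _; exact: sqr_ge0.
Qed.

(** The factor d instead of its square root is enough, since only exponents of scales matter; it is
    the origin of the factor d in [rad]. *)
Lemma edist_le x y c : 0 <= c -> (forall i, `|x ord0 i - y ord0 i| <= c) ->
  edist x y <= d%:R * c.
Proof.
move=> c0 h; rewrite -(@ler_pXn2r _ 2)//= ?nnegrE ?mulr_ge0 ?edist_ge0//.
rewrite edist_sqr; apply: (@le_trans _ _ (\sum_(i < d) c ^+ 2)).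
  by apply: ler_sum => i _; rewrite -real_normK ?num_real// ler_pXn2r ?nnegrE.
rewrite sumr_const card_ord -[leLHS]mulr_natl exprMn ler_wpM2r ?sqr_ge0//.
by rewrite -natrX ler_nat -mulnn; nia.
Qed.

Lemma edist_eq0 x y : edist x y <= 0 -> x = y.
Proof.
move=> h; apply/rowP => i; apply/eqP; rewrite -subr_eq0 -normr_le0.
exact: le_trans (edist_coord _ _ _) h.
Qed.

Lemma edist_ball x e y : 0 <= e -> ball x e y -> edist x y <= d%:R * e.
Proof.
move=> e0 h; apply: edist_le => // i.
by have := h; rewrite /ball/= /mx_ball => -[_ /(_ ord0 i)/ltW].
Qed.

(** The topology on row vectors comes from the sup norm; this lemma and [open_edist] translate
    between it and [edist]. *)
Lemma nbhs_edist x (U : set 'rV[R]_d) :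
  nbhs x U -> exists2 e, 0 < e & forall y, edist x y < e -> U y.
Proof.
move=> /nbhs_ballP[e /= e0 h]; exists e => // y xy; apply: h.
by split => // i j; rewrite (ord1 i); apply: le_lt_trans (edist_coord _ _ _) xy.
Qed.

Lemma open_edist (U : set 'rV[R]_d) :
  (forall x, U x -> exists2 e, 0 < e & forall y, edist x y < e -> U y) -> open U.
Proof.
move=> h; rewrite openE => x /h[e e0 hU]; apply/nbhs_ballP.
exists (e / (d%:R + 1)) => /=; first by rewrite divr_gt0.
move=> y xy; apply: hU; apply: le_lt_trans (edist_ball _ xy) _.
  by rewrite divr_ge0// ltW.
by rewrite mulrCA gtr_pMr// ltr_pdivrMr// mul1r ltrDl.
Qed.

Lemma open_eball x r : open [set y | edist x y < r].
Proof.
apply: open_edist => y /= xy; exists (r - edist x y); first by rewrite subr_gt0.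
move=> z yz; apply: le_lt_trans (edist_triangle y _ _) _.
by rewrite addrC -ltrBrDr.
Qed.

Lemma open_ecomp x r : open [set y | r < edist x y].
Proof.
apply: open_edist => y /= xy; exists (edist x y - r); first by rewrite subr_gt0.
move=> z yz; have := edist_triangle z x y; rewrite (edistC z y); lra.
Qed.

Lemma measurable_open_set (U : set 'rV[R]_d) : open U ->
  measurable (U : set (BorelV R d)).
Proof. by move=> oU; apply: sub_sigma_algebra. Qed.

Lemma measurable_cball x r : measurable (cball x r : set (BorelV R d)).
Proof.
rewrite -(setCK (cball x r)); apply: measurableC; apply: measurable_open_set.
have -> : ~` cball x r = [set y | r < edist x y].
  by apply/seteqP; split => y /=; rewrite /cball/= ltNge => /negP.
exact: open_ecomp.
Qed.

End EuclideanDistance.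

(** * Geometry of the Cantor set *)

Section Digits.
Local Open Scope nat_scope.

(** A letter below b^d encodes the position of a subcube in a grid with b places per axis: digit j
    in base b is the coordinate along axis j. *)
Definition base_digit (b i j : nat) := (i %/ b ^ j) %% b.

Lemma base_digit_inj b d i i' : i < b ^ d -> i' < b ^ d ->
  (forall j, j < d -> base_digit b i j = base_digit b i' j) -> i = i'.
Proof.
case: b => [|b] in i i' *.
  by case: d => [|d]; rewrite ?expn0 ?exp0n//; case: i i' => [|?] [|?].
elim: d i i' => [|d IH] i i'; first by rewrite expn0; case: i i' => [|?] [|?].
rewrite expnSr => hi hi' h.
rewrite (divn_eq i b.+1) (divn_eq i' b.+1); congr (_ * _ + _).
  apply: IH; rewrite ?ltn_divLR// => j jd.
  by have := h j.+1 jd; rewrite /base_digit expnS !divnMA.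
by have := h 0 isT; rewrite /base_digit expn0 !divn1.
Qed.

(** There is no carry when the digit is below b - 1, so one coordinate moves by one place and the
    others stay. *)
Lemma base_digit_add b i j : base_digit b i j + 1 < b ->
  [/\ forall j', j' != j -> base_digit b (i + b ^ j) j' = base_digit b i j',
      base_digit b (i + b ^ j) j = base_digit b i j + 1
    & forall d, j < d -> i < b ^ d -> i + b ^ j < b ^ d].
Proof.
move=> h; have b0 : 0 < b by apply: leq_ltn_trans h.
have bj k : 0 < b ^ k by rewrite expn_gt0 b0.
have Q1 : (i + b ^ j) %/ b ^ j = (i %/ b ^ j).+1.
  by rewrite divnDr// divnn bj addn1.
have Q2 : ((i + b ^ j) %/ b ^ j) %/ b = (i %/ b ^ j) %/ b.
  rewrite Q1 {1}(divn_eq (i %/ b ^ j) b) -addnS divnMDl//  [X in _ + X]divn_small ?addn0//.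
  by move: h; rewrite /base_digit addn1.
have big k : j < k -> (i + b ^ j) %/ b ^ k = i %/ b ^ k.
  move=> jk; have -> : b ^ k = b ^ j * b * b ^ (k - j.+1).
    by rewrite -expnSr -expnD subnKC.
  by rewrite !divnMA Q2.
split.
- move=> j' jj; case: (ssrnat.ltngtP j' j) jj => // jj _; rewrite /base_digit.
    have -> : b ^ j = b ^ (j - j').-1 * b * b ^ j'.
      by rewrite -expnSr prednK ?subn_gt0// -expnD subnK// ltnW.
    by rewrite addnC divnMDl// modnMDl.
  by rewrite big.
- rewrite /base_digit Q1 -addn1 -modnDml modn_small//.
- move=> d jd id; have := big d jd; rewrite (divn_small id) => /eqP.
  by rewrite -leqn0 leqNgt divn_gt0// -ltnNge.
Qed.

Lemma base_digit_sub b i j : 0 < base_digit b i j ->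
  b ^ j <= i /\ base_digit b (i - b ^ j) j + 1 = base_digit b i j.
Proof.
rewrite /base_digit => h.
have b0 : 0 < b ^ j.
  by rewrite lt0n; apply: contraTN h => /eqP ->; rewrite divn0 mod0n.
have Q0 : 0 < i %/ b ^ j.
  by rewrite lt0n; apply: contraTN h => /eqP ->; rewrite mod0n.
have le : b ^ j <= i by rewrite -divn_gt0.
split => //; set i' := i - b ^ j.
have E : i %/ b ^ j = (i' %/ b ^ j).+1.
  by rewrite -(subnK le) -/i' divnDr// divnn b0 addn1.
move: h; rewrite E => h.
case: b {b0 le Q0} @i' E h => [|b] i' E h; first by move: h; rewrite !modn0; rewrite addn1.
set q := i' %/ _ in h *.
have [qb|] := eqVneq (q %% b.+1) b.
  by move: h; rewrite -(addn1 q) -modnDml qb addn1 modnn.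
move=> qb; have qb2 : q %% b.+1 < b.
  by rewrite ltn_neqAle qb -ltnS ltn_mod.
suff -> : q.+1 %% b.+1 = (q %% b.+1).+1 by rewrite addn1.
by rewrite -(addn1 q) -modnDml addn1 modn_small.
Qed.

End Digits.

Section Cantor.
Variables (R : realType) (d : nat) (m M : nat -> nat).
Hypothesis d_gt0 : (0 < d)%N.
Hypothesis m_gt0 : forall k, (0 < m k)%N.
Hypothesis mM : forall k, (4 * d * m k <= M k)%N.
Let N k := (m k ^ d)%N.

Definition side n : R := \prod_(k < n) (M k)%:R^-1.
Definition dgt (w : nat -> nat) j k := base_digit (m k) (w k) j.
(* Sibling subcubes of side u are 4 d u apart, and the radius rad = d u bounds their diameter. *)
Definition psum w j n : R := \sum_(k < n) (4 * d * dgt w j k)%:R * side k.+1.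
(** The partial sums are nondecreasing and bounded, so the supremum is the sum of the series. *)
Definition pos w j : R := sup (range (psum w j)).
Definition pt w : 'rV[R]_d := \row_j pos w j.
Definition rad n : R := d%:R * side n.

Lemma M_gt0 k : (0 < M k)%N.
Proof. by apply: leq_trans (mM k); rewrite !muln_gt0 d_gt0 m_gt0. Qed.

Lemma side_gt0 n : 0 < side n.
Proof. by apply: prodr_gt0 => k _; rewrite invr_gt0 ltr0n M_gt0. Qed.

Lemma side0 : side 0 = 1. Proof. by rewrite /side big_ord0. Qed.

Lemma sideS n : side n = (M n)%:R * side n.+1.
Proof.
rewrite {2}/side big_ord_recr/= mulrCA mulfV ?mulr1// pnatr_eq0 -lt0n.
exact: M_gt0.
Qed.

Lemma sideS_le n : (4 * d * m n)%:R * side n.+1 <= side n.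
Proof. by rewrite [leRHS]sideS ler_pM2r ?side_gt0// ler_nat. Qed.

Lemma side_half n : side n.+1 <= side n / 2.
Proof.
rewrite ler_pdivlMr// mulrC; apply: le_trans (sideS_le n).
rewrite ler_pM2r ?side_gt0// ler_nat.
by have := m_gt0 n; have := d_gt0; nia.
Qed.

Lemma side_mono i j : (i <= j)%N -> side j <= side i.
Proof.
move=> /subnK <-; elim: (j - i)%N => [|k IH]; first by rewrite add0n.
rewrite addSn; apply: le_trans (side_half _) (le_trans _ IH).
by rewrite ler_pdivrMr// ler_peMr// ?ler1n// ltW ?side_gt0.
Qed.

Lemma side_small e : 0 < e -> exists n, side n < e.
Proof.
move=> e0; have h n : side n * n.+1%:R <= 1.
  elim: n => [|n IH]; first by rewrite side0 mulr1.
  apply: le_trans IH; apply: (@le_trans _ _ (side n / 2 * n.+2%:R)).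
    by rewrite ler_wpM2r// side_half.
  rewrite -mulrA ler_pM2l ?side_gt0// mulrC ler_pdivrMr// -natrM ler_nat; lia.
exists (Num.trunc e^-1).
have : e^-1 < (Num.trunc e^-1).+1%:R.
  by have /truncn_itv/andP[] : 0 <= e^-1 by rewrite invr_ge0 ltW.
set n := Num.trunc _ => he; have := h n.
rewrite -ler_pdivlMr ?ltr0n// mul1r => h1; apply: le_lt_trans h1 _.
by rewrite invf_plt ?posrE// ltr0n.
Qed.

Lemma le_side0 x c : (forall n, x <= c * side n) -> 0 < c -> x <= 0.
Proof.
move=> h c0; rewrite leNgt; apply/negP => x0.
have [n hn] := @side_small (x / c) (divr_gt0 x0 c0).
by have := h n; rewrite leNgt mulrC -ltr_pdivlMr// hn.
Qed.

Lemma dgt_lt w j k : (dgt w j k < m k)%N.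
Proof. by rewrite ltn_mod. Qed.

Lemma psumS w j n : psum w j n.+1 = psum w j n + (4 * d * dgt w j n)%:R * side n.+1.
Proof. by rewrite /psum big_ord_recr. Qed.

Lemma psum_step w j n : psum w j n <= psum w j n.+1 /\
  psum w j n.+1 + (4 * d)%:R * side n.+1 <= psum w j n + side n.
Proof.
rewrite psumS; have s0 := side_gt0 n.+1; split.
  by rewrite lerDl mulr_ge0// ltW.
rewrite -addrA lerD2l -mulrDl -natrD; apply: le_trans (sideS_le n).
by rewrite ler_pM2r// ler_nat; have := dgt_lt w j n; nia.
Qed.

Lemma psum_bounds w j n k :
  psum w j n <= psum w j (k + n) /\
  psum w j (k + n) + side (k + n) <= psum w j n + side n.
Proof.
elim: k => [|k [h1 h2]]; first by rewrite add0n.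
have [h3 h4] := psum_step w j (k + n); rewrite addSn; split.
  exact: le_trans h3.
apply: le_trans h2; apply: le_trans h4; rewrite lerD2l.
rewrite ler_peMl//; first exact: ltW (side_gt0 _).
by rewrite ler1n muln_gt0.
Qed.

Lemma pos_bounds w j n : psum w j n <= pos w j <= psum w j n + side n.
Proof.
have ub k : psum w j k <= psum w j n + side n.
  apply: (@le_trans _ _ (psum w j (k + n))).
    by rewrite addnC; have [] := psum_bounds w j k n.
  have [_ h] := psum_bounds w j n k; apply: le_trans h.
  by rewrite lerDl ltW ?side_gt0.
apply/andP; split.
  apply: ub_le_sup; last by exists n.
  by exists (psum w j n + side n) => _ [k _ <-].
by apply: ge_sup => [|_ [k _ <-]//]; exists (psum w j 0), 0%N.
Qed.

Lemma psum_agree w w' j n : agree n w w' -> psum w j n = psum w' j n.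
Proof. by move=> h; apply: eq_bigr => k _; rewrite /dgt h. Qed.

Lemma rad_gt0 n : 0 < rad n.
Proof. by rewrite mulr_gt0 ?side_gt0// ltr0n. Qed.

Lemma rad_mono i j : (i <= j)%N -> rad j <= rad i.
Proof. by move=> ij; rewrite ler_wpM2l// side_mono. Qed.

Lemma rad_small e : 0 < e -> exists n, rad n < e.
Proof.
move=> e0; have [|n hn] := @side_small (e / d%:R).
  by rewrite divr_gt0// ltr0n.
by exists n; rewrite /rad mulrC -ltr_pdivlMr// ltr0n.
Qed.

Lemma radS n : rad n = (M n)%:R * rad n.+1.
Proof. by rewrite /rad sideS mulrCA. Qed.

Lemma pt_agree n w w' : agree n w w' -> edist (pt w) (pt w') <= rad n.
Proof.
move=> h; apply: edist_le; first exact: ltW (side_gt0 n).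
move=> i; rewrite !mxE; have := pos_bounds w i n; have := pos_bounds w' i n.
rewrite (psum_agree i h) => /andP[h1 h2] /andP[h3 h4].
rewrite ler_norml; lra.
Qed.

(** Points in distinct sibling subcubes of side u differ in some coordinate by at least 4du - u >=
    3du. As 3 exceeds 2, two points within [rad n] of a common point belong to the same cylinder. *)
Lemma pt_separated n w w' : valid N w -> valid N w' ->
  edist (pt w) (pt w') < 3 * rad n -> agree n w w'.
Proof.
move=> wv wv'; elim: n => [|n IH] h; first by [].
have ag : agree n w w'.
  apply: IH; apply: lt_le_trans h _; rewrite ler_pM2l//; exact: rad_mono.
move=> k; rewrite ltnS leq_eqVlt => /orP[/eqP ->|]; last exact: ag.
apply: (@base_digit_inj (m n) d) => // j jd.
apply/eqP; apply/negPn/negP => ne.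
have := edist_coord (pt w) (pt w') (Ordinal jd); rewrite !mxE/=.
have := pos_bounds w j n.+1; have := pos_bounds w' j n.+1.
rewrite !psumS (psum_agree j ag) => /andP[h1 h2] /andP[h3 h4].
rewrite leNgt => /negP; apply; apply: lt_le_trans h _.
have s0 := side_gt0 n.+1; have d1 : 1 <= d%:R :> R by rewrite ler1n.
have key (a b x : R) (u v : nat) : (u < v)%N -> b <= a + (4 * d * u)%:R * side n.+1 + side n.+1 ->
   a + (4 * d * v)%:R * side n.+1 <= x -> 3 * rad n.+1 <= x - b.
  move=> uv hb hx.
  have : (4 * d * u + 4 * d)%:R * side n.+1 <= (4 * d * v)%:R * side n.+1.
    by rewrite ler_pM2r// ler_nat; nia.
  rewrite natrD mulrDl (natrM _ 4 d) => hh.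
  have : side n.+1 <= d%:R * side n.+1 by rewrite ler_peMl// ltW.
  rewrite /rad; move: hh; rewrite -!mulrA; set D := d%:R * side n.+1; lra.
move: ne; rewrite neq_ltn => /orP[uv|uv].
  by rewrite distrC; apply: le_trans (ler_norm _); exact: key uv h4 h1.
by apply: le_trans (ler_norm _); exact: key uv h2 h3.
Qed.

Lemma pt_closure (x : 'rV[R]_d) (f : nat -> nat -> nat) :
  (forall n, valid N (f n)) -> (forall n, edist (pt (f n)) x <= rad n) ->
  exists w, [/\ valid N w, x = pt w & forall n, agree n w (f n)].
Proof.
move=> fv fx.
have ag i j : (i <= j)%N -> agree i (f i) (f j).
  move=> ij; apply: pt_separated => //; apply: le_lt_trans (edist_triangle x _ _) _.
  have h2 : edist x (pt (f j)) <= rad i.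
    by rewrite edistC; apply: le_trans (fx j) (rad_mono ij).
  have h0 := rad_gt0 i; have h1 := fx i; lra.
(* The words are coherent, so the diagonal follows each [f n] for n letters; letter k is read in
   [f k.+1], the first word whose letter k is final. *)
pose w k := f k.+1 k.
have wf n : agree n w (f n) by move=> k kn; rewrite /w (ag k.+1 n kn).
have wv : valid N w by move=> k; exact: fv.
exists w; split => //; apply: edist_eq0; apply: (@le_side0 _ (2 * d%:R)); last first.
  by rewrite mulr_gt0// ltr0n.
move=> n; apply: le_trans (edist_triangle (pt (f n)) _ _) _.
have h1 := fx n; rewrite edistC in h1; have h2 := pt_agree (wf n).
by rewrite edistC in h2; rewrite -mulrA -/(rad n); lra.
Qed.

Lemma pos_shift w w' j n c :
  (forall k, (n <= k)%N -> psum w' j k = psum w j k + c) -> pos w' j = pos w j + c.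
Proof.
move=> h; apply/eqP; rewrite -subr_eq0 -normr_le0; apply: (@le_side0 _ 1) => // k.
rewrite mul1r; apply: (@le_trans _ _ (side (k + n))); last exact/side_mono/leq_addr.
have := pos_bounds w j (k + n); have := pos_bounds w' j (k + n).
rewrite h ?leq_addl// => /andP[h1 h2] /andP[h3 h4]; rewrite ler_norml; lra.
Qed.

Lemma pos_mono w w' j : (forall k, (dgt w' j k <= dgt w j k)%N) -> pos w' j <= pos w j.
Proof.
move=> h; apply: ge_sup; first by exists (psum w' j 0), 0%N.
move=> _ [n _ <-]; apply: (@le_trans _ _ (psum w j n)); last by case/andP: (pos_bounds w j n).
apply: ler_sum => k _; apply: ler_wpM2r; first exact: ltW (side_gt0 _).
by rewrite ler_nat leq_mul2l h orbT.
Qed.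

Lemma psum_upd w n i j k : (n < k)%N ->
  psum (fun l => if l == n then i else w l) j k =
  psum w j k + ((4 * d * base_digit (m n) i j)%:R - (4 * d * dgt w j n)%:R) * side n.+1.
Proof.
move=> nk; rewrite /psum (bigD1 (Ordinal nk))//= [in RHS](bigD1 (Ordinal nk))//=.
rewrite {1}/dgt eqxx mulrBl.
rewrite (eq_bigr (fun k : 'I__ => (4 * d * dgt w j k)%:R * side k.+1)).
  by rewrite addrAC addrCA subrr addr0 addrC.
move=> l /negP hl; rewrite /dgt ifN//; apply/eqP => ln; apply: hl.
by apply/eqP/val_inj.
Qed.

(** Raising one base digit without carry translates the point along an axis by 4d sides, that is by
    [4 * rad n.+1], and keeps it in the Cantor set. *)
Lemma shift_up w n (j : 'I_d) : valid N w -> (dgt w j n + 1 < m n)%N ->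
  exists2 w', valid N w' & pt w' = pt w + (4 * rad n.+1) *: delta_mx ord0 j.
Proof.
move=> wv h; have [h1 h2 h3] := base_digit_add h.
exists (fun l => if l == n then (w n + m n ^ j)%N else w l).
  by move=> l; case: eqP => [->|_]; [apply: h3|].
apply/rowP => i; rewrite !mxE eqxx/=.
apply: (@pos_shift _ _ _ n.+1) => k nk; rewrite psum_upd//.
have [->|ij] := eqVneq i j.
  by rewrite h2 mulnDr natrD addrAC subrr add0r muln1 mulr1 /rad natrM mulrA.
by rewrite h1 ?subrr ?mul0r ?mulr0.
Qed.

Lemma shift_down w n (j : 'I_d) : valid N w -> (0 < dgt w j n)%N ->
  exists2 w', valid N w' & pt w' = pt w - (4 * rad n.+1) *: delta_mx ord0 j.
Proof.
move=> wv h; have [le h2] := base_digit_sub h.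
pose w0 l := if l == n then (w n - m n ^ j)%N else w l.
have w0v : valid N w0.
  move=> l; rewrite /w0; case: eqP => [->|_]; last exact: wv.
  by apply: leq_ltn_trans (wv n); exact: leq_subr.
have h3 : (base_digit (m n) (w n - m n ^ j) j + 1 < m n)%N by rewrite h2 dgt_lt.
have [h4 _ _] := base_digit_add h3.
exists w0 => //; apply/rowP => i; rewrite !mxE eqxx/=.
apply: (@pos_shift _ _ _ n.+1) => k nk; rewrite psum_upd//.
have [->|ij] := eqVneq i j.
  rewrite /dgt -h2 mulnDr muln1 natrD opprD addrA subrr add0r mulNr mulr1.
  by rewrite /rad natrM mulrA.
by rewrite /dgt -(h4 i ij) subnK// subrr mul0r mulr0 subr0 addr0.
Qed.

Lemma edist_shift (x x0 : 'rV[R]_d) c j :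
  edist (x + c *: delta_mx ord0 j) x0 ^+ 2 =
  edist x x0 ^+ 2 + 2 * c * (x ord0 j - x0 ord0 j) + c ^+ 2.
Proof.
rewrite !edist_sqr (bigD1 j)//= [in RHS](bigD1 j)//= !mxE !eqxx/= mulr1.
rewrite (eq_bigr (fun i => (x ord0 i - x0 ord0 i) ^+ 2)); first by ring.
by move=> i /negbTE ij; rewrite !mxE ij andbF mulr0 addr0.
Qed.

Hypothesis M_oo : forall c : R, exists n0, forall n, (n0 <= n)%N -> c <= (M n)%:R.

(* The shift lowers the squared distance by 2 h a - h^2 >= h a. *)
Lemma inner_shift (x x0 : 'rV[R]_d) rho h a s j : 0 < rho -> edist x x0 = rho ->
  s ^+ 2 = 1 -> 0 < h -> h <= a -> a = s * (x0 ord0 j - x ord0 j) -> a <= rho ->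
  edist (x + (s * h) *: delta_mx ord0 j) x0 <= rho - h * a / (2 * rho).
Proof.
move=> rho0 E s1 h0 ha aE arho; have a0 : 0 < a by exact: lt_le_trans ha.
have q0 : h * a / (2 * rho) <= rho.
  rewrite ler_pdivrMr ?mulr_gt0//; apply: (@le_trans _ _ (rho * rho)).
    by apply: ler_pM => //; [exact: ltW|exact: ltW|exact: le_trans arho].
  by nra.
rewrite -(@ler_pXn2r _ 2)//= ?nnegrE ?edist_ge0 ?subr_ge0//.
rewrite edist_shift E.
have -> : 2 * (s * h) * (x ord0 j - x0 ord0 j) = - (2 * h * a) by rewrite aE; ring.
rewrite exprMn s1 mul1r sqrrB.
have -> : rho * (h * a / (2 * rho)) *+ 2 = h * a.
  by field; rewrite gt_eqF.
have : 0 <= (h * a / (2 * rho)) ^+ 2 by exact: sqr_ge0.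
nra.
Qed.

(** Inside the sphere the word itself serves. On it, if some digit can be moved towards [x0] at
    infinitely many levels, the translation by [4 * rad n.+1] gains a depth proportional to
    [rad n.+1], which exceeds [rad n.+2] since [M] tends to infinity. Otherwise the late digits are
    extremal along every axis on which [pt w] and [x0] differ: a displacement within a deep cylinder
    has nonpositive scalar product with [x0 - pt w], so no other point of that cylinder stays in the
    ball. *)
Lemma ball_depth (x0 : 'rV[R]_d) rho w : valid N w -> 0 < rho ->
  edist (pt w) x0 <= rho ->
  (forall n0, exists n w', [/\ (n0 <= n)%N, valid N w',
      edist (pt w) (pt w') <= 4 * rad n.+1 &
      forall z, edist (pt w') z <= rad n.+2 -> edist z x0 <= rho]) \/
  (exists n, forall w', valid N w' -> agree n w w' -> edist (pt w') x0 <= rho ->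
     pt w' = pt w).
Proof.
move=> wv rho0; rewrite le_eqVlt => /orP[/eqP E|lt]; last first.
  move: lt; rewrite -subr_gt0 => lt; left => n0; have [n hn] := rad_small lt.
  exists (maxn n0 n), w; rewrite leq_maxl edistxx mulr_ge0 ?(ltW (rad_gt0 _))//.
  split => // z hz; apply: le_trans (edist_triangle (pt w) _ _) _.
  rewrite edistC in hz; apply: (@le_trans _ _ (rad n + edist (pt w) x0)).
    rewrite lerD2r; apply: le_trans hz (rad_mono _).
    by rewrite -addn2; apply: leq_trans (leq_maxr n0 n) (leq_addr _ _).
  by rewrite -lerBrDr ltW.
pose v j := x0 ord0 j - pt w ord0 j.
have step (j : 'I_d) (s a : R) : s ^+ 2 = 1 -> a = s * v j -> 0 < a ->
   (forall n0, exists n w', [/\ (n0 <= n)%N, valid N w' &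
      pt w' = pt w + (s * (4 * rad n.+1)) *: delta_mx ord0 j]) ->
   forall n0, exists n w', [/\ (n0 <= n)%N, valid N w',
      edist (pt w) (pt w') <= 4 * rad n.+1 &
      forall z, edist (pt w') z <= rad n.+2 -> edist z x0 <= rho].
  move=> s1 aE a0 H n0.
  have s1' : `|s| = 1 by apply/eqP; rewrite -sqr_norm_eq1 s1.
  have arho : a <= rho.
    rewrite -E edistC; apply: le_trans (edist_coord _ _ j); rewrite aE.
    by apply: le_trans (ler_norm _) _; rewrite normrM s1' mul1r.
  have a4 : 0 < a / 4 by rewrite divr_gt0.
  have [n1 hn1] := rad_small a4.
  (* The depth gained is 2 a [rad n.+1] / [rho], that is 2 (a / [rho]) [M n.+1] [rad n.+2]; this
     choice makes it at least twice [rad n.+2]. *)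
  have [n2 hn2] := M_oo (rho / a).
  have [n [w' [hn w'v w'E]]] := H (maxn n0 (maxn n1 n2)).
  move: hn; rewrite !geq_max => /and3P[hn0 hn_1 hn_2].
  exists n, w'; split => //.
    rewrite w'E -(@ler_pXn2r _ 2)//= ?nnegrE ?edist_ge0 ?mulr_ge0 ?(ltW (side_gt0 _))//.
    rewrite edistC edist_shift edistxx subrr mulr0 addr0 expr0n add0r exprMn s1 mul1r//.
  move=> z hz; apply: le_trans (edist_triangle (pt w') _ _) _; rewrite edistC.
  have hs : edist (pt w') x0 <= rho - 4 * rad n.+1 * a / (2 * rho).
    rewrite w'E; apply: (@inner_shift _ _ rho _ a s) => //.
      by rewrite mulr_gt0 ?rad_gt0.
    rewrite mulrC -ler_pdivlMr//; apply: ltW; apply: le_lt_trans hn1.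
    by apply: rad_mono; apply: leq_trans hn_1 (leqnSn _).
  apply: le_trans (lerD hz hs) _.
  rewrite addrCA gerDl subr_le0 ler_pdivlMr ?mulr_gt0//.
  rewrite (radS n.+1); have := hn2 n.+1 (leq_trans hn_2 (leqnSn _)).
  rewrite ler_pdivrMr//; have := rad_gt0 n.+2.
  set r2 := rad n.+2; set Mn := (M n.+1)%:R => r20 h.
  have : r2 * rho <= r2 * (Mn * a) by rewrite ler_pM2l.
  have : 0 < r2 * (Mn * a) by apply: lt_le_trans (mulr_gt0 r20 rho0) _; rewrite ler_pM2l.
  nra.
have [[j [vj H]]|no1] := pselect (exists j, 0 < v j /\
    forall n0, exists n, (n0 <= n)%N && (dgt w j n + 1 < m n)%N).
  left; apply: (step j 1 (v j)); rewrite ?expr1n ?mul1r// => n0.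
  have [n /andP[hn hd]] := H n0; have [w' w'v w'E] := shift_up wv hd.
  by exists n, w'; rewrite mul1r.
have [[j [vj H]]|no2] := pselect (exists j, v j < 0 /\
    forall n0, exists n, (n0 <= n)%N && (0 < dgt w j n)%N).
  left; apply: (step j (-1) (- v j)); rewrite ?sqrrN ?expr1n ?mulN1r ?oppr_gt0// => n0.
  have [n /andP[hn hd]] := H n0; have [w' w'v w'E] := shift_down wv hd.
  by exists n, w'; rewrite mulN1r scaleNr.
right.
have ev (j : 'I_d) : exists n, forall k, (n <= k)%N ->
    (0 < v j -> forall w', (dgt w' j k <= dgt w j k)%N) /\
    (v j < 0 -> forall w', (dgt w j k <= dgt w' j k)%N).
  have [vj|vj|vj] := ltgtP (v j) 0.
  - have [n hn] : exists n0, forall n, (n0 <= n)%N -> dgt w j n = 0%N.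
      apply: contrapT => hc; apply: no2; exists j; split => // n0.
      apply: contrapT => hn; apply: hc; exists n0 => n n0n.
      by apply/eqP; rewrite -leqn0 leqNgt; apply/negP => h; apply: hn; exists n; rewrite n0n.
    by exists n => k nk; split => // _ w'; rewrite hn.
  - have [n hn] : exists n0, forall n, (n0 <= n)%N -> (m n <= dgt w j n + 1)%N.
      apply: contrapT => hc; apply: no1; exists j; split => // n0.
      apply: contrapT => hn; apply: hc; exists n0 => n n0n.
      by rewrite leqNgt; apply/negP => h; apply: hn; exists n; rewrite n0n.
    exists n => k nk; split => // _ w'.
    by have := dgt_lt w' j k; have := hn k nk; lia.
  - by exists 0%N => k _.
have [f hf] := choice ev.
exists (\max_(j < d) f j)%N => w' w'v ag E'.
have prod_le0 (j : 'I_d) : v j * (pt w' ord0 j - pt w ord0 j) <= 0.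
  have fk k : ~~ (k < \max_(j < d) f j)%N -> (f j <= k)%N.
    by rewrite -leqNgt; apply: leq_trans; exact: leq_bigmax.
  have [vj|vj|vj] := ltgtP (v j) 0; last by rewrite vj mul0r.
  - rewrite nmulr_rle0// subr_ge0 !mxE; apply: pos_mono => k.
    case: (boolP (k < \max_(j < d) f j)%N) => hk; first by rewrite /dgt ag.
    by have [_ /(_ vj)] := hf j k (fk k hk); apply.
  - rewrite pmulr_rle0// subr_le0 !mxE; apply: pos_mono => k.
    case: (boolP (k < \max_(j < d) f j)%N) => hk; first by rewrite /dgt ag.
    by have [/(_ vj) + _] := hf j k (fk k hk); apply.
apply: edist_eq0.
(* The squared distance to [x0] is expanded around [pt w]; the cross term can only increase it, so
   nothing is left for the distance from [pt w'] to [pt w]. *)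
have : edist (pt w') x0 ^+ 2 <= edist (pt w) x0 ^+ 2.
  by rewrite E ler_pXn2r// nnegrE ?edist_ge0// ltW.
have -> : edist (pt w') x0 ^+ 2 = edist (pt w') (pt w) ^+ 2 -
   2 * (\sum_(j < d) v j * (pt w' ord0 j - pt w ord0 j)) + edist (pt w) x0 ^+ 2.
  rewrite !edist_sqr mulr_sumr -sumrB -big_split/=; apply: eq_bigr => j _.
  by rewrite /v; ring.
have : \sum_(j < d) v j * (pt w' ord0 j - pt w ord0 j) <= 0.
  by apply: sumr_le0 => j _.
move=> h1 h2; rewrite leNgt; apply/negP => h; have := exprn_gt0 2 h; lra.
Qed.

End Cantor.

(** * The coded measure *)

Section CantorMeasure.
Variables (R : realType) (d : nat) (m M : nat -> nat) (p : nat -> nat -> R).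
Hypothesis d_gt0 : (0 < d)%N.
Hypothesis m_gt0 : forall k, (0 < m k)%N.
Hypothesis mM : forall k, (4 * d * m k <= M k)%N.
Let N k := (m k ^ d)%N.
Hypothesis p_gt0 : forall k i, (i < N k)%N -> 0 < p k i.
Hypothesis p_sum : forall k, \sum_(0 <= i < N k) p k i = 1.

Let p_ge0 k i : (i < N k)%N -> 0 <= p k i. Proof. by move=> /p_gt0/ltW. Qed.
Let V := BorelV R d.
Let pt := @pt R d m M.
Let rad := @rad R d M.
Let code := code N p.
Let cylset := cylset N p.
Let cylmass := cylmass p.
Let rad_gt0 n : 0 < rad n. Proof. exact: (@rad_gt0 R d m M). Qed.
Let pt_agree n w w' : agree n w w' -> edist (pt w) (pt w') <= rad n.
Proof. exact: (@pt_agree R d m M). Qed.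

Lemma cylmass_gt0 w n : valid N w -> 0 < cylmass w n.
Proof. by move=> wv; apply: prodr_gt0 => k _; apply: p_gt0. Qed.

(** Cylinders shrink to points, so the preimage of an open set is the countable union of the
    cylinders whose whole image lies in it. *)
Lemma measurable_code_open (U : set V) : open (U : set 'rV[R]_d) ->
  measurable [set t : R | 0 <= t < 1 /\ U (pt (code t))].
Proof.
move=> oU.
pose good n s := `[< forall w, valid N w -> agree n w (nth 0%N s) -> U (pt w) >].
have -> : [set t : R | 0 <= t < 1 /\ U (pt (code t))] =
    \bigcup_n \big[setU/set0]_(s <- words N n | good n s) cylset n (nth 0%N s).
  apply/seteqP; split => t /=.
    move=> [t01 Ut]; have [e e0 He] := nbhs_edist (open_nbhs_nbhs (conj oU Ut)).
    have [n hn] := rad_small d_gt0 m_gt0 mM e0.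
    have tv : valid N (code t) by exact: code_valid.
    exists n => //; rewrite -bigcup_seq_cond; exists (mkseq (code t) n) => /=.
      rewrite mkseq_words//; apply/asboolP => w wv ag; apply: He.
      apply: le_lt_trans hn. apply: pt_agree.
      by move=> k kn; rewrite ag// -agree_mkseq.
    by split => //; exact: agree_mkseq.
  move=> [n _]; rewrite -bigcup_seq_cond => -[s /= /andP[sn /asboolP gs] [t01 ag]].
  by split => //; apply: gs => //; exact: code_valid.
apply: bigcup_measurable => n _; rewrite big_seq_cond.
apply: bigsetU_measurable => s /andP[sn _]; apply: measurable_cylset => //.
by apply: words_valid_seq sn; exact: N_gt0 p_sum.
Qed.

Lemma exists_coded_measure : exists mu : {measure set V -> \bar R},
  forall A, mu A = lebesgue_measure [set t : R | 0 <= t < 1 /\ A (pt (code t))].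
Proof.
pose I01 : set (measurableTypeR R) := [set t | 0 <= t < 1].
have mI : measurable I01.
  have -> : I01 = [set` `[0, 1[] by apply/seteqP; split => t; rewrite /= in_itv.
  exact: measurable_itv.
(* The value at 0 is a default outside [0, 1), where the restricted Lebesgue measure vanishes. *)
pose T : measurableTypeR R -> V := fun t => pt (code (if 0 <= t < 1 then t else 0)).
have mT : measurable_fun setT T.
  apply: (measurability (@open 'rV[R]_d : set (set V))) => //.
  move=> _ [U oU <-]; rewrite setTI.
  have -> : T @^-1` U = [set t : R | 0 <= t < 1 /\ U (pt (code t))] `|`
      (if `[< U (pt (code 0)) >] then ~` I01 else set0).
    apply/seteqP; split => t; rewrite /T /preimage/=;
      have [t01|t01] := boolP (0 <= t < 1).
    - by move=> Ut; left.
    - by move=> Ut; right; rewrite asboolT//; exact/negP.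
    - by move=> [[_ //]|]; case: asboolP => _ //= H; exfalso; exact: H t01.
    - by move=> [[//]|]; case: asboolP.
  apply: measurableU; first exact: measurable_code_open.
  by case: ifP => // _; exact: measurableC.
exists (measure_function_pushforward__canonical__measure_function_Measure
  (mrestr (@lebesgue_measure R) mI) mT) => A /=.
rewrite /pushforward /mrestr; congr lebesgue_measure.
apply/seteqP; split => t /=; rewrite /T.
  by move=> [h t01]; have := t01; rewrite /I01/= => t01'; move: h; rewrite t01'.
by move=> [t01 h]; rewrite /I01/= t01.
Qed.

Variable mu : {measure set V -> \bar R}.
Hypothesis muE : forall A : set V,
  mu A = lebesgue_measure [set t : R | 0 <= t < 1 /\ A (pt (code t))].

(** By [pt_agree] and [pt_separated] such a ball meets the Cantor set in exactly one cylinder of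
    level n. *)
Lemma mu_cball_eq w n r : valid N w -> rad n <= r < 3 * rad n ->
  mu (cball (pt w) r) = (cylmass w n)%:E.
Proof.
move=> wv /andP[h1 h2]; rewrite muE -(lebesgue_cylset p_ge0 p_sum)//.
congr lebesgue_measure; apply/seteqP; split => t /= [t01 ht]; split => //.
  apply: (@pt_separated R d m M) => //; first exact: code_valid.
  by rewrite edistC; apply: le_lt_trans h2.
by rewrite /cball/= edistC; apply: le_trans h1; exact: pt_agree.
Qed.

Lemma cball_mono (x : 'rV[R]_d) r r' : r <= r' -> cball x r `<=` cball x r'.
Proof. by move=> rr y h; apply: le_trans rr. Qed.

Lemma mu_le (A B : set V) : measurable A -> measurable B -> A `<=` B -> (mu A <= mu B)%E.
Proof. by move=> mA mB AB; apply: le_measure; rewrite ?inE. Qed.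

Lemma mu_cball_ge w n r : valid N w -> rad n <= r ->
  ((cylmass w n)%:E <= mu (cball (pt w) r))%E.
Proof.
move=> wv h; rewrite -(@mu_cball_eq w n (rad n))//.
  by apply: mu_le; [exact: measurable_cball..|exact: cball_mono].
by rewrite lexx/= ltr_pMl ?ltr1n// rad_gt0.
Qed.

Lemma mu_cball_le w n r : valid N w -> r < 3 * rad n ->
  (mu (cball (pt w) r) <= (cylmass w n)%:E)%E.
Proof.
move=> wv h; have [hr|/ltW hr] := leP (rad n) r; first by rewrite (@mu_cball_eq w n)// hr.
rewrite -(@mu_cball_eq w n (rad n))//.
  by apply: mu_le; [exact: measurable_cball..|exact: cball_mono].
by rewrite lexx/= ltr_pMl ?ltr1n// rad_gt0.
Qed.

Lemma mu_setT : mu setT = 1%E.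
Proof.
rewrite muE; have -> : [set t : R | 0 <= t < 1 /\ (setT : set V) (pt (code t))] = [set` `[(0 : R), 1[].
  by apply/seteqP; split => t /=; rewrite in_itv//= => -[].
by rewrite lebesgue_measure_itv/= lte_fin ltr01 oppr0 adde0.
Qed.

Lemma mu_le1 A : measurable A -> (mu A <= 1)%E.
Proof. by move=> mA; rewrite -mu_setT; apply: mu_le. Qed.

(** All weights are positive, so every cylinder is charged. Conversely a point of the support is a
    limit of coded points, and [pt_closure] provides its word. *)
Lemma supp_pt x : supp mu x <-> exists2 w, valid N w & x = pt w.
Proof.
split=> [sx|[w wv ->] U oU Uw]; last first.
  have [e e0 He] := nbhs_edist (open_nbhs_nbhs (conj oU Uw)).
  have [n hn] := rad_small d_gt0 m_gt0 mM e0.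
  apply: (@lt_le_trans _ _ (cylmass w n)%:E); first by rewrite lte_fin cylmass_gt0.
  apply: le_trans (mu_cball_ge wv (lexx _)) _.
  apply: mu_le; [exact: measurable_cball|exact: measurable_open_set|].
  by move=> y /= h; apply: He; apply: le_lt_trans hn.
have H n : exists w, valid N w /\ edist (pt w) x <= rad n.
  have := sx _ (@open_eball R d x (rad n)).
  rewrite /= edistxx rad_gt0// => /(_ isT); rewrite muE => h.
  have [t [t01 ht]] : [set t : R | 0 <= t < 1 /\ edist x (pt (code t)) < rad n] !=set0.
    by apply/set0P; apply: contraTneq h => ->; rewrite measure0 ltxx.
  exists (code t); split; first exact: code_valid.
  by rewrite edistC ltW.
have [f hf] := choice H.
have [||w [wv -> _]] := @pt_closure R d m M d_gt0 m_gt0 mM x f.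
- by move=> n; case: (hf n).
- by move=> n; case: (hf n).
by exists w.
Qed.

Lemma compact_supp : compact (supp mu : set 'rV[R]_d).
Proof.
apply: bounded_closed_compact; last first.
  rewrite -openC; apply: open_edist => x /= nx.
  have [U [oU Ux mU]] : exists U : set 'rV[R]_d, [/\ open U, U x & ~ (0 < mu U)%E].
    apply: contrapT => h; apply: nx => U oU Ux.
    by apply: contrapT => h'; apply: h; exists U.
  have [e e0 He] := nbhs_edist (open_nbhs_nbhs (conj oU Ux)).
  by exists e => // y xy sy; apply: mU; apply: sy => //; exact: He.
exists (`|pt (fun=> 0%N)| + d%:R); split; first exact: num_real.
move=> C hC x /supp_pt[w wv ->]; apply: ltW; apply: le_lt_trans hC.
rewrite -[X in `|X|](subrK (pt (fun=> 0%N))) addrC.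
apply: le_trans (ler_normD _ _) _; rewrite lerD2l//.
have h : edist (pt w) (pt (fun=> 0%N)) <= d%:R.
  have := @pt_agree 0 w (fun=> 0%N).
  by rewrite [X in (_ -> _ <= X) -> _](_ : _ = d%:R * side R M 0)// side0 mulr1; apply.
rewrite [leLHS](_ : _ = mx_norm (pt w - pt (fun=> 0%N)))// mx_normrE.
apply: bigmax_le => // -[i j] _ /=; rewrite (ord1 i).
by apply: le_trans h; have := edist_coord (pt w) (pt (fun=> 0%N)) j; rewrite !mxE.
Qed.

End CantorMeasure.

(** * Limits at 0+ and Hausdorff content *)

Section LowerUpperLimits.
Variable R : realType.
Implicit Types (f : R -> \bar R) (a : \bar R) (b r v : R).

Lemma ereal_between (x y : \bar R) : (x < y)%E -> exists b, (x < b%:E)%E /\ (b%:E < y)%E.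
Proof.
case: x => [x||]; case: y => [y||] //= xy.
- by exists ((x + y) / 2); rewrite !lte_fin; move: xy; rewrite lte_fin; lra.
- by exists (x + 1); rewrite lte_fin ltry; lra.
- by exists (y - 1); rewrite lte_fin ltNyr; lra.
- by exists 0; rewrite ltNyr ltry.
Qed.

Lemma liminf0_gt f b : (b%:E < liminf0 f)%E ->
  exists2 e, 0 < e & forall r, 0 < r < e -> (b%:E <= f r)%E.
Proof.
move=> /ereal_sup_gt[_ [e /= e0 <-] h]; exists e => // r re.
by apply: (le_trans (ltW h)); apply: ereal_inf_lbound; exists r.
Qed.

Lemma liminf0_lt f b : (liminf0 f < b%:E)%E ->
  forall e, 0 < e -> exists2 r, 0 < r < e & (f r < b%:E)%E.
Proof.
move=> h e e0; have : (ereal_inf (f @` [set r | (0 < r < e)%R]) < b%:E)%E.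
  by apply: le_lt_trans h; apply: ereal_sup_ubound; exists e.
by move=> /ereal_inf_lt[_ [r /= re <-] hr]; exists r.
Qed.

Lemma le_liminf0 f a : (forall b, (b%:E < a)%E ->
    exists2 e, 0 < e & forall r, 0 < r < e -> (b%:E <= f r)%E) -> (a <= liminf0 f)%E.
Proof.
move=> h; rewrite leNgt; apply/negP => /ereal_between[b [h1 /h[e e0 he]]].
move: h1; rewrite ltNge => /negP; apply.
apply: le_trans (ereal_sup_ubound _); last by exists e.
by apply: le_ereal_inf_tmp => _ [r /= re <-]; exact: he.
Qed.

Lemma liminf0_le f a : (forall b, (a < b%:E)%E ->
    forall e, 0 < e -> exists2 r, 0 < r < e & (f r <= b%:E)%E) -> (liminf0 f <= a)%E.
Proof.
move=> h; rewrite leNgt; apply/negP => /ereal_between[b [h1 h2]].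
have [e e0 he] := liminf0_gt h2; have [c [h3 h4]] := ereal_between h1.
have [r re] := h _ h3 _ e0; rewrite leNgt => /negP; apply.
by apply: lt_le_trans h4 (he _ re).
Qed.

Lemma limsup0_le f a : (forall b, (a < b%:E)%E ->
    exists2 e, 0 < e & forall r, 0 < r < e -> (f r <= b%:E)%E) -> (limsup0 f <= a)%E.
Proof.
move=> h; rewrite leNgt; apply/negP => /ereal_between[b [/h[e e0 he] h2]].
move: h2; rewrite ltNge => /negP; apply.
apply: le_trans (ereal_inf_lbound _) _; first by exists e.
by apply: ge_ereal_sup => _ [r /= re <-]; exact: he.
Qed.

Lemma liminf0_le_limsup0 f : (liminf0 f <= limsup0 f)%E.
Proof.
rewrite leNgt; apply/negP => /ereal_between[b [h1 h2]].
have [e e0 he] := liminf0_gt h2.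
have [_ [e' /= e0' <-] h3] := ereal_inf_lt h1.
have m0 : 0 < Num.min e e' by rewrite lt_min e0.
have h4 : 0 < Num.min e e' / 2 by rewrite divr_gt0.
have h5 : Num.min e e' / 2 < Num.min e e' by lra.
move: h5; rewrite lt_min => /andP[h5 h6].
move: h3; rewrite ltNge => /negP; apply.
apply: le_trans (he (Num.min e e' / 2) _) _; first by rewrite h4.
by apply: ereal_sup_ubound; exists (Num.min e e' / 2) => //=; rewrite h4.
Qed.

Lemma eln_ratio_ge r v b : 0 < r < 1 -> 0 < v ->
  (b%:E <= eln v%:E * ((ln r)^-1)%:E)%E = (ln v <= b * ln r).
Proof.
move=> /andP[r0 r1] v0; rewrite /= v0 -EFinM lee_fin.
by rewrite ler_ndivlMr// ln_lt0// r0.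
Qed.

Lemma eln_ratio_le r v b : 0 < r < 1 -> 0 < v ->
  (eln v%:E * ((ln r)^-1)%:E <= b%:E)%E = (b * ln r <= ln v).
Proof.
move=> /andP[r0 r1] v0; rewrite /= v0 -EFinM lee_fin.
by rewrite ler_ndivrMr// ln_lt0// r0.
Qed.

(** The logarithm of 0 is -oo and ln r is negative: balls of mass 0 count as infinite local
    dimension. *)
Lemma eln_ratio0 r : 0 < r < 1 -> (eln 0%:E * ((ln r)^-1)%:E = +oo)%E.
Proof.
by move=> /andP[r0 r1]; rewrite /= ltxx lt0_mulNye ?lte_fin ?invr_lt0 ?ln_lt0 ?r0.
Qed.

End LowerUpperLimits.

Section HausdorffContent.
Variables (R : realType) (d : nat).

Lemma diam_cball (c : 'rV[R]_d) r : 0 <= r ->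
  (0 <= diam (cball c r) <= (2 * r)%:E)%E.
Proof.
move=> r0; apply/andP; split.
  by apply: ereal_sup_ubound; exists (c, c); rewrite //= /cball/= edistxx.
apply: ge_ereal_sup => _ [[x y] [/= hx hy] <-]; rewrite lee_fin.
apply: le_trans (edist_triangle c _ _) _; rewrite edistC mulr_natl mulr2n.
exact: lerD.
Qed.

Lemma diam_set0 : diam (set0 : set 'rV[R]_d) = -oo%E.
Proof.
rewrite /diam (_ : [set _ | _ in _] = set0) ?ereal_sup0//.
by apply/seteqP; split => // ? [[x y] [[]]].
Qed.

(** The finite lists are flattened into one sequence through a bijection of nat with pairs. Spare
    indices receive the empty set, of diameter -oo, whose [fine] is 0; its s-th power is 0 because s
    > 0. *)
Lemma hcontent_le (T : eqType) (E : set 'rV[R]_d) (s delta : R) (L : nat -> seq T)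
    (c : nat -> T -> 'rV[R]_d) (rho : nat -> R) :
  0 < s -> (forall n, 0 <= rho n) -> (forall n, 2 * rho n <= delta) ->
  (forall x, E x -> exists n, exists2 y, y \in L n & cball (c n y) (rho n) x) ->
  (hcontent s delta E <= \sum_(0 <= n <oo) ((size (L n))%:R * (2 * rho n) `^ s)%:E)%E.
Proof.
move=> s0 rho0 rhod cov.
have /card_set_bijP[e ebij] : ([set: nat] #= [set: nat * nat])%card.
  by rewrite card_eq_sym; exact: card_nat2.
pose B n j : set 'rV[R]_d :=
  if onth (L n) j is Some y then cball (c n y) (rho n) else set0.
pose U i := B (e i).1 (e i).2.
pose g (k : nat * nat) : \bar R := if (k.2 < size (L k.1))%N then ((2 * rho k.1) `^ s)%:E else 0%E.
have g0 k : (0 <= g k)%E by rewrite /g; case: ifP => // _; rewrite lee_fin powR_ge0.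
apply: (@le_trans _ _ (\sum_(0 <= i <oo) ((fine (diam (U i))) `^ s)%:E)%E).
  apply: ereal_inf_lbound; exists U => //; split => [x Ex|i].
    have [n [y yL hy]] := cov x Ex; pose j := index y (L n).
  have Ly : onth (L n) j = Some y.
    by rewrite onthE (nth_map y) ?index_mem// nth_index.
    have [_ _ +] := ebij => /(_ (n, j) I)[i _ ei].
    by exists i => //; rewrite /U ei/= /B Ly.
  rewrite /U /B; case: onth => [y|]; last by rewrite diam_set0 leNye.
  by case/andP: (diam_cball (c (e i).1 y) (rho0 (e i).1)) => _ h; apply: le_trans h _; rewrite lee_fin.
apply: (@le_trans _ _ (\sum_(0 <= i <oo) g (e i))%E).
  apply: lee_nneseries => [i _ _|i _]; first by rewrite lee_fin powR_ge0.
  rewrite /U /B /g.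
  case: ifPn => [hj|]; last first.
    rewrite -leqNgt => hj; rewrite onth_default//.
    by rewrite diam_set0/= powR0// gt_eqF.
  case: onth => [y|]; last by rewrite diam_set0/= powR0 ?lee_fin ?powR_ge0// gt_eqF.
  rewrite lee_fin; case/andP: (diam_cball (c (e i).1 y) (rho0 (e i).1)).
  case: diam => [D||]//= D0 D1; apply: ge0_ler_powR => //=; first exact: ltW.
  by rewrite nnegrE mulr_ge0.
rewrite nneseries_esumT// -(@reindex_esum _ _ _ setT setT e g ebij).
rewrite (_ : setT = setT `*`` (fun=> setT)); last first.
  by apply/seteqP; split => // -[].
rewrite -(@esum_esum _ _ _ setT (fun=> setT) (fun i j => g (i, j)))//.
rewrite -nneseries_esumT; last first.
  by move=> n; apply: esum_ge0.
apply: lee_nneseries => [n _ _|n _]; first by apply: esum_ge0.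
have -> : (\esum_(j in [set: nat]) g (n, j) = \esum_(j in `I_(size (L n))) ((2 * rho n) `^ s)%:E)%E.
  rewrite [RHS]esum_mkcond; apply: eq_esum => j _; rewrite /g/=.
  by rewrite (_ : (j \in `I_ _) = (j < size (L n))%N)//; apply/idP/idP; rewrite inE.
rewrite esum_fset//; last by move=> j _; rewrite lee_fin powR_ge0.
by rewrite -fsbig_ord sumEFin sumr_const card_ord -[X in (X%:E <= _)%E]mulr_natl.
Qed.

End HausdorffContent.

(** * Scales *)

Section Eventually.

Definition evt (P : nat -> Prop) := exists n0, forall n, (n0 <= n)%N -> P n.

Lemma evtW (P : nat -> Prop) : (forall n, P n) -> evt P.
Proof. by move=> h; exists 0%N. Qed.

Lemma evt_ge k : evt (fun n => (k <= n)%N).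
Proof. by exists k. Qed.

Lemma evtI (P Q : nat -> Prop) : evt P -> evt Q -> evt (fun n => P n /\ Q n).
Proof.
move=> [n hn] [k hk]; exists (maxn n k) => l; rewrite geq_max => /andP[h1 h2].
by split; [exact: hn|exact: hk].
Qed.

Lemma evt_mono (P Q : nat -> Prop) : (forall n, P n -> Q n) -> evt P -> evt Q.
Proof. by move=> h [n hn]; exists n => k /hn/h. Qed.

Lemma evt_mono2 (P1 P2 Q : nat -> Prop) : (forall n, P1 n -> P2 n -> Q n) ->
  evt P1 -> evt P2 -> evt Q.
Proof. by move=> h h1 h2; apply: evt_mono (evtI h1 h2) => n [] /h; apply. Qed.

Lemma evtS (P : nat -> Prop) : evt P -> evt (fun n => P n.+1).
Proof. by move=> [n hn]; exists n => k nk; apply: hn; apply: leqW. Qed.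

Lemma evt_pred (P : nat -> Prop) : evt P -> evt (fun n => P n.-1).
Proof. by move=> [n hn]; exists n.+1 => k nk; apply: hn; case: k nk. Qed.

End Eventually.

Section Scales.
Variables (R : realType) (M : nat -> nat).
Hypothesis M_ge4 : forall k, (4 <= M k)%N.
Hypothesis M_oo : forall c : R, exists n0, forall n, (n0 <= n)%N -> c <= (M n)%:R.

Definition logM k : R := ln (M k)%:R.
Definition scale n : R := \sum_(k < n) logM k.

Hypothesis logM_small : forall e : R, 0 < e -> evt (fun n => logM n <= e * scale n).

Lemma logM_gt0 k : 0 < logM k.
Proof. by apply: ln_gt0; rewrite ltr1n; apply: leq_trans (M_ge4 k). Qed.

Lemma scaleS n : scale n.+1 = scale n + logM n.
Proof. by rewrite /scale big_ord_recr. Qed.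

Lemma scale_ge0 n : 0 <= scale n.
Proof. by apply: sumr_ge0 => k _; exact: ltW (logM_gt0 k). Qed.

Lemma scale_gt0 n : 0 < scale n.+1.
Proof. by rewrite scaleS ltr_wpDl ?scale_ge0 ?logM_gt0. Qed.

Lemma scale_mono i j : (i <= j)%N -> scale i <= scale j.
Proof.
move=> /subnK <-; elim: (j - i)%N => [|k IH]; first by rewrite add0n.
by rewrite addSn scaleS; apply: le_trans IH _; rewrite lerDl ltW ?logM_gt0.
Qed.

Lemma sideE n : side R M n = expR (- scale n).
Proof.
elim: n => [|n IH]; first by rewrite /side /scale !big_ord0 oppr0 expR0.
rewrite /side big_ord_recr/= scaleS opprD expRD -IH; congr (_ * _).
by rewrite expRN lnK// posrE ltr0n; apply: leq_trans (M_ge4 n).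
Qed.

(** The increments [logM] tend to infinity, so [scale] outgrows every linear function; this pays for
    factors that occur once per level. *)
Lemma scale_big K : evt (fun n => K * n.+1%:R <= scale n).
Proof.
have [n0 h0] := M_oo (expR (2 * `|K|)).
have hu n : (n0 <= n)%N -> 2 * `|K| <= logM n.
  by move=> nn; rewrite -[leLHS]expRK ler_ln ?posrE ?expR_gt0 ?h0// ltr0n; apply: leq_trans (M_ge4 n).
exists (n0 + (n0 + 1))%N => n hn.
apply: (@le_trans _ _ (`|K| * n.+1%:R)); first by rewrite ler_wpM2r// ler_norm.
have key k : 2 * `|K| * k%:R <= scale (n0 + k).
  elim: k => [|k IH]; first by rewrite mulr0 scale_ge0.
  by rewrite addnS scaleS -[k.+1%:R]natr1 mulrDr mulr1 lerD// hu// leq_addr.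
have := key (n - n0)%N; rewrite subnKC; last by apply: leq_trans hn; exact: leq_addr.
apply: le_trans; rewrite -mulrA mulrCA ler_wpM2l// -natrM ler_nat.
lia.
Qed.

Lemma scale_oo K : evt (fun n => K <= scale n).
Proof.
apply: evt_mono (scale_big `|K|) => n; apply: le_trans.
by apply: le_trans (ler_norm K) _; rewrite ler_peMr// ler1n.
Qed.

Lemma const_small K e : 0 < e -> evt (fun n => K <= e * scale n).
Proof.
by move=> e0; apply: evt_mono (scale_oo (K / e)) => n; rewrite ler_pdivrMr// mulrC.
Qed.

Lemma logM_const_small K K' e : 0 < e -> evt (fun n => K * logM n + K' <= e * scale n).
Proof.
move=> e0; have e1 : 0 < e / 2 by rewrite divr_gt0.
have K1 : 0 < `|K| + 1 by rewrite ltr_wpDl.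
have e2 : 0 < e / 2 / (`|K| + 1) by rewrite divr_gt0.
apply: evt_mono2 (logM_small e2) (const_small K' e1) => n h1 h2.
have -> : e * scale n = e / 2 * scale n + e / 2 * scale n by rewrite -mulrDl -splitr.
apply: lerD => //; apply: (@le_trans _ _ ((`|K| + 1) * logM n)).
  rewrite ler_wpM2r ?(ltW (logM_gt0 n))//; apply: le_trans (ler_norm K) _.
  by rewrite lerDl.
move: h1; rewrite -(ler_pM2l K1) => /le_trans; apply.
by rewrite mulrA [(_ + 1) * _]mulrC divfK ?gt_eqF.
Qed.

Lemma logM_pred_small K K' e : 0 < e ->
  evt (fun n => K * logM n.-1 + K' <= e * scale n).
Proof.
move=> e0; apply: evt_mono (evt_pred (logM_const_small K K' e0)) => n /le_trans; apply.
by rewrite ler_pM2l// scale_mono// leq_pred.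
Qed.

(** A Cesaro argument: from some level on the increments obey the bound with e/2, and the other half
    absorbs the initial levels. *)
Lemma sum_scale_le (f : nat -> R) c :
  (forall e, 0 < e -> evt (fun k => f k <= (c + e) * logM k)) ->
  forall e, 0 < e -> evt (fun n => \sum_(k < n) f k <= (c + e) * scale n).
Proof.
move=> H e e0; have e1 : 0 < e / 2 by rewrite divr_gt0.
have [k0 hk0] := H _ e1.
pose C := \sum_(k < k0) f k - (c + e / 2) * scale k0.
have key n : \sum_(k < k0 + n) f k <= C + (c + e / 2) * scale (k0 + n).
  elim: n => [|n IH]; first by rewrite addn0 /C subrK.
  rewrite addnS big_ord_recr/= scaleS mulrDr addrA lerD//.
  by apply: hk0; exact: leq_addr.
apply: evt_mono2 (evt_ge k0) (const_small C e1) => n hn h.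
have := key (n - k0)%N; rewrite subnKC// => /le_trans; apply.
apply: le_trans (lerD h (lexx _)) _; rewrite -mulrDl; apply: ler_wpM2r; first exact: scale_ge0.
lra.
Qed.

Lemma sum_scale_ge (f : nat -> R) c :
  (forall e, 0 < e -> evt (fun k => (c - e) * logM k <= f k)) ->
  forall e, 0 < e -> evt (fun n => (c - e) * scale n <= \sum_(k < n) f k).
Proof.
move=> H e e0; have H1 e' : 0 < e' -> evt (fun k => - f k <= (- c + e') * logM k).
  by move=> /H; apply: evt_mono => k; rewrite lerNl -mulNr opprD opprK.
by apply: evt_mono (sum_scale_le H1 e0) => n; rewrite sumrN lerNl -mulNr opprD opprK.
Qed.

Lemma radE d n : (0 < d)%N -> rad R d M n = expR (ln d%:R - scale n).
Proof. by move=> d0; rewrite /rad sideE expRD lnK// posrE ltr0n. Qed.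

Lemma ln_rad d n : (0 < d)%N -> ln (rad R d M n) = ln d%:R - scale n.
Proof. by move=> d0; rewrite radE// expRK. Qed.

End Scales.

(** * Covering by heavy cylinders *)

Section Covering.
Variables (R : realType) (d : nat) (m M : nat -> nat) (p : nat -> nat -> R).
Hypothesis d_gt0 : (0 < d)%N.
Hypothesis m_gt0 : forall k, (0 < m k)%N.
Hypothesis mM : forall k, (4 * d * m k <= M k)%N.
Hypothesis M_oo : forall c : R, exists n0, forall n, (n0 <= n)%N -> c <= (M n)%:R.
Hypothesis logM_small : forall e : R, 0 < e -> evt (fun n => logM R M n <= e * scale R M n).
Let N k := (m k ^ d)%N.
Hypothesis p_gt0 : forall k i, (i < N k)%N -> 0 < p k i.

Let M_ge4 k : (4 <= M k)%N.
Proof. by apply: leq_trans (mM k); rewrite -mulnA leq_pmulr// muln_gt0 d_gt0 m_gt0. Qed.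
Let N_gt0 k : (0 < N k)%N. Proof. by rewrite expn_gt0 m_gt0. Qed.
Let pt := @pt R d m M.
Let rad := @rad R d M.
Let S := scale R M.
Let cylmass := cylmass p.
Let cylmass_mkseq w n : cylmass (nth 0%N (mkseq w n)) n = cylmass w n.
Proof. by apply: cylmass_agree; apply: agree_sym; exact: agree_mkseq. Qed.

Definition Zsum q n : R := \sum_(s <- words N n) cylmass (nth 0%N s) n `^ q.

Lemma powR_ln (x q : R) : 0 < x -> x `^ q = expR (q * ln x).
Proof. by move=> x0; rewrite /powR gt_eqF. Qed.

(** For q > 0 these are the words of mass at least exp(-c S / q), for q < 0 those of mass at most
    this value: one definition serves both sides of the spectrum. *)
Definition heavy q c n :=
  [seq s <- words N n | - c * S n <= q * ln (cylmass (nth 0%N s) n)].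

(** Markov's inequality for the q-th powers of the masses. *)
Lemma heavy_count q c t n : Zsum q n <= expR (t * S n) ->
  (size (heavy q c n))%:R <= expR ((c + t) * S n).
Proof.
move=> h; suff : (size (heavy q c n))%:R * expR (- c * S n) <= Zsum q n.
  move=> h'; have := le_trans h' h.
  rewrite -ler_pdivlMr ?expR_gt0// -expRN -expRD => /le_trans; apply.
  by rewrite ler_expR; lra.
apply: (@le_trans _ _ (\sum_(s <- heavy q c n) cylmass (nth 0%N s) n `^ q)).
  have -> : (size (heavy q c n))%:R * expR (- c * S n) =
      \sum_(s <- heavy q c n) expR (- c * S n).
    by rewrite big_const_seq count_predT iter_addr addr0 mulr_natl.
  rewrite [leLHS]big_seq [leRHS]big_seq.
  apply: ler_sum => s; rewrite mem_filter => /andP[hs sw].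
  rewrite powR_ln ?ler_expR//; apply: (cylmass_gt0 p_gt0).
  exact: words_valid_seq sw.
apply: ler_sum_uniq; rewrite ?filter_uniq ?words_uniq//.
  by move=> s; rewrite mem_filter => /andP[].
by move=> s; exact: powR_ge0.
Qed.

Lemma hcontent_ge0 s delta (E : set 'rV[R]_d) : (0 <= hcontent s delta E)%E.
Proof.
apply: le_ereal_inf_tmp => _ [U _ <-].
by apply: nneseries_ge0 => i _ _; rewrite lee_fin powR_ge0.
Qed.

(** About exp((c - t) S n) heavy words exist at level n, so balls of radius comparable to [rad n.-1]
    around them have small s-sums for s > c - t. The word need only come within [4 * rad n.-1] of x,
    because near a sphere the estimate is known for a shifted word only. *)
Lemma cover_null (E : set 'rV[R]_d) q t c s :
  (forall e, 0 < e -> evt (fun n => Zsum q n <= expR ((- t + e) * S n))) ->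
  (forall x, E x -> forall e, 0 < e -> forall n0, exists n w,
     [/\ (n0 <= n)%N, valid N w, edist (pt w) x <= 4 * rad n.-1 &
         - (c + e) * S n <= q * ln (cylmass w n)]) ->
  0 < s -> c - t < s -> hmeasure s E = 0%E.
Proof.
move=> Zle Ex s0 cts; apply/eqP; rewrite eq_le; apply/andP; split; last first.
  by apply: le_trans (hcontent_ge0 s 1 E) (ereal_sup_ubound _); exists 1 => /=.
apply: ge_ereal_sup => _ [delta /= delta0 <-]; apply/lee_addgt0Pr => eta eta0.
rewrite add0e; set g := s - (c - t); have g0 : 0 < g by rewrite subr_gt0.
have g8 : 0 < g / 8 by rewrite divr_gt0.
(* The exponent left over is g/2; with [K * n.+1%:R <= S n], the quantity g/2 [S n] pays for the
   factor (10 d)^s, for eta and for 2^(n+1). *)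
pose K := 2 / g * (`|s * ln (10 * d%:R)| + `|ln eta| + ln 2).
have ev1 : evt (fun n => (size (heavy q (c + g / 8) n))%:R <= expR ((c - t + g / 4) * S n)).
  by apply: evt_mono (Zle _ g8) => n /heavy_count/le_trans; apply; rewrite ler_expR;
    apply: ler_wpM2r; [exact: scale_ge0|lra].
have ev2 : evt (fun n => s * logM R M n.-1 <= g / 4 * S n).
  have g4 : 0 < g / 4 by rewrite divr_gt0.
  by apply: evt_mono (logM_pred_small M_ge4 M_oo logM_small s 0 g4) => n; rewrite addr0.
have ev3 : evt (fun n => K * n.+1%:R <= S n) by exact: scale_big.
have delta10 : 0 < delta / 10 by rewrite divr_gt0.
have [n1 hn1] := rad_small d_gt0 m_gt0 mM delta10.
have [n2 hn2] := evtI (evtI ev1 ev2) (evtI ev3 (evt_ge n1.+1)).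
pose n3 := maxn 1 n2.
(* No ball is taken below level [n3]; the [maxn] in [rho] keeps the radii small there too, since the
   diameter bound is required at every index. *)
pose L n := if (n < n3)%N then [::] else heavy q (c + g / 8) n.
pose rho n := 5 * rad (maxn n n3).-1.
have rho0 n : 0 <= rho n by rewrite mulr_ge0// ltW// (@rad_gt0 R d m M).
have n3_1 : (n1 <= n3.-1)%N.
  have [_ [_ h]] := hn2 n2 (leqnn _); rewrite /n3.
  by rewrite (maxn_idPr _)//; [case: (n2) h|apply: leq_trans h].
apply: le_trans (@hcontent_le R d _ E s delta L (fun n w => pt (nth 0%N w)) rho s0 rho0 _ _) _.
- move=> n; rewrite /rho mulrA -ler_pdivlMl//.
  apply: ltW; apply: (@le_lt_trans _ _ (rad n1)).
    apply: (@rad_mono R d m M) => //; apply: leq_trans n3_1 _.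
    by rewrite -!subn1 leq_sub2r// leq_maxr.
  by apply: lt_le_trans hn1 _; rewrite mulrC -natrM.
- move=> x /Ex/(_ _ g8 n3)[n [w [n3n wv dx hw]]].
  exists n, (mkseq w n); first rewrite /L ltnNge n3n /heavy mem_filter mkseq_words// andbT.
    by rewrite cylmass_mkseq.
  rewrite /cball/= /rho (maxn_idPl n3n).
  apply: le_trans (edist_triangle (pt w) _ _) _.
  have h1 : edist (pt (nth 0%N (mkseq w n))) (pt w) <= rad n.
    apply: (@pt_agree R d m M) => //; apply: agree_sym; exact: agree_mkseq.
  have h2 : rad n <= rad n.-1 by apply: (@rad_mono R d m M) => //; exact: leq_pred.
  lra.
apply: le_trans (epsilon_trick0 xpredT (ltW eta0)).
apply: lee_nneseries => [n _ _|n _]; first by rewrite lee_fin mulr_ge0 ?powR_ge0.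
rewrite lee_fin /L; case: ltnP => n3n; first by rewrite mul0r divr_ge0 ?ltW.
rewrite /rho (maxn_idPl n3n).
have n2n : (n2 <= n)%N by apply: leq_trans n3n; exact: leq_maxr.
have [[h1 h2] [h3 _]] := hn2 n n2n.
have n0 : (0 < n)%N by apply: leq_trans n3n; exact: leq_maxl.
have Sn : S n = S n.-1 + logM R M n.-1 by rewrite -{1}(prednK n0) /S scaleS.
apply: le_trans (ler_wpM2r (powR_ge0 _ _) h1) _.
have r0 : 0 < rad n.-1 by exact: (@rad_gt0 R d m M).
have d0 : (0 : R) < d%:R by rewrite ltr0n.
have r10 : 0 < 2 * 5 * rad n.-1 by rewrite pmulr_rgt0.
rewrite mulrA powR_ln// lnM ?posrE// (ln_rad R M_ge4)//.
rewrite -[X in _ <= X / _](@lnK _ eta)// -[(2 ^ n.+1)%:R](@lnK _)?posrE ?ltr0n ?expn_gt0//.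
rewrite -expRN -!expRD ler_expR natrX lnXn//.
have e10 : ln (2 * 5) + (ln d%:R - scale R M n.-1) = ln (10 * d%:R) - S n.-1 :> R.
  rewrite (lnM (_ : 10 \is Num.pos)) ?posrE// -natrM; rewrite /S; ring.
rewrite e10.
have h4 : `|s * ln (10 * d%:R)| + `|ln eta| + ln 2 *+ n.+1 <= g / 2 * S n.
  have g2 : 0 < g / 2 by rewrite divr_gt0.
  move: h3; rewrite -(ler_pM2l g2) => h; apply: le_trans h.
  have -> : g / 2 * (K * n.+1%:R) =
      (`|s * ln (10 * d%:R)| + `|ln eta|) * n.+1%:R + ln 2 *+ n.+1.
    by rewrite -[ln 2 *+ _]mulr_natr /K; field; rewrite gt_eqF.
  by rewrite lerD2r ler_peMr ?addr_ge0// ler1n.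
have h5 := ler_norm (s * ln (10 * d%:R)); have h6 := ler_norm (- ln eta).
rewrite normrN in h6.
have -> : (c - t + g / 4) * S n = s * S n - g * S n + g / 4 * S n by rewrite /g; ring.
have -> : s * (ln (10 * d%:R) - S n.-1) = s * ln (10 * d%:R) - s * S n + s * logM R M n.-1.
  by rewrite Sn; ring.
lra.
Qed.

(** A single heavy word already gives 1 <= exp((c - t + e) S n). The resulting 0 <= c - t is what
    empties the level sets where the conjugate would be negative or -oo. *)
Lemma cover_dim (E : set 'rV[R]_d) q t c :
  (forall e, 0 < e -> evt (fun n => Zsum q n <= expR ((- t + e) * S n))) ->
  (forall x, E x -> forall e, 0 < e -> forall n0, exists n w,
     [/\ (n0 <= n)%N, valid N w, edist (pt w) x <= 4 * rad n.-1 &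
         - (c + e) * S n <= q * ln (cylmass w n)]) ->
  E !=set0 -> 0 <= c - t /\ (hdim E <= (c - t)%:E)%E.
Proof.
move=> Zle Ex E0; have ct0 : 0 <= c - t.
  have [x xE] := E0; apply/ler_addgt0Pr => e e0.
  have e2 : 0 < e / 2 by rewrite divr_gt0.
  have [n1 hn1] := Zle _ e2.
  have [n [w [hn wv _ hw]]] := Ex x xE _ e2 n1.+1.
  have := @heavy_count q (c + e / 2) _ _ (hn1 n (ltnW hn)).
  have sn : 0 < S n by case: n hn {hw} => // n _; exact: scale_gt0.
  have h1 : (1 : R) <= (size (heavy q (c + e / 2) n))%:R.
    rewrite ler1n lt0n size_eq0; apply/eqP => h.
    have : mkseq w n \in heavy q (c + e / 2) n.
      rewrite mem_filter mkseq_words// andbT.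
      by rewrite cylmass_mkseq.
    by rewrite h.
  move=> /(le_trans h1); rewrite -[X in X <= _]expR0 ler_expR pmulr_lge0//; lra.
split => //; rewrite /hdim asboolF; last by apply/eqP/set0P.
rewrite leNgt; apply/negP => /ereal_between[s [h1 h2]].
move: h2; rewrite ltNge => /negP; apply.
rewrite lte_fin in h1; have s0 : 0 < s by exact: le_lt_trans h1.
by apply: ereal_inf_lbound; exists s => //; split => //; exact: cover_null Ex s0 h1.
Qed.

End Covering.

(** * Local dimensions and upper bounds *)

Section Local.
Variables (R : realType) (d : nat) (m M : nat -> nat) (p : nat -> nat -> R).
Hypothesis d_gt0 : (0 < d)%N.
Hypothesis m_gt0 : forall k, (0 < m k)%N.
Hypothesis mM : forall k, (4 * d * m k <= M k)%N.
Hypothesis M_oo : forall c : R, exists n0, forall n, (n0 <= n)%N -> c <= (M n)%:R.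
Hypothesis logM_small : forall e : R, 0 < e -> evt (fun n => logM R M n <= e * scale R M n).
Let N k := (m k ^ d)%N.
Hypothesis p_gt0 : forall k i, (i < N k)%N -> 0 < p k i.
Hypothesis p_sum : forall k, \sum_(0 <= i < N k) p k i = 1.
Let V := BorelV R d.
Variable mu : {measure set V -> \bar R}.
Hypothesis muE : forall A : set V,
  mu A = lebesgue_measure [set t : R | 0 <= t < 1 /\ A (@pt R d m M (code N p t))].

Let M_ge4 k : (4 <= M k)%N.
Proof. by apply: leq_trans (mM k); rewrite -mulnA leq_pmulr// muln_gt0 d_gt0 m_gt0. Qed.
Let pt := @pt R d m M.
Let rad := @rad R d M.
Let S := scale R M.
Let cylmass := cylmass p.
Let rad_gt0 n : 0 < rad n. Proof. exact: (@rad_gt0 R d m M). Qed.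
Let cylmass_gt0 w n : valid N w -> 0 < cylmass w n. Proof. exact: cylmass_gt0. Qed.
Let mu_cball_ge w n r : valid N w -> rad n <= r ->
  ((cylmass w n)%:E <= mu (cball (pt w) r))%E.
Proof. exact: (@mu_cball_ge R d m M p). Qed.
Let mu_cball_le w n r : valid N w -> r < 3 * rad n ->
  (mu (cball (pt w) r) <= (cylmass w n)%:E)%E.
Proof. exact: (@mu_cball_le R d m M p). Qed.

Lemma ln_mono (x y : R) : 0 < x -> x <= y -> ln x <= ln y.
Proof. by move=> x0 xy; rewrite ler_ln ?posrE//; exact: lt_le_trans xy. Qed.

Lemma mu_cball_fin (x : 'rV[R]_d) r : mu (cball x r) = (fine (mu (cball x r)))%:E.
Proof.
rewrite fineK// ge0_fin_numE//; apply: le_lt_trans (ltry 1).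
by apply: (mu_le1 muE); exact: measurable_cball.
Qed.

Lemma rad_bracket n0 r : 0 < r < rad n0 ->
  exists n, [/\ (n0 <= n)%N, rad n.+1 <= r & r < rad n].
Proof.
move=> /andP[r0 rn]; have [k hk] := rad_small d_gt0 m_gt0 mM r0.
have ex : exists k, rad k <= r by exists k; exact: ltW.
case: (ex_minnP ex) => -[|n] hn hmin.
  by have := lt_le_trans rn (@rad_mono R d m M d_gt0 m_gt0 mM _ _ (leq0n n0)); rewrite ltNge hn.
exists n; split => //.
  rewrite leqNgt; apply/negP => h.
  by have := lt_le_trans rn (le_trans (@rad_mono R d m M d_gt0 m_gt0 mM _ _ h) hn); rewrite ltxx.
by rewrite ltNge; apply/negP => /hmin; rewrite ltnn.
Qed.

Lemma ln_bracket n r : rad n.+1 <= r -> r < rad n ->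
  `|ln r + S n| <= logM R M n + ln d%:R.
Proof.
move=> h1 h2; have r0 : 0 < r by apply: lt_le_trans h1.
have := ln_mono (rad_gt0 n.+1) h1; rewrite (ln_rad R M_ge4)// scaleS => h3.
have := ln_mono r0 (ltW h2); rewrite (ln_rad R M_ge4)// => h4.
have ld : 0 <= ln d%:R :> R by apply: ln_ge0; rewrite ler1n.
have u0 := logM_gt0 R M_ge4 n.
rewrite ler_norml /S; lra.
Qed.

Lemma mul_bracket n r b : rad n.+1 <= r -> r < rad n ->
  `|b * ln r + b * S n| <= `|b| * (logM R M n + ln d%:R).
Proof. by move=> h1 h2; rewrite -mulrDr normrM ler_wpM2l// ln_bracket. Qed.

Lemma evt_rad (P : nat -> Prop) (Q : R -> Prop) : evt P ->
  (forall n r, P n -> rad n.+1 <= r -> r < rad n -> Q r) ->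
  exists2 e, 0 < e & forall r, 0 < r < e -> Q r.
Proof.
move=> [n0 h0] H; exists (rad n0) => // r /rad_bracket[n [hn h1 h2]].
exact: H (h0 n hn) h1 h2.
Qed.

Lemma rad_lt1 : evt (fun n => rad n < 1).
Proof.
have [n hn] := rad_small d_gt0 m_gt0 mM (@ltr01 R).
by exists n => k nk; apply: le_lt_trans hn; apply: (@rad_mono R d m M).
Qed.

Section Ratio.
Variables (nu : set V -> \bar R) (w : nat -> nat).
Hypothesis wv : valid N w.
Hypothesis nu_mu : exists2 e, 0 < e & forall r, 0 < r < e ->
  nu (cball (pt w) r) = mu (cball (pt w) r).

Let nu_rad : evt (fun n => forall r, 0 < r < rad n -> nu (cball (pt w) r) = mu (cball (pt w) r)).
Proof.
have [e e0 he] := nu_mu; have [n hn] := rad_small d_gt0 m_gt0 mM e0.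
exists n => k nk r /andP[r0 rk]; apply: he; rewrite r0/=.
by apply: lt_trans rk _; apply: le_lt_trans hn; exact: (@rad_mono R d m M).
Qed.

Let mass_fin r n : 0 < r -> rad n.+1 <= r -> r < rad n -> exists v,
  [/\ mu (cball (pt w) r) = v%:E, cylmass w n.+1 <= v & v <= cylmass w n].
Proof.
move=> r0 h1 h2; exists (fine (mu (cball (pt w) r))); split.
- exact: mu_cball_fin.
- by have := mu_cball_ge wv h1; rewrite mu_cball_fin lee_fin.
- have h3 : r < 3 * rad n by apply: lt_trans h2 _; rewrite ltr_pMl// ltr1n.
  by have := mu_cball_le wv h3; rewrite mu_cball_fin lee_fin.
Qed.

(** For r between [rad n.+1] and [rad n] the mass lies between those of the cylinders of levels n +
    1 and n, and ln r differs from -S n by at most [logM n] + ln d, which is o(S n). The set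
    function [nu] stands for the measure or its restriction to a ball. *)
Lemma ratio_ge b b' : b < b' -> evt (fun n => ln (cylmass w n) <= - b' * S n) ->
  exists2 e, 0 < e & forall r, 0 < r < e -> (b%:E <= Defs.ratio nu (pt w) r)%E.
Proof.
move=> bb H; have e0 : 0 < b' - b by rewrite subr_gt0.
have E := evtI (evtI H nu_rad) (evtI rad_lt1 (logM_const_small M_ge4 M_oo logM_small `|b| (`|b| * ln d%:R) e0)).
apply: evt_rad E _ => n r [[h1 h2] [h3 h4]] r1 r2.
have r0 : 0 < r by apply: lt_le_trans r1.
have [v [hv v1 v2]] := mass_fin r0 r1 r2.
have v0 : 0 < v by apply: lt_le_trans v1; exact: cylmass_gt0.
rewrite /Defs.ratio h2 ?r0// hv eln_ratio_ge ?r0 ?(lt_trans r2)//.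
have {}v2 := ln_mono v0 v2.
have := mul_bracket b r1 r2; rewrite ler_norml mulrDr => /andP[h5 _].
have : (b' - b) * S n = b' * S n - b * S n by ring.
move: h1 h4 h5; rewrite mulNr /S; lra.
Qed.

Lemma ratio_le b b' : b' < b -> evt (fun n => - b' * S n <= ln (cylmass w n)) ->
  exists2 e, 0 < e & forall r, 0 < r < e -> (Defs.ratio nu (pt w) r <= b%:E)%E.
Proof.
move=> bb H; have e0 : 0 < b - b' by rewrite subr_gt0.
have E := evtI (evtI (evtS H) nu_rad) (evtI rad_lt1
  (logM_const_small M_ge4 M_oo logM_small (`|b| + b') (`|b| * ln d%:R) e0)).
apply: evt_rad E _ => n r [[h1 h2] [h3 h4]] r1 r2.
have r0 : 0 < r by apply: lt_le_trans r1.
have [v [hv v1 v2]] := mass_fin r0 r1 r2.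
have v0 : 0 < v by apply: lt_le_trans v1; exact: cylmass_gt0.
rewrite /Defs.ratio h2 ?r0// hv eln_ratio_le ?r0 ?(lt_trans r2)//.
have {}v1 := ln_mono (cylmass_gt0 n.+1 wv) v1.
have := mul_bracket b r1 r2; rewrite ler_norml mulrDr => /andP[_ h5].
have : (b - b') * S n = b * S n - b' * S n by ring.
move: h1 h4 h5; rewrite mulNr /S scaleS; lra.
Qed.

Lemma local_dim_eq a :
  (forall e, 0 < e -> evt (fun n => `|ln (cylmass w n) + a * S n| <= e * S n)) ->
  ldim nu (pt w) = a%:E /\ udim nu (pt w) = a%:E.
Proof.
move=> H; have h1 : (a%:E <= ldim nu (pt w))%E.
  apply: le_liminf0 => b; rewrite lte_fin => ba.
  have e0 : 0 < (a - b) / 2 by rewrite divr_gt0// subr_gt0.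
  apply: (@ratio_ge b (a - (a - b) / 2)); first lra.
  apply: evt_mono (H _ e0) => n; rewrite ler_norml => /andP[_ h].
  by rewrite mulNr mulrBl; lra.
have h2 : (udim nu (pt w) <= a%:E)%E.
  apply: limsup0_le => b; rewrite lte_fin => ba.
  have e0 : 0 < (b - a) / 2 by rewrite divr_gt0// subr_gt0.
  apply: (@ratio_le b (a + (b - a) / 2)); first lra.
  apply: evt_mono (H _ e0) => n; rewrite ler_norml => /andP[h _].
  by rewrite mulNr mulrDl; lra.
have h3 := liminf0_le_limsup0 (Defs.ratio nu (pt w)).
by split; apply/eqP; rewrite eq_le; apply/andP; split => //;
  [apply: le_trans h3 h2|apply: le_trans h1 h3].
Qed.

Lemma local_dim_oo :
  (forall b, evt (fun n => ln (cylmass w n) <= - b * S n)) ->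
  ldim nu (pt w) = +oo%E /\ udim nu (pt w) = +oo%E.
Proof.
move=> H; have h1 : (+oo <= ldim nu (pt w))%E.
  apply: le_liminf0 => b _; apply: (@ratio_ge b (b + 1)) => //; lra.
have h3 := liminf0_le_limsup0 (Defs.ratio nu (pt w)).
by split; apply/eqP; rewrite eq_le leey//=; apply: le_trans h1 _.
Qed.

End Ratio.

Section Upper.
Variable nu : set V -> \bar R.
Hypothesis nu_ge0 : forall x r, (0 <= nu (cball x r))%E.
Hypothesis nu_le : forall x r, (nu (cball x r) <= mu (cball x r))%E.
Hypothesis nu_supp : forall x, supp nu x -> exists2 w, valid N w & x = pt w /\
  forall n0, exists n w', [/\ (n0 <= n)%N, valid N w',
    edist (pt w) (pt w') <= 4 * rad n.+1 &
    ((cylmass w' n.+2)%:E <= nu (cball x (5 * rad n.+1)))%E].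

Let nu_fin x r : nu (cball x r) = (fine (nu (cball x r)))%:E.
Proof.
rewrite fineK// ge0_fin_numE//; apply: le_lt_trans (ltry 1).
by apply: le_trans (nu_le _ _) _; apply: (mu_le1 muE); exact: measurable_cball.
Qed.

(** A ball of large [nu] mass has large [mu] mass, so the cylinder at the point itself is heavy for
    q >= 0. *)
Lemma cyl_of_ldim_lt x q b : supp nu x -> 0 <= q -> (ldim nu x < b%:E)%E ->
  forall e, 0 < e -> forall n0, exists n w,
     [/\ (n0 <= n)%N, valid N w, edist (pt w) x <= 4 * rad n.-1 &
         - (b * q + e) * S n <= q * ln (cylmass w n)].
Proof.
move=> /nu_supp[w wv [-> _]] q0 xb e e0 n0.
have q1 : 0 < q + 1 by rewrite ltr_wpDl.
have e1 : 0 < e / (q + 1) by rewrite divr_gt0.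
have [n1 h1] := evtI (evtI (evt_ge n0) rad_lt1)
  (logM_const_small M_ge4 M_oo logM_small `|b| (`|b| * ln d%:R) e1).
have [r r01 hr] := liminf0_lt xb (rad_gt0 n1).
have [n [n1n r1 r2]] := rad_bracket r01; have r0 : 0 < r by apply: lt_le_trans r1.
have [[h2 h3] h4] := h1 n n1n.
exists n, w; split => //; first by rewrite edistxx mulr_ge0// ltW.
have r011 : 0 < r < 1 by rewrite r0 (lt_trans r2).
have h5 : r < 3 * rad n by apply: lt_trans r2 _; rewrite ltr_pMl// ltr1n.
have := mu_cball_le wv h5; move: hr; rewrite /Defs.ratio.
have := nu_le (pt w) r; have := nu_ge0 (pt w) r.
rewrite nu_fin mu_cball_fin; set v := fine (nu _); rewrite !lee_fin le_eqVlt.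
(* A ball of mass 0 has ratio +oo, so it is not the one selected by the lower limit. *)
case/orP => [/eqP <-|v0]; first by rewrite eln_ratio0.
move=> v1 /ltW; rewrite eln_ratio_le// => v2 v3.
have v4 : ln v <= ln (cylmass w n).
  by rewrite ler_ln ?posrE ?cylmass_gt0//; apply: le_trans v1 v3.
have := mul_bracket b r1 r2; rewrite ler_norml mulrDr => /andP[h6 _].
have h7 : - b * S n - e / (q + 1) * S n <= ln (cylmass w n).
  by move: h4 h6 v2 v4; rewrite /S mulNr; lra.
apply: le_trans (ler_wpM2l q0 h7).
have h8 : q * (e / (q + 1)) <= e.
  by rewrite mulrA ler_pdivrMr// mulrC ler_pM2l// lerDl.
have : q * (e / (q + 1)) * S n <= e * S n by apply: ler_wpM2r h8; exact: scale_ge0.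
lra.
Qed.

(** All small balls have small [nu] mass, but the cylinder at the point may stick out of the
    restricting ball and weigh more. The shifted cylinder from [nu_supp] is bounded by the [nu] mass
    of a ball around x, hence heavy for q <= 0. *)
Lemma cyl_of_ldim_gt x q b : supp nu x -> q <= 0 -> (b%:E < ldim nu x)%E ->
  forall e, 0 < e -> forall n0, exists n w,
     [/\ (n0 <= n)%N, valid N w, edist (pt w) x <= 4 * rad n.-1 &
         - (b * q + e) * S n <= q * ln (cylmass w n)].
Proof.
move=> /nu_supp[w wv [-> H]] q0 xb e e0 n0.
have q1 : 0 < 1 - q by lra.
have e1 : 0 < e / (1 - q) by rewrite divr_gt0.
have [e2 e20 he2] := liminf0_gt xb.
have m0 : 0 < Num.min e2 1 / 5 by rewrite divr_gt0// lt_min e20/=.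
have [n1 hn1] := rad_small d_gt0 m_gt0 mM m0.
have [n2 h2] := evtS (evtS (logM_pred_small M_ge4 M_oo logM_small `|b|
   (`|b| * (ln (5 * d%:R))) e1)).
have [n [w' [nn w'v dw hw]]] := H (maxn n0 (maxn n1 n2)).
move: nn; rewrite !geq_max => /and3P[nn0 nn1 nn2].
exists n.+2, w'; split => //; [by rewrite -addn2; apply: leq_trans nn0 (leq_addr _ _)|by rewrite edistC|].
set r := 5 * rad n.+1 in hw.
have r0 : 0 < r by rewrite mulr_gt0.
have rm : r < Num.min e2 1.
  rewrite /r mulrC -ltr_pdivlMr//; apply: le_lt_trans hn1.
  by apply: (@rad_mono R d m M) => //; apply: leq_trans nn1 (leqnSn _).
move: rm; rewrite lt_min => /andP[re r1].
have := he2 r; rewrite r0 re /Defs.ratio => /(_ isT).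
move: hw; rewrite nu_fin; set v := fine _; rewrite lee_fin => hv.
have v0 : 0 < v by apply: lt_le_trans hv; exact: cylmass_gt0.
rewrite eln_ratio_ge ?r0// => v1.
have v2 : ln (cylmass w' n.+2) <= b * ln r.
  by apply: le_trans v1; rewrite ler_ln ?posrE// cylmass_gt0.
have lr : ln r = ln (5 * d%:R) - S n.+1.
  have d0 : (0 : R) < d%:R by rewrite ltr0n.
  rewrite /r lnM ?posrE// (ln_rad R M_ge4)// addrA -lnM ?posrE//.
have := h2 n nn2; rewrite /= => h3.
have h4 : b * ln r <= - b * S n.+2 + `|b| * (logM R M n.+1 + ln (5 * d%:R)).
  rewrite lr /S [scale R M n.+2]scaleS !mulrDr.
  have l5 : 0 <= ln (5 * d%:R) :> R by apply: ln_ge0; rewrite -natrM ler1n muln_gt0.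
  have := ler_wpM2r l5 (ler_norm b).
  have := ler_wpM2r (ltW (logM_gt0 R M_ge4 n.+1)) (ler_norm b).
  by rewrite mulNr; lra.
have h7 : ln (cylmass w' n.+2) <= - b * S n.+2 + e / (1 - q) * S n.+2.
  by apply: le_trans v2 (le_trans h4 _); rewrite lerD2l mulrDr.
have := ler_wnM2l q0 h7; apply: le_trans.
have h8 : - q * (e / (1 - q)) <= e.
  by rewrite mulrA ler_pdivrMr// mulrC ler_pM2l//; lra.
have : - q * (e / (1 - q)) * S n.+2 <= e * S n.+2 by apply: ler_wpM2r h8; exact: scale_ge0.
lra.
Qed.

Lemma lowE_dim_le a q t : lowE nu a%:E !=set0 ->
  (forall e, 0 < e -> evt (fun n => Zsum d m p q n <= expR ((- t + e) * S n))) ->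
  0 <= a * q - t /\ (hdim (lowE nu a%:E) <= (a * q - t)%:E)%E.
Proof.
move=> E0 Z; apply: (cover_dim d_gt0 m_gt0 mM M_oo logM_small p_gt0 Z) => //.
move=> x [sx xa] e e0 n0; have q1 : 0 < `|q| + 1 by rewrite ltr_wpDl.
have e2 : 0 < e / 2 by rewrite divr_gt0.
have e1 : 0 < e / 2 / (`|q| + 1) by rewrite divr_gt0.
have h : e / 2 / (`|q| + 1) * `|q| <= e / 2.
  by rewrite mulrAC ler_pdivrMr// ler_pM2l// lerDl.
have [q0|/ltW q0] := leP 0 q.
  have [|n [w [h1 h2 h3 h4]]] := @cyl_of_ldim_lt x q (a + e / 2 / (`|q| + 1)) sx q0 _ _ e2 n0.
    by rewrite xa lte_fin ltrDl.
  exists n, w; split => //; apply: le_trans h4; apply: ler_wpM2r; first exact: scale_ge0.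
  by move: h; rewrite ger0_norm// mulrDl; lra.
have [|n [w [h1 h2 h3 h4]]] := @cyl_of_ldim_gt x q (a - e / 2 / (`|q| + 1)) sx q0 _ _ e2 n0.
  by rewrite xa lte_fin gtrDl oppr_lt0.
exists n, w; split => //; apply: le_trans h4; apply: ler_wpM2r; first exact: scale_ge0.
by move: h; rewrite ler0_norm// mulrBl mulrN; lra.
Qed.

(** At q = 0 the weights disappear and all cylinders are counted. *)
Lemma lowE_oo_dim_le t : (lowE nu +oo%E) !=set0 ->
  (forall e, 0 < e -> evt (fun n => Zsum d m p 0 n <= expR ((- t + e) * S n))) ->
  0 <= - t /\ (hdim (lowE nu +oo%E) <= (- t)%:E)%E.
Proof.
move=> E0 Z; rewrite -[- t]add0r.
apply: (cover_dim d_gt0 m_gt0 mM M_oo logM_small p_gt0 Z) => //.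
move=> x [sx xa] e e0 n0; have [|n [w [h1 h2 h3 h4]]] := @cyl_of_ldim_gt x 0 0 sx (lexx _) _ _ e0 n0.
  by rewrite xa ltry.
by exists n, w; split => //; rewrite mulr0 in h4.
Qed.

(** With the finite exponent b = (t - 1) / q, the nonnegativity in [cover_dim] would read 0 <= b q -
    t = -1. *)
Lemma lowE_oo_empty q t : q < 0 ->
  (forall e, 0 < e -> evt (fun n => Zsum d m p q n <= expR ((- t + e) * S n))) ->
  ~ ((lowE nu +oo%E) !=set0).
Proof.
move=> q0 Z E0.
have [|h _] := @cover_dim R d m M p d_gt0 m_gt0 mM M_oo logM_small p_gt0 (lowE nu +oo%E) q t (t - 1) Z _ E0; last lra.
move=> x [sx xa] e e0 n0.
have [|n [w [h1 h2 h3 h4]]] := @cyl_of_ldim_gt x q ((t - 1) / q) sx (ltW q0) _ _ e0 n0.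
  by rewrite xa ltry.
by exists n, w; split => //; move: h4; rewrite divfK// lt_eqF.
Qed.

End Upper.

End Local.

(** * Mass distribution and L^q sums *)

Section MassDistribution.
Variables (R : realType) (d : nat) (m M : nat -> nat) (p : nat -> nat -> R).
Hypothesis d_gt0 : (0 < d)%N.
Hypothesis m_gt0 : forall k, (0 < m k)%N.
Hypothesis mM : forall k, (4 * d * m k <= M k)%N.
Hypothesis M_oo : forall c : R, exists n0, forall n, (n0 <= n)%N -> c <= (M n)%:R.
Hypothesis logM_small : forall e : R, 0 < e -> evt (fun n => logM R M n <= e * scale R M n).
Let N k := (m k ^ d)%N.
Hypothesis p_ge0 : forall k i, (i < N k)%N -> 0 <= p k i.
Hypothesis p_sum : forall k, \sum_(0 <= i < N k) p k i = 1.

Let M_ge4 k : (4 <= M k)%N.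
Proof. by apply: leq_trans (mM k); rewrite -mulnA leq_pmulr// muln_gt0 d_gt0 m_gt0. Qed.
Let pt := @pt R d m M.
Let rad := @rad R d M.
Let S := scale R M.
Let rad_gt0 n : 0 < rad n. Proof. exact: (@rad_gt0 R d m M). Qed.

Lemma le_fine_diam (U : set 'rV[R]_d) delta x y : (diam U <= delta%:E)%E -> U x -> U y ->
  edist x y <= fine (diam U) <= delta.
Proof.
move=> Ud Ux Uy; have h : ((edist x y)%:E <= diam U)%E.
  by apply: ereal_sup_ubound; exists (x, y).
by case: (diam U) h Ud => [D||]//=; rewrite !lee_fin => -> ->.
Qed.

(** The mass distribution principle, with Lebesgue measure on the codes: a covering set of diameter
    between [rad n.+1] and [rad n] catches codes of only one cylinder of level n. Weights may vanish
    here, as they do for the auxiliary weights of [hdim_lower]. *)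
Lemma hdim_ge (E : set 'rV[R]_d) beta :
  (forall s, s < beta -> evt (fun n => forall w, valid N w ->
     cylmass p w n <= expR (- s * S n))) ->
  (forall t, 0 <= t < 1 -> E (pt (code N p t))) ->
  (beta%:E <= hdim E)%E.
Proof.
move=> H EH; rewrite /hdim asboolF; last first.
  move=> E0; have : E (pt (code N p 0)) by apply: EH; rewrite lexx ltr01.
  by rewrite E0.
apply: le_ereal_inf_tmp => _ [s /= [s0 hs] <-]; rewrite lee_fin leNgt; apply/negP => sb.
pose s1 := (s + beta) / 2; have s1b : s1 < beta by rewrite /s1; lra.
have ss1 : 0 < s1 - s by rewrite /s1; lra.
have s10 : 0 < s1 by lra.
have [n0 hn0] := evtI (H _ s1b) (logM_const_small M_ge4 M_oo logM_small s 0 ss1).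
(* The difference s1 - s absorbs s [logM n], the cost of replacing [rad n] by [rad n.+1]. *)
have mass_le n w : (n0 <= n)%N -> valid N w -> cylmass p w n <= rad n.+1 `^ s.
  move=> nn wv; have [h1 h2] := hn0 n nn; apply: le_trans (h1 w wv) _.
  rewrite powR_ln// ler_expR (ln_rad R M_ge4)// scaleS.
  have : 0 <= s * ln d%:R :> R by rewrite mulr_ge0 ?(ltW s0)// ln_ge0// ler1n.
  move: h2; rewrite addr0 /S; lra.
suff : (1 <= hcontent s (rad n0 / 2) E)%E.
  move=> h; have : (hcontent s (rad n0 / 2) E <= hmeasure s E)%E.
    by apply: ereal_sup_ubound; exists (rad n0 / 2) => //=; rewrite divr_gt0.
  by rewrite hs => /(le_trans h); rewrite lee_fin ler10.
apply: le_ereal_inf_tmp => _ [U [cov Ud] <-].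
(* Covering sets need not be measurable, so the codes they catch are enclosed in measurable sets. *)
have HA i : exists A : set R, [/\ measurable A,
    [set t : R | (0 <= t < 1)%R /\ U i (pt (code N p t))] `<=` A &
    (lebesgue_measure A <= ((fine (diam (U i))) `^ s)%:E)%E].
  have [[t0 [t01 Ut0]]|no] := pselect (exists t : R, 0 <= t < 1 /\ U i (pt (code N p t))); last first.
    exists set0; split => //; last by rewrite measure0 lee_fin powR_ge0.
    by move=> t ht; apply: no; exists t.
  have wv := code_valid p_sum t01.
  have Dle t : 0 <= t < 1 -> U i (pt (code N p t)) ->
      edist (pt (code N p t0)) (pt (code N p t)) <= fine (diam (U i)) <= rad n0 / 2.
    by move=> t_01 Ut; exact: le_fine_diam (Ud i) Ut0 Ut.
  have /andP[D0 D1] := Dle t0 t01 Ut0; rewrite edistxx in D0.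
  have D2 : fine (diam (U i)) < rad n0 by apply: le_lt_trans D1 _; have := rad_gt0 n0; lra.
  have ag n t : fine (diam (U i)) < rad n -> 0 <= t < 1 -> U i (pt (code N p t)) ->
      agree n (code N p t) (code N p t0).
    move=> Dn t_01 Ut; apply: (@pt_separated R d m M) => //.
      by apply: code_valid.
    rewrite edistC; have /andP[h _] := Dle t t_01 Ut.
    apply: le_lt_trans h (lt_trans Dn _); by rewrite ltr_pMl// ltr1n.
  move: D0; rewrite le_eqVlt => /orP[/eqP D0|D0].
    (* A set of diameter 0 catches codes that agree at every level; the cylinders around them shrink
       to measure 0 because s1 > 0. *)
    exists (\bigcap_n cylset N p n (code N p t0)); split.
    - by apply: bigcap_measurable => [|n _]; [exists 0%N|exact: measurable_cylset].
    - by move=> t [t_01 Ut] n _; split => //; apply: ag; rewrite -?D0.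
    rewrite -D0 powR0 ?gt_eqF//; apply/lee_addgt0Pr => e e0; rewrite add0e.
    have [n1 hn1] := scale_oo M_ge4 M_oo (- ln e / s1).
    pose n := maxn n0 n1; have [h1 _] := hn0 n (leq_maxl _ _).
    apply: (@le_trans _ _ (lebesgue_measure (cylset N p n (code N p t0)))).
      apply: le_measure; rewrite ?inE.
      - by apply: bigcap_measurable => [|k _]; [exists 0%N|exact: measurable_cylset].
      - exact: measurable_cylset.
      - by apply: bigcap_inf.
    rewrite lebesgue_cylset// lee_fin; apply: le_trans (h1 _ wv) _.
    rewrite -[leRHS]lnK ?posrE// ler_expR mulNr lerNl mulrC -ler_pdivrMr//.
    exact: hn1 (leq_maxr _ _).
  have [|n [nn r1 r2]] := @rad_bracket R d m M d_gt0 m_gt0 mM n0 (fine (diam (U i))).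
    by rewrite D0 D2.
  exists (cylset N p n (code N p t0)); split; first exact: measurable_cylset.
    by move=> t [t_01 Ut]; split => //; exact: ag.
  rewrite lebesgue_cylset// lee_fin; apply: le_trans (mass_le n _ nn wv) _.
  by apply: ge0_ler_powR; rewrite ?nnegrE ?(ltW s0) ?(ltW D0) ?(ltW (rad_gt0 _)).
have [A hA] := choice HA.
have I01 : lebesgue_measure [set` `[(0 : R), 1[] = 1%E.
  by rewrite lebesgue_measure_itv/= lte_fin ltr01 oppr0 adde0.
rewrite -I01; apply: (@le_trans _ _ (\sum_(0 <= i <oo) lebesgue_measure (A i))%E).
  apply: (measure_sigma_subadditive lebesgue_measure) => //.
  - by move=> n; case: (hA n).
  - move=> t /=; rewrite in_itv/= => t01.
    have [i _ Ui] := cov _ (EH t t01).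
    by have [_ h _] := hA i; exists i => //; apply: h.
by apply: lee_nneseries => [n _ _|n _]; [exact: measure_ge0|case: (hA n)].
Qed.

End MassDistribution.

Section LqSpectrum.
Variables (R : realType) (d : nat) (m M : nat -> nat) (p : nat -> nat -> R).
Hypothesis d_gt0 : (0 < d)%N.
Hypothesis m_gt0 : forall k, (0 < m k)%N.
Hypothesis mM : forall k, (4 * d * m k <= M k)%N.
Hypothesis M_oo : forall c : R, exists n0, forall n, (n0 <= n)%N -> c <= (M n)%:R.
Hypothesis logM_small : forall e : R, 0 < e -> evt (fun n => logM R M n <= e * scale R M n).
Let N k := (m k ^ d)%N.
Hypothesis p_gt0 : forall k i, (i < N k)%N -> 0 < p k i.
Hypothesis p_sum : forall k, \sum_(0 <= i < N k) p k i = 1.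
Let V := BorelV R d.
Variable mu : {measure set V -> \bar R}.
Hypothesis muE : forall A : set V,
  mu A = lebesgue_measure [set t : R | 0 <= t < 1 /\ A (@pt R d m M (code N p t))].

Let M_ge4 k : (4 <= M k)%N.
Proof. by apply: leq_trans (mM k); rewrite -mulnA leq_pmulr// muln_gt0 d_gt0 m_gt0. Qed.
Let pt := @pt R d m M.
Let rad := @rad R d M.
Let S := scale R M.
Let cylmass := cylmass p.
Let rad_gt0 n : 0 < rad n. Proof. exact: (@rad_gt0 R d m M). Qed.
Let cylmass_gt0 w n : valid N w -> 0 < cylmass w n. Proof. exact: cylmass_gt0. Qed.
Let Z := Zsum d m p.
Let N_gt0 k : (0 < N k)%N. Proof. by rewrite expn_gt0 m_gt0. Qed.
Let cylmass_mkseq w n : cylmass (nth 0%N (mkseq w n)) n = cylmass w n.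
Proof. by apply: cylmass_agree; apply: agree_sym; exact: agree_mkseq. Qed.

Lemma Zsum_prefix q n : \sum_(s <- words N n.+1) cylmass (nth 0%N s) n `^ q = (N n)%:R * Z q n.
Proof.
rewrite /= big_allpairs_dep/= /Z /Zsum mulr_sumr big_seq [RHS]big_seq.
apply: eq_bigr => s sw; rewrite (eq_bigr (fun=> cylmass (nth 0%N s) n `^ q)); last first.
  move=> i _; congr (_ `^ _); apply: cylmass_agree => k kn.
  by rewrite nth_rcons (words_size sw) kn.
by rewrite big_const_seq count_predT size_iota iter_addr addr0 mulr_natl.
Qed.

Lemma Zsum_gt0 q n : 0 < Z q n.
Proof.
have s0 : mkseq (fun=> 0%N) n \in words N n by apply: mkseq_words.
rewrite /Z /Zsum (perm_big _ (perm_to_rem s0))/= big_cons ltr_wpDr//.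
  by apply: sumr_ge0 => s _; exact: powR_ge0.
apply: powR_gt0; apply: cylmass_gt0; exact: words_valid_seq s0.
Qed.

Lemma Spack_ge0 r q : (0 <= Spack mu r q)%E.
Proof.
by apply: ereal_sup_ubound; exists [::]; [split => // i j /andP[_]; rewrite ltn0|rewrite big_nil].
Qed.

(** The mass of a ball lies between those of its cylinders of levels n + 1 and n, so its q-th power
    is at most the sum of theirs, whatever the sign of q. Disjoint balls have different words of
    length n + 1, and each prefix of length n recurs at most [N n] times. *)
Lemma Spack_le n r q : rad n.+1 <= r -> r < rad n ->
  (Spack mu r q <= (Z q n.+1 + (N n)%:R * Z q n)%:E)%E.
Proof.
move=> r1 r2; apply: ge_ereal_sup => _ [s [ss sd] <-].
pose cw (x : 'rV[R]_d) := xget (fun=> 0%N) [set w | valid N w /\ x = pt w].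
have cwP x : x \in s -> valid N (cw x) /\ x = pt (cw x).
  move=> /ss/(supp_pt d_gt0 m_gt0 mM p_gt0 p_sum muE)[w wv xw].
  by apply: (@xgetPex _ _ [set w | valid N w /\ x = pt w]); exists w.
pose F u := cylmass (nth 0%N u) n.+1 `^ q + cylmass (nth 0%N u) n `^ q.
pose f x := mkseq (cw x) n.+1.
have fF x : x \in s -> fine (mu (cball x r)) `^ q <= F (f x).
  move=> /cwP[wv xw]; rewrite /F /f cylmass_mkseq.
  have -> : cylmass (nth 0%N (mkseq (cw x) n.+1)) n = cylmass (cw x) n.
    by apply: cylmass_agree; apply: agreeS; apply: agree_sym; exact: agree_mkseq.
  have h3 : r < 3 * rad n by apply: lt_trans r2 _; rewrite ltr_pMl// ltr1n.
  have := mu_cball_ge d_gt0 m_gt0 mM p_gt0 p_sum muE wv r1.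
  have := mu_cball_le d_gt0 m_gt0 mM p_gt0 p_sum muE wv h3.
  rewrite -/pt -xw (mu_cball_fin muE) !lee_fin => v2 v1.
  have c1 := cylmass_gt0 n.+1 wv; have c0 := cylmass_gt0 n wv.
  have v0 : 0 < fine (mu (cball x r)) by apply: lt_le_trans v1.
  rewrite !powR_ln//; have [q0|/ltW q0] := leP 0 q.
    by apply: ler_wpDl; [exact: expR_ge0|rewrite ler_expR ler_wpM2l// ln_mono].
  by apply: ler_wpDr; [exact: expR_ge0|rewrite ler_expR ler_wnM2l// ln_mono].
rewrite sumEFin lee_fin; apply: (@le_trans _ _ (\sum_(u <- [seq f x | x <- s]) F u)).
  by rewrite big_map big_seq [leRHS]big_seq; apply: ler_sum.
apply: (@le_trans _ _ (\sum_(u <- words N n.+1) F u)); last first.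
  by rewrite big_split/= Zsum_prefix.
apply: ler_sum_uniq; [|exact: words_uniq| |].
- apply/(uniqP [::]) => i j; rewrite !inE size_map => hi hj.
  rewrite !(nth_map 0)//; wlog ij : i j hi hj / (i < j)%N.
    move=> W h; case: (ssrnat.ltngtP i j) => // ij; first exact: W.
    by apply/esym/W.
  move=> fij; exfalso.
  have [wv1 xw1] := cwP _ (mem_nth 0 hi); have [wv2 xw2] := cwP _ (mem_nth 0 hj).
  have ag : agree n.+1 (cw (nth 0 s i)) (cw (nth 0 s j)).
    by move=> k kn; rewrite (agree_mkseq (cw (nth 0 s i)) kn) (agree_mkseq (cw (nth 0 s j)) kn) -/(f _) fij.
  have := sd i j; rewrite ij hj => /(_ isT).
  rewrite -subset0 => /(_ (nth 0 s j)); apply; split; rewrite /cball/=; last first.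
    by rewrite edistxx; apply: le_trans r1; exact: ltW.
  apply: le_trans r1; rewrite xw1 xw2; exact: (@pt_agree R d m M).
- by move=> _ /mapP[x /cwP[wv _] ->]; apply: mkseq_words.
- by move=> u; rewrite addr_ge0// powR_ge0.
Qed.

Lemma Lq_ge q t :
  (forall e, 0 < e -> evt (fun n => Z q n <= expR ((- t + e) * S n))) ->
  (t%:E <= Lq mu q)%E.
Proof.
move=> ZH; apply: le_liminf0 => b; rewrite lte_fin => bt.
pose g := t - b; have g0 : 0 < g by rewrite /g; lra.
have g4 : 0 < g / 4 by rewrite divr_gt0.
have g34 : 0 < g / 4 * 3 by rewrite mulr_gt0.
(* Bounds the coefficient of [logM n] in both terms of [Spack_le]: level n + 1 costs |-t + g/4|, and
   [N n] is at most the d-th power of [M n]. *)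
pose K := `|- t + g / 4| + d%:R.
have E := evtI (evtI (ZH _ g4) (evtS (ZH _ g4))) (evtI (rad_lt1 R d_gt0 m_gt0 mM)
  (logM_const_small M_ge4 M_oo logM_small (K + `|b|) (`|b| * ln d%:R + ln 2) g34)).
apply: (evt_rad d_gt0 m_gt0 mM E) => n r [[h1 h2] [h3 h4]] r1 r2.
have r0 : 0 < r by apply: lt_le_trans r1.
have r01 : 0 < r < 1 by rewrite r0 (lt_trans r2).
have := Spack_le q r1 r2; have := Spack_ge0 r q.
case: (Spack mu r q) => [v||]//; rewrite !lee_fin.
rewrite le_eqVlt => /orP[/eqP <- _|v0 hv]; first by rewrite eln_ratio0// leey.
rewrite eln_ratio_ge//; have u0 := logM_gt0 R M_ge4 n.
set Y := (- t + g / 4) * S n + K * logM R M n.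
have y1 : Z q n.+1 <= expR Y.
  apply: le_trans h2 _; rewrite ler_expR /S scaleS mulrDr lerD2l.
  rewrite ler_wpM2r ?(ltW u0)//; apply: le_trans (ler_norm _) _.
  by rewrite lerDl.
have y2 : (N n)%:R * Z q n <= expR Y.
  apply: (@le_trans _ _ (expR (d%:R * logM R M n) * expR ((- t + g / 4) * S n))).
    apply: ler_pM => //; first exact: ltW (Zsum_gt0 _ _).
    rewrite expRM_natl /logM lnK ?posrE ?ltr0n; last by apply: leq_trans (M_ge4 n).
    rewrite -natrX ler_nat /N leq_exp2r//.
    by apply: leq_trans (mM n); rewrite leq_pmull// muln_gt0.
  rewrite -expRD ler_expR /Y addrC lerD2l ler_wpM2r ?(ltW u0)//.
  by rewrite lerDr.
have : v <= expR (ln 2 + Y).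
  by rewrite expRD lnK ?posrE// mulr_natl mulr2n; apply: le_trans hv _; exact: lerD.
move=> /(ln_mono v0); rewrite expRK => /le_trans; apply.
have := mul_bracket d_gt0 m_gt0 mM b r1 r2; rewrite ler_norml mulrDr => /andP[h6 _].
have e1 : g / 4 * 3 * S n = (t - b) * S n - g / 4 * S n by rewrite /g; field.
move: h4 h6 e1; rewrite /Y /S !mulrDl; lra.
Qed.

(** One point per cylinder of level n gives a packing: a common point of two balls would bring their
    centers within 2 [rad n] < 3 [rad n]. *)
Lemma Spack_ge n q : ((Z q n)%:E <= Spack mu (rad n) q)%E.
Proof.
apply: ereal_sup_ubound; exists [seq pt (nth 0%N u) | u <- words N n]; last first.
  rewrite sumEFin big_map; congr EFin; rewrite /Z /Zsum big_seq [RHS]big_seq.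
  apply: eq_bigr => u uw; rewrite (mu_cball_eq d_gt0 m_gt0 mM p_gt0 p_sum muE (n := n))//.
    exact: words_valid_seq uw.
  by rewrite lexx/= ltr_pMl// ltr1n.
split => [x /mapP[u uw ->]|i j].
  apply/(supp_pt d_gt0 m_gt0 mM p_gt0 p_sum muE); exists (nth 0%N u) => //.
  exact: words_valid_seq uw.
rewrite size_map => /andP[ij js]; have si := ltn_trans ij js.
rewrite !(nth_map [::])//; apply/seteqP; split => // y [/= h1 h2].
have wi := mem_nth [::] si; have wj := mem_nth [::] js.
have ag : agree n (nth 0%N (nth [::] (words N n) i)) (nth 0%N (nth [::] (words N n) j)).
  apply: (@pt_separated R d m M d_gt0 m_gt0 mM); [exact: words_valid_seq wi|exact: words_valid_seq wj|].
  apply: le_lt_trans (edist_triangle y _ _) _; rewrite (edistC y).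
  have := rad_gt0 n; move: h1 h2; rewrite /cball/= -/pt -/rad; lra.
have := words_agree wi wj ag; move/eqP; rewrite nth_uniq ?words_uniq//.
by move/eqP => ij'; rewrite ij' ltnn in ij.
Qed.

(** A lower limit is bounded above by its values along the radii [rad n], where the packing sum
    needs no comparison of levels. *)
Lemma Lq_le q t :
  (forall e, 0 < e -> evt (fun n => expR ((- t - e) * S n) <= Z q n)) ->
  (Lq mu q <= t%:E)%E.
Proof.
move=> ZH; apply: liminf0_le => b; rewrite lte_fin => tb e e0.
have g0 : 0 < (b - t) / 2 by rewrite divr_gt0// subr_gt0.
have [n1 hn1] := rad_small d_gt0 m_gt0 mM e0.
have [n2 hn2] := evtI (evtI (ZH _ g0) (evt_ge n1)) (evtI (rad_lt1 R d_gt0 m_gt0 mM)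
  (const_small M_ge4 M_oo (b * ln d%:R) g0)).
have [[h1 h2] [h3 h4]] := hn2 n2 (leqnn _); exists (rad n2).
  rewrite rad_gt0/=; apply: le_lt_trans hn1; exact: (@rad_mono R d m M).
have r01 : 0 < rad n2 < 1 by rewrite rad_gt0.
have := Spack_ge n2 q; have Z0 := Zsum_gt0 q n2; case: (Spack mu (rad n2) q) => [v||]//; last first.
  by rewrite /= lt0_mulye ?leNye// lte_fin invr_lt0 ln_lt0.
rewrite lee_fin => Zv; have v0 : 0 < v by apply: lt_le_trans Zv.
rewrite eln_ratio_le//; apply: le_trans (ln_mono Z0 Zv).
have := ln_mono (expR_gt0 _) h1; rewrite expRK => /(le_trans _); apply.
rewrite (ln_rad R M_ge4)//; move: h4; rewrite /S.
have -> : b * (ln d%:R - scale R M n2) = b * ln d%:R - b * scale R M n2 by ring.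
have -> : (- t - (b - t) / 2) * scale R M n2 = (b - t) / 2 * scale R M n2 - b * scale R M n2 by field.
lra.
Qed.

End LqSpectrum.

(** * Restrictions to balls and lower bounds *)

Section HausdorffMonotone.
Variables (R : realType) (d : nat).

Lemma hdim_mono (E F : set 'rV[R]_d) : E `<=` F -> (hdim E <= hdim F)%E.
Proof.
move=> EF; rewrite /hdim; case: asboolP => [_|E0]; first exact: leNye.
rewrite asboolF; last by move=> F0; apply: E0; apply/seteqP; split => // x /EF; rewrite F0.
apply: le_ereal_inf => _ [s [s0 hs] <-]; exists s => //; split => //.
apply/eqP; rewrite eq_le; apply/andP; split; last first.
  by apply: le_trans (hcontent_ge0 s 1 E) (ereal_sup_ubound _); exists 1 => /=.
rewrite -hs; apply: ge_ereal_sup => _ [delta /= delta0 <-].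
apply: le_trans (_ : (hcontent s delta F <= _)%E); last first.
  by apply: ereal_sup_ubound; exists delta.
apply: le_ereal_inf => _ [U [cov Ud] <-]; exists U => //; split => //.
exact: subset_trans EF cov.
Qed.

Lemma hdim0 : hdim (set0 : set 'rV[R]_d) = -oo%E.
Proof. by rewrite /hdim asboolT. Qed.

End HausdorffMonotone.

Section Spectra.
Variables (R : realType) (d : nat) (m M : nat -> nat) (p : nat -> nat -> R).
Hypothesis d_gt0 : (0 < d)%N.
Hypothesis m_gt0 : forall k, (0 < m k)%N.
Hypothesis mM : forall k, (4 * d * m k <= M k)%N.
Hypothesis M_oo : forall c : R, exists n0, forall n, (n0 <= n)%N -> c <= (M n)%:R.
Hypothesis logM_small : forall e : R, 0 < e -> evt (fun n => logM R M n <= e * scale R M n).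
Let N k := (m k ^ d)%N.
Hypothesis p_gt0 : forall k i, (i < N k)%N -> 0 < p k i.
Hypothesis p_half : forall k i, (i < N k)%N -> p k i <= 2^-1.
Hypothesis p_sum : forall k, \sum_(0 <= i < N k) p k i = 1.
Let V := BorelV R d.
Variable mu : {measure set V -> \bar R}.
Hypothesis muE : forall A : set V,
  mu A = lebesgue_measure [set t : R | 0 <= t < 1 /\ A (@pt R d m M (code N p t))].

Let M_ge4 k : (4 <= M k)%N.
Proof. by apply: leq_trans (mM k); rewrite -mulnA leq_pmulr// muln_gt0 d_gt0 m_gt0. Qed.
Let pt := @pt R d m M.
Let rad := @rad R d M.
Let S := scale R M.
Let cylmass := cylmass p.
Let rad_gt0 n : 0 < rad n. Proof. exact: (@rad_gt0 R d m M). Qed.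
Let cylmass_gt0 w n : valid N w -> 0 < cylmass w n. Proof. exact: cylmass_gt0. Qed.
Let mu_cball_ge w n r : valid N w -> rad n <= r ->
  ((cylmass w n)%:E <= mu (cball (pt w) r))%E.
Proof. exact: (@mu_cball_ge R d m M p). Qed.
Let mu_cball_le w n r : valid N w -> r < 3 * rad n ->
  (mu (cball (pt w) r) <= (cylmass w n)%:E)%E.
Proof. exact: (@mu_cball_le R d m M p). Qed.
Let supp_pt x : supp mu x <-> exists2 w, valid N w & x = pt w.
Proof. exact: (@supp_pt R d m M p). Qed.
Let p_ge0 k i : (i < N k)%N -> 0 <= p k i. Proof. by move=> /p_gt0/ltW. Qed.

(** Weights at most 1/2 exclude atoms; this refutes the second alternative of [ball_depth] on the
    support of a restriction. *)
Lemma cylmass_half w n : valid N w -> cylmass w n <= (n.+1%:R)^-1.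
Proof.
move=> wv; have h : cylmass w n <= 2^-1 ^+ n.
  elim: n => [|n IH]; first by rewrite /cylmass cylmass0 expr0.
  by rewrite /cylmass cylmassS exprSr ler_pM ?p_half ?p_ge0 ?wv// ltW// cylmass_gt0.
apply: le_trans h _; rewrite exprVn lef_pV2 ?posrE ?ltr0n ?exprn_gt0//.
by rewrite -natrX ler_nat ltn_expl.
Qed.

Definition restr (x0 : 'rV[R]_d) rho (A : set V) := mu (A `&` cball x0 rho).

Lemma restr_le x0 rho x r : (restr x0 rho (cball x r) <= mu (cball x r))%E.
Proof.
apply: (mu_le mu); [|exact: measurable_cball|exact: subIsetl].
by apply: measurableI; exact: measurable_cball.
Qed.

(** In the second alternative of [ball_depth] the restriction could charge only the point x near x;
    as points have measure 0, x would not be in its support. *)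
Lemma restr_supp x0 rho x : 0 < rho -> supp (restr x0 rho) x ->
  exists2 w, valid N w & x = pt w /\
  forall n0, exists n w', [/\ (n0 <= n)%N, valid N w',
    edist (pt w) (pt w') <= 4 * rad n.+1 &
    ((cylmass w' n.+2)%:E <= restr x0 rho (cball x (5 * rad n.+1)))%E].
Proof.
move=> rho0 sx.
have /supp_pt[w wv xw] : supp mu x.
  move=> U oU Ux; apply: lt_le_trans (sx U oU Ux) _.
  apply: (mu_le mu); [|exact: measurable_open_set|exact: subIsetl].
  by apply: measurableI; [exact: measurable_open_set|exact: measurable_cball].
exists w => //; split => // n0.
have xrho : edist (pt w) x0 <= rho.
  rewrite leNgt; apply/negP => h.
  have := sx _ (@open_ecomp R d x0 rho); rewrite /= xw edistC => /(_ h).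
  rewrite /restr (_ : _ `&` _ = set0) ?measure0 ?ltxx//.
  apply/seteqP; split => // y [/=]; rewrite /cball/=.
  by move=> /lt_le_trans h' /h'; rewrite ltxx.
have [H|[n H]] := ball_depth d_gt0 m_gt0 mM M_oo wv rho0 xrho.
  have [n [w' [nn w'v dw hz]]] := H n0; exists n, w'; split => //.
  apply: le_trans (mu_cball_ge w'v (lexx _)) _.
  apply: (mu_le mu); [exact: measurable_cball| |].
    by apply: measurableI; exact: measurable_cball.
  move=> z /= hz'; split; rewrite /cball/=; last by rewrite edistC; exact: hz.
  rewrite xw; apply: le_trans (edist_triangle (pt w') _ _) _.
  have := @rad_mono R d m M d_gt0 m_gt0 mM _ _ (leqnSn n.+1).
  move: dw hz'; rewrite /cball/= -/rad; lra.
exfalso; have := sx _ (@open_eball R d x (rad n)); rewrite /= edistxx rad_gt0 => /(_ isT).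
rewrite /restr; set A := _ `&` _ => A0.
have mA : measurable (A : set V).
  by apply: measurableI; [apply: measurable_open_set; exact: open_eball|exact: measurable_cball].
have AE k : (mu A <= (k.+1%:R^-1)%:E)%E.
  apply: (@le_trans _ _ (mu (cball x (rad k)))); last first.
    apply: (@le_trans _ _ (cylmass w k)%:E); last by rewrite lee_fin cylmass_half.
    by rewrite xw; apply: mu_cball_le => //; rewrite ltr_pMl// ltr1n.
  rewrite (_ : mu A = mu (A `&` cball x (rad k))).
    apply: (mu_le mu); [|exact: measurable_cball|exact: subIsetr].
    by apply: measurableI => //; exact: measurable_cball.
  rewrite !muE; congr lebesgue_measure; apply/seteqP; split => t /=; last by move=> [? []].
  move=> [t01 At]; split => //; split => //; move: At => [/= h1 h2].
  have cv : valid N (code N p t) by apply: code_valid.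
  suff cx : pt (code N p t) = x by rewrite /cball/= -/pt cx edistxx ltW.
  rewrite xw; apply: H => //; last by rewrite edistC.
  apply: (@pt_separated R d m M) => //; rewrite -/pt -xw; apply: lt_trans h1 _.
  by rewrite ltr_pMl// ltr1n.
have [b [b0 b1]] := ereal_between A0; rewrite lte_fin in b0.
have [k hk] : exists k : nat, k.+1%:R^-1 < b.
  exists (Num.trunc b^-1); rewrite invf_plt ?posrE//.
  by have /truncn_itv/andP[] : 0 <= b^-1 by rewrite invr_ge0 ltW.
by have := lt_le_trans b1 (AE k); rewrite lte_fin ltNge ltW.
Qed.

Lemma mu_supp x : supp mu x ->
  exists2 w, valid N w & x = pt w /\
  forall n0, exists n w', [/\ (n0 <= n)%N, valid N w',
    edist (pt w) (pt w') <= 4 * rad n.+1 &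
    ((cylmass w' n.+2)%:E <= mu (cball x (5 * rad n.+1)))%E].
Proof.
move=> /supp_pt[w wv xw]; exists w => //; split => // n0; exists n0, w; split => //.
  by rewrite edistxx mulr_ge0// ltW.
rewrite xw; apply: mu_cball_ge => //.
apply: le_trans (@rad_mono R d m M d_gt0 m_gt0 mM _ _ (leqnSn n0.+1)) _.
by rewrite -/rad; have := rad_gt0 n0.+1; lra.
Qed.

(** The bounds are uniform over the letters of [J k], so they can be summed along every word that
    uses these letters. *)
Definition letters_exponent (J : nat -> pred nat) (a : \bar R) := match a with
  | r%:E => forall e, 0 < e -> evt (fun k => forall i, (i < N k)%N -> J k i ->
       `|ln (p k i) + r * logM R M k| <= e * logM R M k)
  | _ => forall b, evt (fun k => forall i, (i < N k)%N -> J k i ->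
       ln (p k i) <= - b * logM R M k)
  end.

Section LowerBound.
Variables (a : \bar R) (beta : R) (J : nat -> pred nat) (w0 : nat -> nat) (n1 : nat).
Variable nu : set V -> \bar R.
Hypothesis a_neq : a != -oo%E.
Hypothesis w0v : valid N w0.
Hypothesis J_ex : forall k, has (J k) (iota 0 (N k)).
Hypothesis J_mass : letters_exponent J a.
Hypothesis J_count : forall s, s < beta ->
  evt (fun k => s * logM R M k <= ln (count (J k) (iota 0 (N k)))%:R).
Hypothesis nu_loc : exists2 e, 0 < e & forall w, valid N w -> agree n1 w w0 ->
  forall r, 0 < r < e -> nu (cball (pt w) r) = mu (cball (pt w) r).
Hypothesis nu_supp : forall w, valid N w -> agree n1 w w0 -> supp nu (pt w).

Lemma ln_cylmass w n : valid N w -> ln (cylmass w n) = \sum_(k < n) ln (p k (w k)).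
Proof.
move=> wv; elim: n => [|n IH]; first by rewrite /cylmass cylmass0 big_ord0 ln1.
rewrite big_ord_recr/= -IH /cylmass cylmassS lnM// posrE ?p_gt0//.
exact: cylmass_gt0.
Qed.

Lemma local_dim_J w : valid N w -> agree n1 w w0 ->
  (forall k, (n1 <= k)%N -> J k (w k)) ->
  ldim nu (pt w) = a /\ udim nu (pt w) = a.
Proof.
move=> wv wag wJ.
have loc : exists2 e, 0 < e & forall r, 0 < r < e -> nu (cball (pt w) r) = mu (cball (pt w) r).
  by have [e e0 he] := nu_loc; exists e => // r; exact: he.
case: a J_mass a_neq => [r||]// H _.
- apply: (local_dim_eq d_gt0 m_gt0 mM M_oo logM_small p_gt0 p_sum muE wv loc) => e e0.
  have U1 : evt (fun n => \sum_(k < n) ln (p k (w k)) <= (- r + e) * S n).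
    apply: (@sum_scale_le R M M_ge4 M_oo (fun k => ln (p k (w k))) (- r)) => // e' e'0;
      apply: evt_mono2 (H _ e'0) (evt_ge n1) => k h1 h2.
    by have := h1 _ (wv k) (wJ k h2); rewrite ler_norml => /andP[_]; lra.
  have U2 : evt (fun n => (- r - e) * S n <= \sum_(k < n) ln (p k (w k))).
    apply: (@sum_scale_ge R M M_ge4 M_oo (fun k => ln (p k (w k))) (- r)) => // e' e'0;
      apply: evt_mono2 (H _ e'0) (evt_ge n1) => k h1 h2.
    by have := h1 _ (wv k) (wJ k h2); rewrite ler_norml => /andP[+ _]; lra.
  apply: evt_mono2 U1 U2 => n h1 h2; rewrite ln_cylmass// ler_norml -/S.
  apply/andP; split; lra.
- apply: (local_dim_oo d_gt0 m_gt0 mM M_oo logM_small p_gt0 p_sum muE wv loc) => b.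
  have U1 : evt (fun n => \sum_(k < n) ln (p k (w k)) <= (- (b + 1) + 1) * S n).
    apply: (@sum_scale_le R M M_ge4 M_oo (fun k => ln (p k (w k))) (- (b + 1))) => // e' e'0;
      apply: evt_mono2 (H (b + 1)) (evt_ge n1) => k h1 h2.
    apply: le_trans (h1 _ (wv k) (wJ k h2)) _; apply: ler_wpM2r; last lra.
    exact: ltW (logM_gt0 R M_ge4 k).
  by apply: evt_mono U1 => n; rewrite -ln_cylmass// (_ : - (b + 1) + 1 = - b)//; lra.
Qed.

(** The auxiliary weights are a point mass along the prefix of [w0], which keeps the words where
    [nu] and [mu] agree at small scales, then the uniform distribution on [J k]. Vanishing
    elsewhere, they code no other letter. *)
Lemma hdim_lower : (beta%:E <= hdim [set x | supp nu x /\ ldim nu x = a /\ udim nu x = a])%E.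
Proof.
pose c k := count (J k) (iota 0 (N k)).
have c0 k : (0 < c k)%N by rewrite -has_count.
pose p' k i : R := if (k < n1)%N then (i == w0 k)%:R else if J k i then (c k)%:R^-1 else 0.
have p'0 k i : (i < N k)%N -> 0 <= p' k i.
  by rewrite /p'; case: ifP => // _ _; case: ifP => // _; rewrite invr_ge0.
have p's k : \sum_(0 <= i < N k) p' k i = 1.
  rewrite /p'; case: ltnP => _.
    rewrite big_mkord (bigD1 (Ordinal (w0v k)))//= eqxx big1 ?addr0// => i.
    by rewrite -val_eqE/= => /negbTE ->.
  rewrite -big_mkcond/= /index_iota subn0 big_const_seq -/(c k) iter_addr addr0.
  by rewrite -[_ *+ _]mulr_natl mulfV// pnatr_eq0 -lt0n.
apply: (hdim_ge d_gt0 m_gt0 mM M_oo logM_small p'0 p's).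
  move=> s sb; pose s1 := (s + beta) / 2.
  have [s1b e0] : s1 < beta /\ 0 < s1 - s by rewrite /s1; lra.
  have [k1 hk1] := evtI (J_count s1b) (evt_ge n1).
  (* Below [k1] the weights are only bounded by 1, hence the increment 0. *)
  pose g k : R := if (k < k1)%N then 0 else - s1 * logM R M k.
  have G : evt (fun n => \sum_(k < n) g k <= (- s1 + (s1 - s)) * S n).
    apply: (@sum_scale_le R M M_ge4 M_oo g (- s1)) => // e e1;
      exists k1 => k kk; rewrite /g ltnNge kk/=.
    by apply: ler_wpM2r; [exact: ltW (logM_gt0 R M_ge4 k)|rewrite lerDl ltW].
  apply: evt_mono G => n h w wv; apply: (@le_trans _ _ (expR (\sum_(k < n) g k))); last first.
    by rewrite ler_expR (_ : - s = - s1 + (s1 - s))//; lra.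
  elim: n {h} => [|n IH]; first by rewrite cylmass0 big_ord0 expR0.
  rewrite cylmassS big_ord_recr/= expRD; apply: ler_pM => //.
  - exact: (@cylmass_ge0 R N p' p'0 w n wv).
  - exact: p'0.
  rewrite /g; case: (ltnP n k1) => nk.
    rewrite expR0 /p'; case: ifP => _; first by rewrite lern1 leq_b1.
    by case: ifP => // _; rewrite invf_le1 ?ler1n ?ltr0n.
  have [h1 h2] := hk1 n nk; rewrite /p' ltnNge h2/=; case: ifP => _; last exact: expR_ge0.
  by rewrite mulNr expRN lef_pV2 ?posrE ?expR_gt0 ?ltr0n// -[leRHS]lnK ?posrE ?ltr0n// ler_expR.
move=> t t01; have cv : valid N (code N p' t) by apply: code_valid.
have pc k := p_code_gt0 p'0 p's k t01.
have ag : agree n1 (code N p' t) w0.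
  by move=> k kn; have := pc k; rewrite {1}/p' kn; case: eqP => //; rewrite ltxx.
split; first exact: nu_supp.
apply: local_dim_J => // k kn; have := pc k.
by rewrite {1}/p' ltnNge kn/=; case: ifP => //; rewrite ltxx.
Qed.

End LowerBound.

End Spectra.

(** * Spectra from the asymptotics of the weights *)

Section AbstractFormalism.
Variables (R : realType) (d : nat) (m M : nat -> nat) (p : nat -> nat -> R).
Hypothesis d_gt0 : (0 < d)%N.
Hypothesis m_gt0 : forall k, (0 < m k)%N.
Hypothesis mM : forall k, (4 * d * m k <= M k)%N.
Hypothesis M_oo : forall c : R, exists n0, forall n, (n0 <= n)%N -> c <= (M n)%:R.
Hypothesis logM_small : forall e : R, 0 < e -> evt (fun n => logM R M n <= e * scale R M n).
Let N k := (m k ^ d)%N.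
Hypothesis p_gt0 : forall k i, (i < N k)%N -> 0 < p k i.
Hypothesis p_half : forall k i, (i < N k)%N -> p k i <= 2^-1.
Hypothesis p_sum : forall k, \sum_(0 <= i < N k) p k i = 1.
Let V := BorelV R d.
Variable mu : {measure set V -> \bar R}.
Hypothesis muE : forall A : set V,
  mu A = lebesgue_measure [set t : R | 0 <= t < 1 /\ A (@pt R d m M (code N p t))].

Let M_ge4 k : (4 <= M k)%N.
Proof. by apply: leq_trans (mM k); rewrite -mulnA leq_pmulr// muln_gt0 d_gt0 m_gt0. Qed.
Let pt := @pt R d m M.
Let rad := @rad R d M.
Let S := scale R M.
Let rad_gt0 n : 0 < rad n. Proof. exact: (@rad_gt0 R d m M). Qed.
Let p_ge0 k i : (i < N k)%N -> 0 <= p k i. Proof. by move=> /p_gt0/ltW. Qed.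
Let letters_exponent := letters_exponent d m M p.
Let N_gt0 k : (0 < N k)%N. Proof. by rewrite expn_gt0 m_gt0. Qed.

Lemma telescope_tail n0 : (\sum_(0 <= k <oo)
  (if (k < n0)%N then 0 else (k.+1%:R)^-1 - (k.+2%:R)^-1)%:E <= (n0.+1%:R^-1 : R)%:E)%E.
Proof.
apply: lime_le; first by apply: is_cvg_nneseries => k _ _; rewrite lee_fin;
  case: ifP => // _; rewrite subr_ge0 lef_pV2 ?posrE ?ltr0n// ler_nat.
apply: nearW => n; rewrite sumEFin lee_fin.
suff : \sum_(0 <= k < n) (if (k < n0)%N then 0 else (k.+1%:R)^-1 - (k.+2%:R)^-1) <=
    (n0.+1%:R)^-1 - ((maxn n n0).+1%:R)^-1 :> R.
  by move=> h; apply: le_trans h _; rewrite gerBl invr_ge0.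
elim: n => [|n IH]; first by rewrite big_geq// max0n subrr.
rewrite big_nat_recr//=; case: ltnP => nn0.
  by move: IH; rewrite addr0 (maxn_idPr (ltnW nn0)) (maxn_idPr nn0).
have -> : maxn n.+1 n0 = n.+1 by apply/maxn_idPl; exact: leqW.
move: IH; rewrite (maxn_idPl nn0); set u := n.+1%:R^-1; set v := n.+2%:R^-1.
by set z := n0.+1%:R^-1; lra.
Qed.

(** Borel-Cantelli with an explicit rate: the bound telescopes, so the codes with a letter outside
    [J] at some level k >= n0 have measure at most 1/(n0 + 1). *)
Lemma exact_dim_J (J : nat -> pred nat) D : letters_exponent J D%:E ->
  (forall k, \sum_(0 <= i < N k | ~~ J k i) p k i <= (k.+1%:R)^-1 - (k.+2%:R)^-1) ->
  exact_dim mu D.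
Proof.
move=> JD Jp.
pose gw n0 n s := all (fun k => (n0 <= k)%N ==> J k (nth 0%N s k)) (iota 0 n).
(* The points with letters in [J] from level [n0] on, described by closed balls so that
   measurability is immediate; [pt_closure] recovers the word. *)
pose G n0 : set V := \bigcap_n \big[setU/set0]_(s <- words N n | gw n0 n s)
   (cball (pt (nth 0%N s)) (rad n) : set V).
have mG n0 : measurable (G n0).
  apply: bigcap_measurable => [|n _]; first by exists 0%N.
  by apply: bigsetU_measurable => s _; exact: measurable_cball.
have GD n0 x : G n0 x -> ldim mu x = D%:E /\ udim mu x = D%:E.
  move=> Gx; have H n : exists s, [/\ s \in words N n, gw n0 n s & edist (pt (nth 0%N s)) x <= rad n].
    by have := Gx n I; rewrite -bigcup_seq_cond => -[s /= /andP[h1 h2] h3]; exists s.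
  have [f hf] := choice H.
  have [n|n|w [wv xw wf]] := @pt_closure R d m M d_gt0 m_gt0 mM x (fun n => nth 0%N (f n)).
  - by have [h _ _] := hf n; apply: words_valid_seq h.
  - by have [_ _ h] := hf n.
  rewrite xw; apply: (@local_dim_J R d m M p d_gt0 m_gt0 mM M_oo logM_small p_gt0 p_sum mu muE
     D%:E J w n0 mu) => //.
    by exists 1.
  move=> k kn; have [_ /allP/(_ k) h _] := hf k.+1.
  by rewrite (wf k.+1)//; move: h; rewrite mem_iota add0n leq0n ltnSn kn; apply.
exists (~` \bigcup_n0 G n0); split.
- by apply: measurableC; apply: bigcup_measurable => n _; exact: mG.
- apply/eqP; rewrite eq_le measure_ge0 andbT; apply/lee_addgt0Pr => e e0; rewrite add0e.
  pose n0 := Num.trunc e^-1.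
  have n0e : n0.+1%:R^-1 <= e.
    apply: ltW; rewrite invf_plt ?posrE//.
    by have /truncn_itv/andP[] : 0 <= e^-1 by rewrite invr_ge0 ltW.
  apply: (@le_trans _ _ (mu (~` G n0))).
    apply: (mu_le mu); [|exact: measurableC|by apply: subsetC; exact: bigcup_sup].
    by apply: measurableC; apply: bigcup_measurable => n _; exact: mG.
  pose F k := if (k < n0)%N then set0 else [set t : R | (0 <= t < 1)%R /\ ~~ J k (code N p t k)].
  have mF k : measurable (F k).
    by rewrite /F; case: ifP => // _; have [] := lebesgue_digit p_ge0 p_sum k (J k).
  have sub : [set t : R | 0 <= t < 1 /\ (~` G n0) (pt (code N p t))] `<=` \bigcup_k F k.
    move=> t /= [t01 nG]; apply: contrapT => nF; apply: nG => n _.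
    have cv : valid N (code N p t) by apply: code_valid.
    rewrite -bigcup_seq_cond; exists (mkseq (code N p t) n) => /=.
      rewrite mkseq_words//; apply/allP => k; rewrite mem_iota add0n => /andP[_ kn].
      apply/implyP => nk; rewrite nth_mkseq//; apply/negPn/negP => nJ; apply: nF.
      by exists k => //; rewrite /F ltnNge nk.
    apply: (@pt_agree R d m M) => //; apply: agree_sym; exact: agree_mkseq.
  rewrite muE; apply: (@le_trans _ _ (\sum_(0 <= k <oo) lebesgue_measure (F k))%E).
    have mB : measurable [set t : R | 0 <= t < 1 /\ (~` G n0) (pt (code N p t))].
      have -> : [set t : R | 0 <= t < 1 /\ (~` G n0) (pt (code N p t))] = \bigcup_k F k.
        apply/seteqP; split => // t [k _]; rewrite /F; case: ltnP => //= nk [t01 nJ].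
        split => // Gt; have cv : valid N (code N p t) by apply: code_valid.
        have := Gt k.+1 I; rewrite -bigcup_seq_cond => -[s /= /andP[sw /allP/(_ k)]].
        rewrite mem_iota add0n leq0n ltnSn nk => /(_ isT) /= Js hs.
        have : agree k.+1 (nth 0%N s) (code N p t).
          apply: (@pt_separated R d m M) => //; first exact: (@words_valid_seq N k.+1 s N_gt0 sw).
          by apply: le_lt_trans hs _; rewrite ltr_pMl// ltr1n.
        by move=> /(_ k (ltnSn k)) E; rewrite E in Js; rewrite Js in nJ.
      by apply: bigcup_measurable => k _; exact: mF.
    exact: (measure_sigma_subadditive lebesgue_measure).
  apply: (@le_trans _ _ ((n0.+1%:R)^-1)%:E); last by rewrite lee_fin.
  apply: le_trans (telescope_tail n0); apply: lee_nneseries => [k _ _|k _]; first exact: measure_ge0.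
  rewrite /F; case: ifP => _; first by rewrite measure0.
  have [_ h] := lebesgue_digit p_ge0 p_sum k (J k).
  by apply: le_trans h _; rewrite lee_fin.
- move=> x /= nx [n _ Gx]; apply: nx; exact: GD Gx.
Qed.

Variable tau : R -> \bar R.
Hypothesis tau_oo : forall q, tau q != +oo%E.
Hypothesis tau0 : tau 0 != -oo%E.
Hypothesis Z_le : forall q, tau q != -oo%E -> forall e, 0 < e ->
  evt (fun n => Zsum d m p q n <= expR ((- fine (tau q) + e) * S n)).
Hypothesis Z_ge : forall q, tau q != -oo%E -> forall e, 0 < e ->
  evt (fun n => expR ((- fine (tau q) - e) * S n) <= Zsum d m p q n).
Hypothesis Z_oo : forall q, tau q = -oo%E -> forall t e, 0 < e ->
  evt (fun n => expR ((- t - e) * S n) <= Zsum d m p q n).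
Hypothesis J_ex : forall a : \bar R, a != -oo%E -> LF tau a != -oo%E ->
  exists beta J, [/\ LF tau a = beta%:E, forall k, has (J k) (iota 0 (N k)),
    letters_exponent J a & forall s, s < beta ->
      evt (fun k => s * logM R M k <= ln (count (J k) (iota 0 (N k)))%:R)].

Let tauE q : tau q != -oo%E -> tau q = (fine (tau q))%:E.
Proof. by move=> h; rewrite fineK// fin_numE h tau_oo. Qed.

Lemma Lq_tau : Lq mu = tau.
Proof.
apply/funext => q; have [tq|tq] := eqVneq (tau q) -oo%E.
  rewrite tq; apply/eqP; rewrite -leeNy_eq leNgt; apply/negP => /ereal_between[b [_]].
  rewrite ltNge => /negP; apply.
  exact: (Lq_le d_gt0 m_gt0 mM M_oo p_gt0 p_sum muE (Z_oo tq b)).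
rewrite (tauE tq); apply/eqP; rewrite eq_le; apply/andP; split.
  exact: (Lq_le d_gt0 m_gt0 mM M_oo p_gt0 p_sum muE (Z_ge tq)).
exact: (Lq_ge d_gt0 m_gt0 mM M_oo logM_small p_gt0 p_sum muE (Z_le tq)).
Qed.

Section Spectrum.
Variable nu : set V -> \bar R.
Hypothesis nu_ge0 : forall x r, (0 <= nu (cball x r))%E.
Hypothesis nu_le : forall x r, (nu (cball x r) <= mu (cball x r))%E.
Hypothesis nu_supp : forall x, supp nu x -> exists2 w, valid N w & x = pt w /\
  forall n0, exists n w', [/\ (n0 <= n)%N, valid N w',
    edist (pt w) (pt w') <= 4 * rad n.+1 &
    ((cylmass p w' n.+2)%:E <= nu (cball x (5 * rad n.+1)))%E].
Hypothesis nu_inside : exists w0 n1 e, [/\ valid N w0, 0 < e &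
  forall w, valid N w -> agree n1 w w0 -> supp nu (pt w) /\
    forall r, 0 < r < e -> nu (cball (pt w) r) = mu (cball (pt w) r)].

(** For a = +oo, a nonempty level set forces tau = -oo at all q < 0, so the infimum in the transform
    reduces to q = 0. *)
Lemma lowE_le_LF a : a != -oo%E -> lowE nu a !=set0 ->
  (0 <= LF tau a)%E /\ (hdim (lowE nu a) <= LF tau a)%E.
Proof.
case: a => [r||]// _ E0.
  have H q : tau q != -oo%E -> 0 <= r * q - fine (tau q) /\
      (hdim (lowE nu r%:E) <= (r * q - fine (tau q))%:E)%E.
    move=> tq; exact: (lowE_dim_le d_gt0 m_gt0 mM M_oo logM_small p_gt0 p_sum muE
      nu_ge0 nu_le nu_supp E0 (Z_le tq)).
  by split; apply: le_ereal_inf_tmp => _ [q /= tq <-]; have [h1 h2] := H q tq;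
    rewrite (tauE tq) -EFinB ?lee_fin.
have noneg q : q < 0 -> tau q = -oo%E.
  move=> q0; apply: contrapT => /eqP tq.
  exact: (lowE_oo_empty d_gt0 m_gt0 mM M_oo logM_small p_gt0 muE
      nu_ge0 nu_le nu_supp q0 (Z_le tq) E0).
have [h1 h2] := lowE_oo_dim_le d_gt0 m_gt0 mM M_oo logM_small p_gt0 muE
      nu_ge0 nu_le nu_supp E0 (Z_le tau0).
have key q : tau q != -oo%E -> q <= 0 ->
    ((if (q < 0)%R then -oo else 0) - tau q = (- fine (tau 0))%:E)%E.
  move=> tq; rewrite le_eqVlt => /orP[/eqP ->|/noneg tq']; last by rewrite tq' eqxx in tq.
  by rewrite ltxx add0e {1}(tauE tau0).
by split; apply: le_ereal_inf_tmp => _ [q /= [tq q0] <-]; rewrite key ?lee_fin.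
Qed.

Lemma LF_le_hdim a : a != -oo%E -> LF tau a != -oo%E ->
  (LF tau a <= hdim [set x | supp nu x /\ ldim nu x = a /\ udim nu x = a])%E.
Proof.
move=> a_neq La; have [beta [J [-> Jex Jm Jc]]] := J_ex a_neq La.
have [w0 [n1 [e [w0v e0 H]]]] := nu_inside.
apply: (@hdim_lower R d m M p d_gt0 m_gt0 mM M_oo logM_small p_gt0 p_sum mu muE a beta J w0 n1 nu) => //.
  by exists e => // w wv ag; have [] := H w wv ag.
by move=> w wv ag; have [] := H w wv ag.
Qed.

(** One squeeze serves [Eset] and [lowE], for the measure and its restrictions. Where the transform
    is -oo, its nonnegativity on nonempty level sets makes [E] empty, in accordance with the
    dimension of the empty set. *)
Lemma spectrum_eq a (E : set 'rV[R]_d) : a != -oo%E ->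
  [set x | supp nu x /\ ldim nu x = a /\ udim nu x = a] `<=` E -> E `<=` lowE nu a ->
  hdim E = LF tau a.
Proof.
move=> a_neq sE Es; have [La|La] := eqVneq (LF tau a) -oo%E.
  have E0 : E = set0.
    apply/seteqP; split => // x /Es Ex.
    have [|] := @lowE_le_LF a a_neq; first by exists x.
    by rewrite La.
  by rewrite E0 hdim0 La.
have lo := le_trans (LF_le_hdim a_neq La) (hdim_mono sE).
apply/eqP; rewrite eq_le lo andbT.
have [E0|/set0P[x Ex]] := eqVneq E set0; first by rewrite E0 hdim0 leNye.
apply: le_trans (hdim_mono Es) _.
by have [|] := @lowE_le_LF a a_neq; first by exists x; exact: Es.
Qed.

End Spectrum.

Let mu_inside : exists w0 n1 e, [/\ valid N w0, 0 < e &
  forall w, valid N w -> agree n1 w w0 -> supp mu (pt w) /\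
    forall r, 0 < r < e -> mu (cball (pt w) r) = mu (cball (pt w) r)].
Proof.
exists (fun=> 0%N), 0%N, 1; split => // w wv _; split => //.
by apply/(supp_pt d_gt0 m_gt0 mM p_gt0 p_sum muE); exists w.
Qed.

Lemma fH_LF a : a != -oo%E -> fH mu a = LF tau a.
Proof.
move=> a_neq; apply: (@spectrum_eq mu) => //.
- exact: (mu_supp d_gt0 m_gt0 mM p_gt0 p_sum muE).
- by move=> x [? [? _]]; split.
Qed.

Lemma lfH_LF a : a != -oo%E -> lfH mu a = LF tau a.
Proof.
move=> a_neq; apply: (@spectrum_eq mu) => //.
- exact: (mu_supp d_gt0 m_gt0 mM p_gt0 p_sum muE).
- by move=> x [? [? _]]; split.
Qed.

(** The restriction satisfies the hypotheses of [spectrum_eq] with the same tau, so both lower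
    spectra equal [LF tau]. *)
Lemma mu_HM : HM mu.
Proof.
move=> x0 rho [y [iy sy]] a a_neq; rewrite lfH_LF//.
have [e e0 he] : exists2 e, 0 < e & forall z, edist y z < e -> edist x0 z <= rho.
  by apply: nbhs_edist; exact: iy.
(* As d > 0, there is a second point z near y, so a ball with interior points has positive
   radius. *)
have rho0 : 0 < rho.
  pose z := y + (e / 2) *: delta_mx ord0 (Ordinal d_gt0).
  have yz : edist z y ^+ 2 = (e / 2) ^+ 2.
    by rewrite edist_shift edistxx subrr mulr0 addr0 expr0n add0r.
  have e2 : 0 < e / 2 by rewrite divr_gt0.
  have yz' : edist z y = e / 2.
    by apply/eqP; rewrite -(@eqrXn2 _ 2) ?edist_ge0 ?ltW// yz.
  have h1 : edist x0 z <= rho by apply: he; rewrite edistC yz'; lra.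
  have h2 : edist x0 y <= rho by apply: he; rewrite edistxx.
  rewrite ltNge; apply/negP => r0.
  have := edist_triangle x0 z y; rewrite yz' (edistC z); lra.
have [w0 w0v yw] := (supp_pt d_gt0 m_gt0 mM p_gt0 p_sum muE y).1 sy.
have e2 : 0 < e / 2 by rewrite divr_gt0.
have [n1 hn1] := rad_small d_gt0 m_gt0 mM e2.
have inside w r : valid N w -> agree n1 w w0 -> r < e / 2 ->
    cball (pt w) r `<=` cball x0 rho.
  move=> wv ag re z hz; apply: he; apply: le_lt_trans (edist_triangle (pt w) _ _) _.
  have : edist y (pt w) <= rad n1.
    by rewrite yw; apply: (@pt_agree R d m M) => //; exact: agree_sym.
  move: hz; rewrite /cball/= -/rad in hn1 *; lra.
apply: (@spectrum_eq (restr mu x0 rho)) => //.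
- exact: restr_le.
- move=> x sx.
  exact: (restr_supp d_gt0 m_gt0 mM M_oo p_gt0 p_half p_sum muE rho0 sx).
- exists w0, n1, (e / 2); split => // w wv ag; split => [U oU Uw|r /andP[r0 re]]; last first.
    by rewrite /restr setIidl//; exact: inside.
  have [e' e'0 he'] := nbhs_edist (open_nbhs_nbhs (conj oU Uw)).
  have m0 : 0 < Num.min e' (e / 2) by rewrite lt_min e'0.
  have [n hn] := rad_small d_gt0 m_gt0 mM m0.
  have [hn2 hn3] : rad n < e' /\ rad n < e / 2 by move: hn; rewrite lt_min => /andP[].
  apply: (@lt_le_trans _ _ (cylmass p w n)%:E); first by rewrite lte_fin (cylmass_gt0 p_gt0).
  apply: le_trans (mu_cball_ge d_gt0 m_gt0 mM p_gt0 p_sum muE wv (lexx _)) _.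
  apply: (mu_le mu); [exact: measurable_cball| |].
    by apply: measurableI; [exact: measurable_open_set|exact: measurable_cball].
  move=> z hz; split; last exact: inside hn3 _ hz.
  by apply: he'; apply: le_lt_trans hn2.
- by move=> x [? [? _]]; split.
Qed.

End AbstractFormalism.

(** * Concave spectra and their conjugates *)

Section ConcaveSpectrum.
Variables (R : realType) (d : nat) (tau : R -> \bar R) (D : R).
Hypothesis tau_oo : forall q, tau q != +oo%E.
Hypothesis tau_concave : concave_ext tau.
Hypothesis tau_nondecr : nondecr_ext tau.
Hypothesis tau1 : tau 1 = 0%E.
Hypothesis tau0_ge : ((- d%:R)%:E <= tau 0)%E.
Hypothesis tau0_le : (tau 0 <= 0)%E.
Hypothesis tau_dom : (forall q, tau q != -oo%E) \/ (forall q, tau q != -oo%E <-> 0 <= q).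
Hypothesis LF_ge0 : forall a : \bar R, a != -oo%E -> LF tau a != -oo%E -> (0 <= LF tau a)%E.
Hypothesis D_deriv : rderiv1 tau <= D <= lderiv1 tau.

Definition ftau q : R := fine (tau q).

Lemma ftauE q : tau q != -oo%E -> tau q = (ftau q)%:E.
Proof. by move=> h; rewrite fineK// fin_numE h tau_oo. Qed.

Lemma dom_ge0 q : 0 <= q -> tau q != -oo%E.
Proof. by move=> q0; case: tau_dom => [//|h]; apply/h. Qed.

Lemma dom_convex x y z : x < y -> y < z -> tau x != -oo%E -> tau y != -oo%E.
Proof.
move=> xy yz; case: tau_dom => [//|h] /h x0; apply/h; exact: le_trans x0 (ltW xy).
Qed.

Lemma ftau1 : ftau 1 = 0. Proof. by rewrite /ftau tau1. Qed.

Lemma ftau0_bounds : - d%:R <= ftau 0 <= 0.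
Proof. by rewrite -!lee_fin -ftauE ?dom_ge0// tau0_ge tau0_le. Qed.

Lemma ftau_mono x y : x <= y -> tau x != -oo%E -> tau y != -oo%E -> ftau x <= ftau y.
Proof. by move=> xy hx hy; rewrite -lee_fin -!ftauE//; exact: tau_nondecr. Qed.

Lemma ftau_concave x y z : x < y -> y < z -> tau x != -oo%E -> tau z != -oo%E ->
  ftau x * (z - y) + ftau z * (y - x) <= ftau y * (z - x).
Proof.
move=> xy yz hx hz; have hy := dom_convex xy yz hx.
have zx : 0 < z - x by lra.
have t01 : 0 < (z - y) / (z - x) < 1.
  apply/andP; split; first by apply: divr_gt0 => //; rewrite subr_gt0.
  by rewrite ltr_pdivrMr// mul1r; lra.
have := tau_concave x z t01.
have -> : (z - y) / (z - x) * x + (1 - (z - y) / (z - x)) * z = y by field; lra.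
rewrite (ftauE hx) (ftauE hy) (ftauE hz) -!EFinM -EFinD lee_fin.
rewrite -(ler_pM2r zx); congr (_ <= _).
by field; lra.
Qed.

Lemma slope_anti x y z : x < y -> y < z -> tau x != -oo%E -> tau z != -oo%E ->
  (ftau z - ftau y) / (z - y) <= (ftau y - ftau x) / (y - x).
Proof.
move=> xy yz hx hz; have := ftau_concave xy yz hx hz.
rewrite ler_pdivrMr ?subr_gt0// mulrAC ler_pdivlMr ?subr_gt0//; nra.
Qed.

(** The supremum of the slopes to the right of q supports tau. A point of the domain to the left of
    q bounds these slopes; on the half line this excludes q = 0. *)
Lemma support_slope q : (exists2 x, x < q & tau x != -oo%E) ->
  exists2 a, 0 <= a & forall y, tau y != -oo%E -> ftau y <= ftau q + a * (y - q).
Proof.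
move=> [x xq hx]; have hz z : q < z -> tau z != -oo%E.
  by move=> qz; apply: (dom_convex (z := z + 1) (lt_trans xq qz)) => //; rewrite ltrDl.
have hq := dom_convex xq (ltr_pwDr ltr01 (lexx q)) hx.
pose A := [set s | exists2 z, q < z & s = (ftau z - ftau q) / (z - q)].
have ubA y : y < q -> tau y != -oo%E -> ubound A ((ftau q - ftau y) / (q - y)).
  by move=> yq hy _ [z qz ->]; exact: slope_anti (hz z qz).
have A0 : A !=set0 by exists ((ftau (q + 1) - ftau q) / (q + 1 - q)), (q + 1) => //; rewrite ltrDl.
have hA : has_ubound A by eexists; exact: ubA xq hx.
exists (sup A).
  apply: le_trans (ub_le_sup hA (_ : A ((ftau (q + 1) - ftau q) / (q + 1 - q)))).
    rewrite divr_ge0//; last lra.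
    by rewrite subr_ge0; apply: ftau_mono => //; [lra|apply: hz; lra].
  by exists (q + 1) => //; lra.
move=> y hy; have [yq|yq|->] := ltgtP y q; last by rewrite subrr mulr0 addr0.
  have : sup A <= (ftau q - ftau y) / (q - y) by apply: ge_sup => //; exact: ubA.
  rewrite ler_pdivlMr ?subr_gt0//; lra.
have : (ftau y - ftau q) / (y - q) <= sup A by apply: ub_le_sup => //; exists y.
rewrite ler_pdivrMr ?subr_gt0//; lra.
Qed.

Let incr h := (fine (tau (1 + h)) - fine (tau 1)) / h.

Let incrE h : incr h = ftau (1 + h) / h.
Proof. by rewrite /incr tau1 subr0. Qed.

Let incr_right h k : 0 < h -> h <= k -> incr k <= incr h.
Proof.
move=> h0; rewrite le_eqVlt => /orP[/eqP ->//|hk]; rewrite !incrE.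
have := @ftau_concave 1 (1 + h) (1 + k).
rewrite ftau1 mul0r add0r !dom_ge0//; [|lra..] => H.
rewrite ler_pdivrMr ?(lt_trans h0)// mulrAC ler_pdivlMr//.
have := H ltac:(lra) ltac:(lra) isT isT; lra.
Qed.

Let incr_left h k : k < 0 -> h <= k -> tau (1 + h) != -oo%E -> incr k <= incr h.
Proof.
move=> k0; rewrite le_eqVlt => /orP[/eqP ->//|hk] domh; rewrite !incrE.
have h0 : h < 0 by exact: lt_trans k0.
have := @ftau_concave (1 + h) (1 + k) 1.
rewrite ftau1 mul0r addr0 (dom_ge0 ler01) domh => H.
rewrite ler_ndivrMr// mulrAC ler_ndivrMr//.
have := H ltac:(lra) ltac:(lra) isT isT; lra.
Qed.

(** By concavity the increments at 1 are monotone, so the right derivative is the supremum of those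
    on the right and the left derivative the infimum of those on the left; D lies between. *)
Lemma D_support y : tau y != -oo%E -> ftau y <= D * (y - 1).
Proof.
move=> hy; have /andP[hr hl] := D_deriv.
have [y1|y1|->] := ltgtP y 1; last by rewrite ftau1 subrr mulr0.
- pose g h := incr (- h).
  have mono : {in Interval (BRight (0 : R)) (BLeft 1) &, nondecreasing_fun g}.
    move=> h k hI kI hk; move: hI kI; rewrite !in_itv/= => /andP[h0 h1] /andP[k0 k1].
    by apply: incr_left; [lra|lra|apply: dom_ge0; lra].
  have lb : has_lbound (g @` [set` Interval (BRight (0 : R)) (BLeft 1)]).
    exists 0 => _ [h hI <-]; move: hI; rewrite /= in_itv/= => /andP[h0 h1]; rewrite /g incrE.
    apply: mulr_le0; last by rewrite invr_le0; lra.
    by rewrite -ftau1; apply: ftau_mono; [lra|apply: dom_ge0; lra|apply: dom_ge0; lra].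
  have ab : (BRight (0 : R) < BLeft 1)%O by rewrite bnd_simp ltr01.
  have cv := nondecreasing_at_right_cvgr ab mono lb.
  have lE : lderiv1 tau = inf (g @` [set` Interval (BRight (0 : R)) (BLeft 1)]).
    by apply: cvg_lim => //; apply/cvg_at_leftNP; rewrite oppr0.
  have key h : 0 < h < 1 -> D <= g h.
    move=> h01; apply: le_trans hl _; rewrite lE; apply: (ge_inf lb).
    by exists h; rewrite //= in_itv.
  have : D <= incr (y - 1).
    have [y0|y0] := ltP 0 y; first by rewrite -[y - 1]opprK; apply: key; lra.
    (* The limit was taken over 0 < h < 1, where 1 - h is certain to be in the domain; y <= 0 is
       compared with the increment at -1/2. *)
    apply: le_trans (key 2^-1 _) _; first by lra.
    by apply: incr_left; [lra|lra|rewrite addrC subrK].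
  rewrite incrE (addrC 1) subrK ler_ndivlMr; lra.
have mono : {in Interval (BRight (0 : R)) (BInfty _ false) &, nonincreasing_fun incr}.
  move=> h k hI kI hk; move: hI kI; rewrite !in_itv/= !andbT => h0 k0.
  exact: incr_right.
have ub : has_ubound (incr @` [set` Interval (BRight (0 : R)) (BInfty _ false)]).
  exists (ftau 1 - ftau 0) => _ [h hI <-]; move: hI; rewrite /= in_itv/= andbT => h0.
  rewrite incrE; have := @slope_anti 0 1 (1 + h) ltr01.
  rewrite ftau1 !dom_ge0//; [|lra..] => H.
  have h10 : 1 < 1 + h by lra.
  have := H h10 isT isT; rewrite ?ftau1 !subr0 divr1 (addrC 1) addrK ?subr0; lra.
have ab : (BRight (0 : R) < BInfty _ false)%O by [].
have cv := nonincreasing_at_right_cvgr ab mono ub.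
have rE : rderiv1 tau = sup (incr @` [set` Interval (BRight (0 : R)) (BInfty _ false)]).
  exact: cvg_lim.
have : incr (y - 1) <= D.
  apply: le_trans hr; rewrite rE; apply: ub_le_sup => //; exists (y - 1) => //=.
  by rewrite in_itv/= andbT subr_gt0.
rewrite incrE (addrC 1) subrK ler_pdivrMr; lra.
Qed.

Lemma D_le : D <= - ftau 0.
Proof. have := D_support (dom_ge0 (lexx 0)); lra. Qed.

Lemma D_ge0 : 0 <= D.
Proof.
have d2 : tau 2 != -oo%E by exact: dom_ge0.
have := D_support d2; have : ftau 1 <= ftau 2.
  by apply: ftau_mono; [lra|exact: dom_ge0|].
rewrite ftau1; lra.
Qed.

Lemma LF_real_le a q : tau q != -oo%E -> (LF tau a%:E <= (a * q - ftau q)%:E)%E.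
Proof.
by move=> hq; apply: ereal_inf_lbound; exists q => //=; rewrite ftauE// -EFinB.
Qed.

Lemma LF_real_fin a : LF tau a%:E != -oo%E -> LF tau a%:E = (fine (LF tau a%:E))%:E.
Proof.
move=> h; rewrite fineK// fin_numE h andTb; apply/eqP => E.
by have := LF_real_le a (dom_ge0 ler01); rewrite E.
Qed.

Lemma LF_support a q : tau q != -oo%E ->
  (forall y, tau y != -oo%E -> ftau y <= ftau q + a * (y - q)) ->
  LF tau a%:E = (a * q - ftau q)%:E.
Proof.
move=> hq H; apply/eqP; rewrite eq_le LF_real_le//=.
apply: le_ereal_inf_tmp => _ [y /= hy <-]; rewrite (ftauE hy) -EFinB lee_fin.
have := H y hy; lra.
Qed.

(** Since tau(1) = 0, the term q = 1 bounds the infimum by a < 0, against nonnegativity. *)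
Lemma LF_neg a : a < 0 -> LF tau a%:E = -oo%E.
Proof.
move=> a0; apply: contrapT => /eqP h; have h0 := @LF_ge0 a%:E isT h.
have := LF_real_le a (dom_ge0 ler01); rewrite ftau1 subr0 mulr1.
by move=> /(le_trans h0); rewrite lee_fin leNgt a0.
Qed.

Lemma LF_oo_all : (forall q, tau q != -oo%E) -> LF tau +oo%E = -oo%E.
Proof.
move=> H; apply/eqP; rewrite -leeNy_eq; apply: ereal_inf_lbound; exists (- 1) => /=.
  by split => //; lra.
have n1 : - 1 < 0 :> R by lra.
by rewrite n1 ftauE.
Qed.

Lemma LF_oo_half : (forall q, tau q != -oo%E <-> 0 <= q) -> LF tau +oo%E = (- ftau 0)%:E.
Proof.
move=> H; apply/eqP; rewrite eq_le; apply/andP; split.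
  apply: ereal_inf_lbound; exists 0 => /=; first by rewrite dom_ge0.
  by rewrite ltxx add0e ftauE ?dom_ge0.
apply: le_ereal_inf_tmp => _ [q /= [/H q0 q0'] <-].
have -> : q = 0 by apply/eqP; rewrite eq_le q0 q0'.
by rewrite ltxx add0e ftauE ?dom_ge0.
Qed.

End ConcaveSpectrum.

(** * The weights *)

Section Block.
Variables (R : realType) (d : nat) (s0 D : R) (ls : R -> R) (domL : R -> Prop) (rho : nat -> R).
Hypothesis d_gt0 : (0 < d)%N.
Hypothesis D_s0 : 0 <= D <= s0.
Hypothesis s0_d : s0 <= d%:R.
Hypothesis ls_bounds : forall a, domL a -> [/\ 0 <= a, 0 <= ls a, ls a <= a & ls a <= s0].
Hypothesis rho_ge : forall k, s0 <= rho k.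

(** An integer near exp x, positive for every x; the rounding costs at most a factor 2 when x >=
    0. *)
Definition cnt (x : R) : nat := (Num.trunc (expR x)).+1.
(** This is ln Q for Q = 2^(k+1), the unit of exponents at level k. *)
Definition blk k : R := k.+1%:R * ln 2.
(** The d-th power, the number of letters, is Q^s0 up to powers of k. The factor (k+4)^3 makes room
    in [room] for 5 + 2 (k+1)^2 multiples of Q^s0. *)
Definition mdig k : nat := (k.+4 ^ 3 * cnt (blk k * (s0 / d%:R)))%N.
(** As s0 <= d, the count in [mdig] is at most 2Q = 2^(k+2); the factor 4d is the spacing of the
    subcubes. *)
Definition Mscale k : nat := (4 * d * (k.+4 ^ 3 * 2 ^ k.+2))%N.

Definition cell k j : set R := [set a | domL a /\ j%:R <= a * k.+1%:R < j.+1%:R].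
Definition act k j : bool := `[< cell k j !=set0 >].
Definition bdim k j : R := sup [set ls a | a in cell k j].
Definition expo k j : R := j%:R / k.+1%:R.
(** Cells reach up to exponent k + 1, so every finite exponent is represented from some level on. *)
Definition ncell k : nat := (k.+1 ^ 2)%N.
(** Small enough for 4 (k+1)^2 + 1 portions of mass [thin k] to total at most 1/((k+1)(k+2)), yet
    only polynomial in k. *)
Definition thin k : R := (k.+4%:R ^+ 5)^-1.

(** The factor 2 provides two letters even when D = 0, whence weights at most 1/2. *)
Definition cntD k : nat := (2 * cnt (blk k * D))%N.
Definition cntC k j : nat := if act k j then cnt (blk k * bdim k j) else 0%N.
Definition massC k j : R := thin k * expR (- (blk k * expo k j)).
Definition cntR k : nat := (mdig k ^ d - cntD k - \sum_(0 <= j < ncell k) cntC k j)%N.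
(** About Q^-rho, there being about Q^s0 letters; dividing by their exact number bounds the total
    light mass by [thin k]. *)
Definition massR k : R := thin k * expR (blk k * (s0 - rho k)) / (mdig k ^ d)%:R.
Definition lost k : R :=
  \sum_(0 <= j < ncell k) (cntC k j)%:R * massC k j + (cntR k)%:R * massR k.
Definition massD k : R := (1 - lost k) / (cntD k)%:R.

Definition letters k : seq R :=
  nseq (cntD k) (massD k) ++
  flatten [seq nseq (cntC k j) (massC k j) | j <- index_iota 0 (ncell k)] ++
  nseq (cntR k) (massR k).
Definition weight k i : R := nth 0 (letters k) i.

Lemma ln2_gt0 : 0 < ln 2 :> R. Proof. by apply: ln_gt0; rewrite ltr1n. Qed.

Lemma blk_gt0 k : 0 < blk k. Proof. by rewrite mulr_gt0 ?ln2_gt0 ?ltr0n. Qed.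

Lemma expR_blk k : expR (blk k) = (2 ^ k.+1)%:R.
Proof. by rewrite expRM_natl lnK ?posrE// natrX. Qed.

Lemma cnt_bounds x : 0 <= x -> expR x <= (cnt x)%:R <= 2 * expR x.
Proof.
move=> x0; have /andP[h1 h2] := truncn_itv (expR_ge0 x); apply/andP; split; first exact: ltW.
have h3 : 1 <= expR x by rewrite -[leLHS]expR0 ler_expR.
by rewrite /cnt -[_.+1%:R]natr1 mulr_natl mulr2n; exact: lerD.
Qed.

Lemma s0_ge0 : 0 <= s0. Proof. by case/andP: D_s0 => h1 h2; exact: le_trans h2. Qed.

Lemma d_gt0R : (0 : R) < d%:R. Proof. by rewrite ltr0n. Qed.

Lemma sd_bounds k : 0 <= blk k * (s0 / d%:R) <= blk k.
Proof.
have b0 := blk_gt0 k; rewrite mulr_ge0 ?(ltW b0) ?divr_ge0 ?s0_ge0//=.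
by rewrite ler_piMr ?(ltW b0)// ler_pdivrMr ?d_gt0R// mul1r.
Qed.

Lemma mdig_gt0 k : (0 < mdig k)%N.
Proof. by rewrite muln_gt0 expn_gt0. Qed.

Lemma mdig_Mscale k : (4 * d * mdig k <= Mscale k)%N.
Proof.
rewrite /Mscale leq_mul2l /mdig leq_mul2l; apply/orP; right; apply/orP; right.
rewrite -(@ler_nat R); have /andP[h1 h2] := sd_bounds k.
have /andP[_ h] := cnt_bounds h1; apply: le_trans h _.
by rewrite expnS natrM ler_pM2l// -expR_blk ler_expR.
Qed.

Lemma mdig_bounds k : expR (blk k * s0) * k.+4%:R ^+ 3 <= (mdig k ^ d)%:R /\
  ln (mdig k ^ d)%:R <= blk k * s0 + d%:R * (ln 2 + 3 * ln k.+4%:R).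
Proof.
have /andP[h1 h2] := sd_bounds k; have /andP[h3 h4] := cnt_bounds h1.
have E : expR (blk k * s0) = expR (blk k * (s0 / d%:R)) ^+ d.
  by rewrite -expRM_natl; congr expR; field; rewrite gt_eqF ?d_gt0R.
have k4 : (1 : R) <= k.+4%:R ^+ 3 by rewrite -natrX ler1n expn_gt0.
rewrite natrX /mdig natrM natrX; split.
  rewrite exprMn E mulrC; apply: ler_pM; rewrite ?exprn_ge0 ?expR_ge0//.
    by rewrite -[leLHS]expr1 ler_weXn2l.
  by apply: lerXn2r; rewrite ?nnegrE ?expR_ge0.
have c0 : 0 < (cnt (blk k * (s0 / d%:R)))%:R :> R by rewrite ltr0n.
rewrite lnXn; last by rewrite mulr_gt0// exprn_gt0.
rewrite lnM ?posrE ?exprn_gt0// lnXn// -[leLHS]mulr_natl -[ln _ *+ 3]mulr_natl.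
have : ln (cnt (blk k * (s0 / d%:R)))%:R <= ln 2 + blk k * (s0 / d%:R).
  apply: le_trans (ln_mono c0 h4) _; rewrite lnM ?posrE ?expR_gt0// expRK//.
move=> h5; have -> : blk k * s0 = d%:R * (blk k * (s0 / d%:R)).
  by field; rewrite gt_eqF ?d_gt0R.
by rewrite -mulrDr ler_pM2l ?d_gt0R//; lra.
Qed.

Lemma bdim_ub k j a : cell k j a -> ls a <= bdim k j.
Proof.
move=> ca; apply: ub_le_sup; last by exists a.
by exists s0 => _ [b [/ls_bounds[_ _ _ h] _] <-].
Qed.

Lemma bdim_le k j B : act k j -> (forall a, cell k j a -> ls a <= B) -> bdim k j <= B.
Proof.
move=> /asboolP[a ca] H; apply: ge_sup; first by exists (ls a), a.
by move=> _ [b cb <-]; exact: H.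
Qed.

(** The last bound is [ls a <= a], which comes from tau(1) = 0, at the upper end of the cell. *)
Lemma bdim_bounds k j : act k j ->
  [/\ 0 <= bdim k j, bdim k j <= s0 & bdim k j <= expo k j + k.+1%:R^-1].
Proof.
move=> ac; split.
- by case/asboolP: (ac) => a ca; apply: le_trans (bdim_ub ca); case: ca => /ls_bounds[].
- by apply: bdim_le => // a [/ls_bounds[]].
- apply: bdim_le => // a [/ls_bounds[_ _ h _] /andP[_ h2]]; apply: le_trans h _.
  rewrite /expo -[X in _ + X]mul1r -mulrDl natr1 ler_pdivlMr ?ltr0n//; exact: ltW.
Qed.

Lemma thin_gt0 k : 0 < thin k. Proof. by rewrite invr_gt0 exprn_gt0// ltr0n. Qed.

Lemma massC_gt0 k j : 0 < massC k j. Proof. by rewrite mulr_gt0 ?thin_gt0 ?expR_gt0. Qed.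

Lemma massR_gt0 k : 0 < massR k.
Proof. by rewrite divr_gt0 ?mulr_gt0 ?thin_gt0 ?expR_gt0// ltr0n expn_gt0 mdig_gt0. Qed.

Lemma cntD_bounds k : 2 * expR (blk k * D) <= (cntD k)%:R <= 4 * expR (blk k * D).
Proof.
have D0 : 0 <= blk k * D by rewrite mulr_ge0 ?(ltW (blk_gt0 k))//; case/andP: D_s0.
have /andP[h1 h2] := cnt_bounds D0; rewrite /cntD natrM; apply/andP; split; lra.
Qed.

Lemma cntD_gt1 k : (1 < cntD k)%N.
Proof. by rewrite /cntD /cnt; lia. Qed.

Lemma cntC_le k j : (cntC k j)%:R <= 2 * expR (blk k * s0).
Proof.
rewrite /cntC; case: ifPn => [ac|_]; last by rewrite mulr_ge0 ?expR_ge0.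
have [b0 b1 _] := bdim_bounds ac; have bk := blk_gt0 k.
have /andP[_ h] := @cnt_bounds (blk k * bdim k j) (mulr_ge0 (ltW bk) b0).
by apply: le_trans h _; rewrite ler_pM2l// ler_expR ler_pM2l.
Qed.

Lemma room k : expR (blk k * s0) + (cntD k)%:R + (\sum_(0 <= j < ncell k) cntC k j)%:R
  <= (mdig k ^ d)%:R.
Proof.
have [h _] := mdig_bounds k; apply: le_trans h.
have /andP[_ h1] := cntD_bounds k; have bk := blk_gt0 k.
have h2 : expR (blk k * D) <= expR (blk k * s0) by rewrite ler_expR ler_pM2l//; case/andP: D_s0.
have h3 : (\sum_(0 <= j < ncell k) cntC k j)%:R <= (ncell k)%:R * (2 * expR (blk k * s0)).
  rewrite natr_sum; apply: (@le_trans _ _ (\sum_(0 <= j < ncell k) 2 * expR (blk k * s0))).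
    by apply: ler_sum => j _; exact: cntC_le.
  by rewrite sumr_const_nat subn0 -[leLHS]mulr_natl.
have E0 := expR_gt0 (blk k * s0); set E := expR (blk k * s0) in h2 h3 E0 *.
have h4 : (1 + 4 + 2 * ncell k)%:R <= k.+4%:R ^+ 3 :> R.
  by rewrite -natrX ler_nat /ncell -(addn4 k) -(addn1 k) !expnS !expn0; nia.
apply: (@le_trans _ _ (E * (1 + 4 + 2 * ncell k)%:R)); last by rewrite ler_pM2l.
rewrite !natrD natrM; lra.
Qed.

Lemma cntR_ge k : expR (blk k * s0) <= (cntR k)%:R.
Proof.
have h := room k; have E0 := expR_gt0 (blk k * s0).
have le : (cntD k + \sum_(0 <= j < ncell k) cntC k j <= mdig k ^ d)%N.
  by rewrite -(@ler_nat R) natrD; lra.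
by rewrite /cntR -subnDA natrB// natrD; lra.
Qed.

Lemma size_letters k : size (letters k) = (mdig k ^ d)%N.
Proof.
have gen s : sumn (shape [seq nseq (cntC k j) (massC k j) | j <- s]) = (\sum_(j <- s) cntC k j)%N.
  by elim: s => [|j s IH]; rewrite ?big_nil// big_cons /= size_nseq IH.
rewrite /letters size_cat size_nseq size_cat size_nseq size_flatten gen.
have h := room k; have E0 := expR_gt0 (blk k * s0).
have le : (cntD k + \sum_(0 <= j < ncell k) cntC k j <= mdig k ^ d)%N.
  by rewrite -(@ler_nat R) natrD; lra.
move: le; rewrite /cntR -subnDA; move: (\sum_(0 <= j < ncell k) _)%N => T le.
by rewrite addnA subnKC.
Qed.

Lemma sum_letters (F : R -> R) k :
  \sum_(0 <= i < mdig k ^ d) F (weight k i) =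
  (cntD k)%:R * F (massD k) + \sum_(0 <= j < ncell k) (cntC k j)%:R * F (massC k j) +
  (cntR k)%:R * F (massR k).
Proof.
have nseqE c (x : R) : \sum_(y <- nseq c x) F y = c%:R * F x.
  by rewrite big_nseq iter_addr addr0 mulr_natl.
have flatE s : \sum_(y <- flatten [seq nseq (cntC k j) (massC k j) | j <- s]) F y =
    \sum_(j <- s) (cntC k j)%:R * F (massC k j).
  elim: s => [|j s IH]; first by rewrite !big_nil.
  by rewrite [in RHS]big_cons -IH -nseqE -big_cat.
transitivity (\sum_(x <- letters k) F x).
  by rewrite -(size_letters k) [RHS](big_nth 0).
have catE s1 s2 : \sum_(y <- s1 ++ s2) F y = \sum_(y <- s1) F y + \sum_(y <- s2) F y.
  by rewrite big_cat.
by rewrite /letters catE catE nseqE flatE nseqE addrA.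
Qed.

(** Written as a telescoping difference for the Borel-Cantelli estimate of [exact_dim_J]. *)
Lemma lost_le k : lost k <= (k.+1%:R)^-1 - (k.+2%:R)^-1.
Proof.
have th0 := thin_gt0 k; have bk := blk_gt0 k.
have h1 j : (cntC k j)%:R * massC k j <= 4 * thin k.
  rewrite /cntC; case: ifPn => [ac|_]; last by rewrite mul0r mulr_ge0// ltW.
  have [b0 _ b1] := bdim_bounds ac.
  have /andP[_ h] := @cnt_bounds (blk k * bdim k j) (mulr_ge0 (ltW bk) b0).
  apply: le_trans (ler_wpM2r (ltW (massC_gt0 k j)) h) _.
  rewrite /massC mulrCA -mulrA -expRD mulrC ler_wpM2r ?(ltW th0)//.
  (* A cell has width 1/(k+1) and Q = 2^(k+1), so discretising the exponents costs only a factor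
     2. *)
  have : blk k * bdim k j - blk k * expo k j <= ln 2.
    rewrite -mulrBr; apply: (@le_trans _ _ (blk k * k.+1%:R^-1)).
      by rewrite ler_pM2l// lerBlDl.
    by rewrite /blk mulrAC mulfV ?mul1r// pnatr_eq0.
  rewrite -ler_expR lnK ?posrE//; lra.
have h2 : (cntR k)%:R * massR k <= thin k.
  have m0 : (0 : R) < (mdig k ^ d)%:R by rewrite ltr0n expn_gt0 mdig_gt0.
  rewrite /massR mulrA ler_pdivrMr//.
  have h3 : (cntR k)%:R <= (mdig k ^ d)%:R :> R.
    by rewrite ler_nat /cntR -subnDA leq_subr.
  have h4 : expR (blk k * (s0 - rho k)) <= 1.
    by rewrite -[leRHS]expR0 ler_expR pmulr_rle0// subr_le0.
  rewrite mulrCA; apply: ler_wpM2l; first exact: ltW.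
  by rewrite -[leRHS]mulr1; apply: ler_pM => //; exact: expR_ge0.
apply: (@le_trans _ _ ((ncell k)%:R * (4 * thin k) + thin k)).
  apply: lerD => //; apply: (@le_trans _ _ (\sum_(0 <= j < ncell k) 4 * thin k)).
    by apply: ler_sum => j _; exact: h1.
  by rewrite sumr_const_nat subn0 -[leLHS]mulr_natl.
have -> : (ncell k)%:R * (4 * thin k) + thin k = (4 * ncell k + 1)%:R * thin k.
  by rewrite natrD natrM; ring.
have -> : (k.+1%:R)^-1 - (k.+2%:R)^-1 = (k.+1 * k.+2)%:R^-1 :> R.
  rewrite natrM -!natr1; have k0 : (0 : R) <= k%:R by [].
  field; rewrite !gt_eqF//; lra.
rewrite /thin ler_pdivrMr ?exprn_gt0 ?ltr0n// [leRHS]mulrC ler_pdivlMr ?ltr0n ?muln_gt0//.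
rewrite -natrX -natrM ler_nat /ncell (expnD _ 3 2); apply: leq_mul.
  by rewrite -(addn4 k) -(addn1 k) !expnS !expn0; nia.
by rewrite -mulnn; apply: leq_mul; lia.
Qed.

Lemma lost_ge0 k : 0 <= lost k.
Proof.
apply: addr_ge0; last by rewrite mulr_ge0// ltW// massR_gt0.
by apply: sumr_ge0 => j _; rewrite mulr_ge0// ltW// massC_gt0.
Qed.

Lemma lost_half k : lost k <= 2^-1.
Proof.
apply: le_trans (lost_le k) _.
have -> : (k.+1%:R)^-1 - (k.+2%:R)^-1 = (k.+1 * k.+2)%:R^-1 :> R.
  rewrite natrM -!natr1; have k0 : (0 : R) <= k%:R by [].
  field; rewrite !gt_eqF//; lra.
by rewrite lef_pV2 ?posrE ?ltr0n// ler_nat; nia.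
Qed.

Lemma massD_bounds k : (2 * (cntD k)%:R)^-1 <= massD k <= (cntD k)%:R^-1.
Proof.
have h1 := lost_half k; have h2 := lost_ge0 k; have c1 := cntD_gt1 k.
have c0 : (0 : R) < (cntD k)%:R^-1 by rewrite invr_gt0 ltr0n; apply: ltn_trans c1.
rewrite /massD invfM; apply/andP; split; first by rewrite ler_pM2r//; lra.
by rewrite ler_piMl ?(ltW c0)//; lra.
Qed.

Lemma massD_gt0 k : 0 < massD k.
Proof.
have /andP[h _] := massD_bounds k; apply: lt_le_trans h.
by rewrite invr_gt0 mulr_gt0// ltr0n (ltn_trans _ (cntD_gt1 k)).
Qed.

Lemma weight_cases k i : (i < mdig k ^ d)%N ->
  [\/ weight k i = massD k, (exists j, weight k i = massC k j /\ act k j) | weight k i = massR k].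
Proof.
rewrite -size_letters => /(mem_nth 0); rewrite -/(weight k i) /letters mem_cat mem_cat.
move=> /or3P[]; rewrite ?mem_nseq.
- by move=> /andP[_ /eqP]; constructor 1.
- move=> /flattenP[s /mapP[j _ ->]]; rewrite mem_nseq => /andP[h /eqP E].
  by constructor 2; exists j; split => //; move: h; rewrite /cntC; case: ifP.
- by move=> /andP[_ /eqP]; constructor 3.
Qed.

Lemma weight_gt0 k i : (i < mdig k ^ d)%N -> 0 < weight k i.
Proof.
by move=> /weight_cases[->|[j [-> _]]|->]; [exact: massD_gt0|exact: massC_gt0|exact: massR_gt0].
Qed.

Lemma weight_sum k : \sum_(0 <= i < mdig k ^ d) weight k i = 1.
Proof.
rewrite (sum_letters id) -addrA -/(lost k) /massD mulrC divfK ?subrK//.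
by rewrite pnatr_eq0 -lt0n (ltn_trans _ (cntD_gt1 k)).
Qed.

Lemma weight_notD k :
  \sum_(0 <= i < mdig k ^ d | weight k i != massD k) weight k i <= (k.+1%:R)^-1 - (k.+2%:R)^-1.
Proof.
apply: le_trans (lost_le k); rewrite big_mkcond/=.
rewrite (sum_letters (fun x => if x != massD k then x else 0)) eqxx/= mulr0 add0r.
have aux (c : nat) x : 0 <= x -> c%:R * (if x != massD k then x else 0) <= c%:R * x.
  by move=> x0; case: ifP => // _; rewrite mulr0 mulr_ge0.
apply: lerD; last exact/aux/ltW/massR_gt0.
by apply: ler_sum => j _; apply: aux; exact/ltW/massC_gt0.
Qed.

Lemma weight_half k i : (i < mdig k ^ d)%N -> weight k i <= 2^-1.
Proof.
have small x : x <= lost k -> x <= 2^-1 by move=> h; apply: le_trans (lost_half k).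
move=> iN; have [E|ne] := eqVneq (weight k i) (massD k).
  rewrite E; have /andP[_ h] := massD_bounds k; apply: le_trans h _.
  by rewrite lef_pV2 ?posrE ?ltr0n ?ler_nat ?cntD_gt1//; apply: ltn_trans (cntD_gt1 k).
apply: le_trans (le_trans (weight_notD k) _); last first.
  have -> : (k.+1%:R)^-1 - (k.+2%:R)^-1 = (k.+1 * k.+2)%:R^-1 :> R.
    rewrite natrM -!natr1; have k0 : (0 : R) <= k%:R by [].
    field; rewrite !gt_eqF//; lra.
  by rewrite lef_pV2 ?posrE ?ltr0n// ler_nat; nia.
rewrite big_mkord (bigD1 (Ordinal iN))//= lerDl; apply: sumr_ge0 => l _.
exact/ltW/weight_gt0.
Qed.

Lemma count_weight k v : count (fun i => weight k i == v) (iota 0 (mdig k ^ d)) =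
  count (pred1 v) (letters k).
Proof.
have -> : letters k = [seq weight k i | i <- iota 0 (mdig k ^ d)].
  by rewrite -size_letters -[LHS](mkseq_nth 0).
by rewrite count_map.
Qed.

Lemma count_nseq_le (c : nat) (v : R) : (c <= count (pred1 v) (nseq c v))%N.
Proof. by rewrite count_nseq/= eqxx mul1n. Qed.

(** Letters are selected by the value of their weight; coincidences between kinds can only enlarge
    the selection, hence an inequality. *)
Lemma count_R k : (cntR k <= count (fun i => weight k i == massR k) (iota 0 (mdig k ^ d)))%N.
Proof.
rewrite count_weight /letters catA count_cat; apply: leq_trans (count_nseq_le _ _) _.
exact: leq_addl.
Qed.

Lemma count_C k j : (j < ncell k)%N ->
  (cntC k j <= count (fun i => weight k i == massC k j) (iota 0 (mdig k ^ d)))%N.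
Proof.
move=> jn; rewrite count_weight /letters count_cat count_cat.
apply: leq_trans (leq_addl _ _); apply: leq_trans (leq_addr _ _).
have : j \in index_iota 0 (ncell k) by rewrite mem_index_iota.
elim: (index_iota _ _) => [|j' s IH] //; rewrite inE => /orP[/eqP <-|/IH h].
  by rewrite map_cons [flatten _]/= count_cat; apply: leq_trans (count_nseq_le _ _) (leq_addr _ _).
by rewrite map_cons [flatten _]/= count_cat; apply: leq_trans h (leq_addl _ _).
Qed.

(** All corrections at level k, constants and powers of k alike, have logarithms bounded by
    multiples of this quantity, which is o([blk k]). *)
Definition err k : R := 1 + ln k.+4%:R.
Let Mk := Mscale.
Let logMk k := logM R Mk k.

Lemma err_ge1 k : 1 <= err k.
Proof. by rewrite lerDl ln_ge0// ler1n. Qed.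

Lemma ln_k4_ge0 k : 0 <= ln k.+4%:R :> R. Proof. by apply: ln_ge0; rewrite ler1n. Qed.

Lemma ln_le_sub1 (x : R) : 0 < x -> ln x <= x - 1.
Proof. by move=> x0; have := expR_ge1Dx (ln x); rewrite lnK ?posrE//; lra. Qed.

Lemma err_small C e : 0 < e -> evt (fun k => C * err k <= e * blk k).
Proof.
move=> e0; have C1 : 0 < `|C| + 1 by rewrite ltr_wpDl.
(* Solves e [blk k] = (|C| + 1) 2h (k + 1); the inequality ln x <= x - 1 at x = h (k + 4) then
   bounds ln (k + 4) with slope h. *)
have l2 := ln2_gt0; pose h := e * ln 2 / (`|C| + 1) / 2.
have h0 : 0 < h by rewrite !divr_gt0// mulr_gt0.
exists (Num.trunc ((3 * h - ln h) / h)) => k hk.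
have h1 : ln k.+4%:R <= h * k.+4%:R - 1 - ln h.
  have := @ln_le_sub1 (h * k.+4%:R); rewrite mulr_gt0 ?ltr0n// => /(_ isT).
  rewrite lnM ?posrE ?ltr0n//; lra.
have h2 : 3 * h - ln h <= k.+1%:R * h.
  rewrite -ler_pdivrMr//; have [u0|u0] := ltP ((3 * h - ln h) / h) 0.
    by apply: le_trans (ltW u0) _.
  have /andP[_ /ltW h3] := truncn_itv u0; apply: le_trans h3 _.
  by rewrite ler_nat ltnS.
have h4 : err k <= 2 * h * k.+1%:R.
  rewrite /err; move: h1; rewrite (_ : k.+4%:R = k.+1%:R + 3 :> R); last by rewrite -natrD addn3.
  move: h2; lra.
apply: (@le_trans _ _ ((`|C| + 1) * err k)).
  apply: ler_wpM2r; first by apply: le_trans (err_ge1 k).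
  by apply: le_trans (ler_norm C) _; rewrite lerDl.
have -> : e * blk k = (`|C| + 1) * (2 * h * k.+1%:R).
  by rewrite /h /blk; field; rewrite gt_eqF.
by rewrite ler_pM2l.
Qed.

Lemma logMkE k : logMk k = blk k + (ln (8 * d%:R) + 3 * ln k.+4%:R).
Proof.
have d0 := d_gt0R; have k0 : (0 : R) < k.+4%:R by rewrite ltr0n.
rewrite /logMk /logM /Mk /Mscale.
have -> : (4 * d * (k.+4 ^ 3 * 2 ^ k.+2))%:R = (8 * d%:R) * (k.+4%:R ^+ 3 * expR (blk k)) :> R.
  by rewrite expR_blk (expnS 2 k.+1) !natrM !natrX; ring.
rewrite lnM ?posrE ?mulr_gt0 ?exprn_gt0 ?expR_gt0//.
rewrite [ln (_ ^+ 3 * _)]lnM ?posrE ?exprn_gt0 ?expR_gt0//.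
by rewrite expRK lnXn// -[ln _ *+ 3]mulr_natl; ring.
Qed.

Let Ca : R := ln (8 * d%:R) + 3.

Lemma Ca_ge0 : 0 <= ln (8 * d%:R) :> R.
Proof. by apply: ln_ge0; rewrite -natrM ler1n muln_gt0. Qed.

Lemma logMk_bounds k : blk k <= logMk k <= blk k + Ca * err k.
Proof.
have h1 := Ca_ge0; have h2 := ln_k4_ge0 k; have h3 := mulr_ge0 h1 h2.
rewrite logMkE /Ca /err; apply/andP; split; nra.
Qed.

Lemma err_small_logM C e : 0 < e -> evt (fun k => C * err k <= e * logMk k).
Proof.
move=> e0; apply: evt_mono (err_small C e0) => k h; apply: le_trans h _.
by rewrite ler_pM2l//; case/andP: (logMk_bounds k).
Qed.

Lemma blk_le_logM t C e : 0 < e -> evt (fun k => t * blk k + C * err k <= (t + e) * logMk k).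
Proof.
move=> e0; apply: evt_mono (err_small_logM (C + `|t| * Ca) e0) => k h.
have /andP[h1 h2] := logMk_bounds k; have := ler_norm (- t); rewrite normrN => h3.
have h4 : - t * (logMk k - blk k) <= `|t| * (logMk k - blk k).
  by apply: ler_wpM2r => //; rewrite subr_ge0.
have h5 : `|t| * (logMk k - blk k) <= `|t| * (Ca * err k).
  by apply: ler_wpM2l => //; lra.
move: h; rewrite mulrDl -mulrA; lra.
Qed.

Lemma blk_ge_logM t C e : 0 < e -> evt (fun k => (t - e) * logMk k <= t * blk k - C * err k).
Proof.
by move=> e0; apply: evt_mono (blk_le_logM (- t) C e0) => k; lra.
Qed.

Lemma Mscale_oo (c : R) : exists n0, forall n, (n0 <= n)%N -> c <= (Mk n)%:R.
Proof.
exists (Num.trunc `|c|) => n hn; apply: le_trans (ler_norm c) _.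
have /andP[_ /ltW h] := truncn_itv (normr_ge0 c); apply: le_trans h _; rewrite ler_nat.
apply: leq_ltn_trans hn _; rewrite /Mk /Mscale.
apply: (@leq_trans (2 ^ n.+2)); first by apply: leq_trans (ltn_expl n.+2 (ltnSn 1)); lia.
by rewrite mulnA leq_pmull// ?muln_gt0 ?d_gt0 ?expn_gt0.
Qed.

Lemma Mscale_ge4 k : (4 <= Mk k)%N.
Proof. by apply: leq_trans (mdig_Mscale k); rewrite -mulnA leq_pmulr// muln_gt0 d_gt0 mdig_gt0. Qed.

(** [logM n] grows at most linearly in n, while [scale] outgrows every linear function. *)
Lemma Mscale_small (e : R) : 0 < e -> evt (fun n => logM R Mk n <= e * scale R Mk n).
Proof.
move=> e0; pose K := (ln 2 + Ca * 4) / e.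
apply: evt_mono (scale_big Mscale_ge4 Mscale_oo K) => n h.
rewrite mulrC -ler_pdivrMr//; apply: le_trans h; rewrite /K mulrAC ler_pM2r ?invr_gt0//.
have /andP[_ h2] := logMk_bounds n; apply: le_trans h2 _.
have -> : (ln 2 + Ca * 4) * n.+1%:R = blk n + Ca * (4 * n.+1%:R) by rewrite /blk; ring.
rewrite lerD2l.
apply: ler_wpM2l; first by have := Ca_ge0; rewrite /Ca; lra.
have := @ln_le_sub1 n.+4%:R; rewrite ltr0n => /(_ isT).
rewrite /err (_ : n.+4%:R = n.+1%:R + 3 :> R); last by rewrite -natrD addn3.
have : (1 : R) <= n.+1%:R by rewrite ler1n.
lra.
Qed.

Lemma ln_thin k : ln (thin k) = - (5 * ln k.+4%:R).
Proof. by rewrite /thin lnV ?posrE ?exprn_gt0 ?ltr0n// lnXn ?ltr0n// -[ln _ *+ 5]mulr_natl. Qed.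

Lemma ln_cntD k : ln 2 + blk k * D <= ln (cntD k)%:R <= ln 4 + blk k * D.
Proof.
have /andP[h1 h2] := cntD_bounds k; have E := expR_gt0 (blk k * D).
have c0 : (0 : R) < (cntD k)%:R by apply: lt_le_trans h1; rewrite mulr_gt0.
apply/andP; split.
  have := ln_mono _ h1; rewrite mulr_gt0// lnM ?posrE// expRK; exact.
by have := ln_mono c0 h2; rewrite lnM ?posrE// expRK.
Qed.

Lemma ln_massD k : - ln 2 - ln (cntD k)%:R <= ln (massD k) <= - ln (cntD k)%:R.
Proof.
have /andP[h1 h2] := massD_bounds k.
have c0 : (0 : R) < (cntD k)%:R by rewrite ltr0n (ltn_trans _ (cntD_gt1 k)).
apply/andP; split.
  have := ln_mono _ h1; rewrite invr_gt0 mulr_gt0// => /(_ isT).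
  by rewrite lnV ?posrE ?mulr_gt0// lnM ?posrE// opprD.
by have := ln_mono (massD_gt0 k) h2; rewrite lnV ?posrE.
Qed.

Lemma ln_massC k j : ln (massC k j) = - (5 * ln k.+4%:R) - blk k * expo k j.
Proof. by rewrite /massC lnM ?posrE ?thin_gt0 ?expR_gt0// ln_thin expRK. Qed.

Lemma ln_massR k :
  ln (massR k) = - (5 * ln k.+4%:R) + blk k * (s0 - rho k) - ln (mdig k ^ d)%:R.
Proof.
have m0 : (0 : R) < (mdig k ^ d)%:R by rewrite ltr0n expn_gt0 mdig_gt0.
rewrite /massR lnM ?posrE ?invr_gt0 ?mulr_gt0 ?thin_gt0 ?expR_gt0// lnV ?posrE//.
by rewrite lnM ?posrE ?thin_gt0 ?expR_gt0// ln_thin expRK.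
Qed.

Lemma ln_mdig k : blk k * s0 <= ln (mdig k ^ d)%:R <= blk k * s0 + d%:R * (1 + 3 * err k).
Proof.
have [h1 h2] := mdig_bounds k; apply/andP; split.
  have E := expR_gt0 (blk k * s0).
  have h3 : expR (blk k * s0) <= (mdig k ^ d)%:R.
    by apply: le_trans h1; rewrite ler_peMr ?(ltW E)// -natrX ler1n expn_gt0.
  by have := ln_mono E h3; rewrite expRK.
apply: le_trans h2 _; rewrite lerD2l ler_pM2l ?d_gt0R//.
have := @ln_le_sub1 2; rewrite ltr0n => /(_ isT); rewrite /err; lra.
Qed.

Lemma ln_massR_le k : ln (massR k) <= - (blk k * rho k).
Proof.
by have /andP[h1 _] := ln_mdig k; rewrite ln_massR; have := ln_k4_ge0 k; lra.
Qed.

(** * Exponents of the power sums of one level *)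

Definition psum_powR q k : R := \sum_(0 <= i < mdig k ^ d) weight k i `^ q.

Lemma psum_powRE q k : psum_powR q k = (cntD k)%:R * massD k `^ q +
  \sum_(0 <= j < ncell k) (cntC k j)%:R * massC k j `^ q + (cntR k)%:R * massR k `^ q.
Proof. exact: (sum_letters (fun x => x `^ q)). Qed.

Lemma psum_powR_gt0 q k : 0 < psum_powR q k.
Proof.
rewrite psum_powRE -addrA ltr_wpDr//.
  apply: addr_ge0; last by rewrite mulr_ge0// powR_ge0.
  by apply: sumr_ge0 => j _; rewrite mulr_ge0// powR_ge0.
by rewrite mulr_gt0 ?powR_gt0 ?massD_gt0// ltr0n (ltn_trans _ (cntD_gt1 k)).
Qed.

Lemma cnt_powR (c : nat) (x q : R) : (0 < c)%N -> 0 < x -> c%:R * x `^ q = expR (ln c%:R + q * ln x).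
Proof. by move=> c0 x0; rewrite expRD lnK ?posrE ?ltr0n// powR_ln. Qed.

Lemma ln2_le1 : ln 2 <= 1 :> R.
Proof. by have := @ln_le_sub1 2; rewrite ltr0n => /(_ isT); lra. Qed.

Lemma ln4_le : ln 4 <= 3 :> R.
Proof. by have := @ln_le_sub1 4; rewrite ltr0n => /(_ isT); lra. Qed.

Lemma mulr_le_norm (q x b : R) : `|x| <= b -> q * x <= `|q| * b.
Proof. by move=> h; apply: le_trans (ler_norm _) _; rewrite normrM ler_wpM2l. Qed.

(** The first kind contributes about Q^(D (1 - q)), and the hypothesis is the supporting line of
    slope D at 1. *)
Lemma termD_le q t k : t <= D * (q - 1) ->
  ln (cntD k)%:R + q * ln (massD k) <= - t * blk k + (3 * `|1 - q| + `|q|) * err k.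
Proof.
move=> ht; have /andP[h1 h2] := ln_cntD k; have /andP[h3 h4] := ln_massD k.
have l2 := ln2_le1; have l4 := ln4_le; have l0 := ln2_gt0; have e1 := err_ge1 k.
have a1 := @mulr_le_norm (1 - q) (ln (cntD k)%:R - blk k * D) 3 ltac:(rewrite ler_norml; lra).
have a2 := @mulr_le_norm q (ln (massD k) + ln (cntD k)%:R) 1 ltac:(rewrite ler_norml; lra).
have a3 : - (D * (q - 1)) * blk k <= - t * blk k.
  by apply: ler_wpM2r; [exact/ltW/blk_gt0|rewrite lerN2].
have a4 : 3 * `|1 - q| + `|q| <= (3 * `|1 - q| + `|q|) * err k.
  by rewrite ler_peMr// addr_ge0// mulr_ge0.
lra.
Qed.

(** Young's inequality passes to the supremum over the cell; replacing a by the left end costs |q| /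
    (k + 1), which [blk k] turns into the constant |q| ln 2. *)
Lemma termC_le q t k j : act k j -> (forall a, domL a -> ls a <= a * q - t) ->
  ln (cntC k j)%:R + q * ln (massC k j) <= - t * blk k + (1 + 6 * `|q|) * err k.
Proof.
move=> ac H; have [b0 b1 b2] := bdim_bounds ac; have bk := blk_gt0 k.
have /andP[c1 c2] := @cnt_bounds (blk k * bdim k j) (mulr_ge0 (ltW bk) b0).
have lc : ln (cntC k j)%:R <= ln 2 + blk k * bdim k j.
  rewrite /cntC ac; have := ln_mono _ c2; rewrite lnM ?posrE ?expR_gt0// expRK; apply.
  by rewrite ltr0n.
have k0 : (0 : R) < k.+1%:R by rewrite ltr0n.
have lb : bdim k j <= expo k j * q + `|q| / k.+1%:R - t.
  apply: bdim_le => // a [da /andP[a1 a2]]; apply: le_trans (H a da) _; rewrite lerD2r.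
  have x1 : expo k j <= a by rewrite /expo ler_pdivrMr.
  have x2 : a <= expo k j + k.+1%:R^-1.
    by rewrite /expo -[X in _ + X]mul1r -mulrDl natr1 ler_pdivlMr// ltW.
  have x3 : 0 < k.+1%:R^-1 :> R by rewrite invr_gt0.
  move: x1 x2 x3; move: (expo k j) (k.+1%:R^-1) => x y x1 x2 x3.
  have : q * (a - x) <= `|q| * y by apply: mulr_le_norm; rewrite ler_norml; lra.
  lra.
have lb2 : blk k * bdim k j <= blk k * (expo k j * q - t) + `|q| * ln 2.
  apply: le_trans (ler_wpM2l (ltW bk) lb) _; rewrite le_eqVlt; apply/orP; left; apply/eqP.
  by rewrite /blk; field; rewrite gt_eqF.
rewrite ln_massC; have l2 := ln2_le1; have e1 := err_ge1 k; have l0 := ln2_gt0.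
have a1 : q * - (5 * ln k.+4%:R) <= `|q| * (5 * ln k.+4%:R).
  by apply: mulr_le_norm; rewrite normrN ger0_norm// mulr_ge0// ln_k4_ge0.
have a2 : `|q| * ln 2 <= `|q| by rewrite ler_piMr.
have a3 : `|q| * (5 * ln k.+4%:R) + `|q| + 1 <= (1 + 6 * `|q|) * err k.
  have p0 := mulr_ge0 (normr_ge0 q) (ln_k4_ge0 k); have p1 := ln_k4_ge0 k; have q0 := normr_ge0 q.
  rewrite /err; nra.
lra.
Qed.

Lemma cntR_gt0 k : (0 < cntR k)%N.
Proof.
by rewrite -(@ltr0n R); apply: lt_le_trans (cntR_ge k); exact: expR_gt0.
Qed.

Lemma termR_le q k :
  ln (cntR k)%:R + q * ln (massR k) <=
    blk k * (s0 - rho k * q) + (4 * d%:R * `|1 - q| + 5 * `|q|) * err k.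
Proof.
have /andP[h1 h2] := ln_mdig k; have e1 := err_ge1 k; have d0 := d_gt0R.
have c0 : (0 : R) < (cntR k)%:R by rewrite ltr0n cntR_gt0.
have lc : ln (cntR k)%:R <= ln (mdig k ^ d)%:R :> R.
  by apply: ln_mono => //; rewrite ler_nat /cntR -subnDA leq_subr.
rewrite ln_massR.
have a1 : q * - (5 * ln k.+4%:R) <= `|q| * (5 * ln k.+4%:R).
  by apply: mulr_le_norm; rewrite normrN ger0_norm// mulr_ge0// ln_k4_ge0.
have a2 : (1 - q) * (ln (mdig k ^ d)%:R - blk k * s0) <= `|1 - q| * (4 * d%:R * err k).
  apply: mulr_le_norm; rewrite ger0_norm ?subr_ge0//.
  have : d%:R * (1 + 3 * err k) <= d%:R * (4 * err k) by rewrite ler_pM2l//; lra.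
  lra.
have a3 : `|q| * (5 * ln k.+4%:R) <= `|q| * (5 * err k) by apply: ler_wpM2l => //; rewrite /err; lra.
lra.
Qed.

Lemma ncell_le k : (2 + ncell k <= k.+4 ^ 2)%N.
Proof.
have -> : k.+4 = (k.+1 + 3)%N by rewrite addn3.
rewrite /ncell sqrnD addnC -addnA leq_add2l.
exact: leq_trans (leq_addr _ _).
Qed.

(** The sum has 2 + (k+1)^2 groups, a polynomial number, so its logarithm is the largest exponent up
    to a multiple of [err k]. *)
Lemma ln_psum_le q t : t <= D * (q - 1) -> (forall a, domL a -> ls a <= a * q - t) ->
  (forall e, 0 < e -> evt (fun k => s0 - rho k * q <= - t + e)) ->
  forall e, 0 < e -> evt (fun k => ln (psum_powR q k) <= (- t + e) * logMk k).
Proof.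
move=> hD hC hR e e0; have e2 : 0 < e / 2 by rewrite divr_gt0.
pose C := (3 * `|1 - q| + `|q|) + (1 + 6 * `|q|) + (4 * d%:R * `|1 - q| + 5 * `|q|).
have C0 : [/\ 0 <= 3 * `|1 - q| + `|q|, 0 <= 1 + 6 * `|q| & 0 <= 4 * d%:R * `|1 - q| + 5 * `|q|].
  by split; rewrite ?addr_ge0// ?mulr_ge0.
have [C1 C2 C3] := C0.
apply: evt_mono2 (hR _ e2) (blk_le_logM (- t + e / 2) (C + 2) e2) => k hr h.
have bk := blk_gt0 k; have e1 := err_ge1 k.
pose X := (- t + e / 2) * blk k + C * err k.
have Xe : 0 <= e / 2 * blk k by rewrite mulr_ge0// ltW.
have i1 := mulr_ge0 C1 (le_trans ler01 e1).
have i2 := mulr_ge0 C2 (le_trans ler01 e1).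
have i3 := mulr_ge0 C3 (le_trans ler01 e1).
have CE : C * err k = (3 * `|1 - q| + `|q|) * err k + (1 + 6 * `|q|) * err k +
   (4 * d%:R * `|1 - q| + 5 * `|q|) * err k by rewrite /C; ring.
have tD : (cntD k)%:R * massD k `^ q <= expR X.
  rewrite cnt_powR ?massD_gt0 ?(ltn_trans _ (cntD_gt1 k))// ler_expR.
  by apply: le_trans (termD_le k hD) _; rewrite /X CE; lra.
have tC j : (cntC k j)%:R * massC k j `^ q <= expR X.
  have [ac|nac] := boolP (act k j); last by rewrite /cntC (negbTE nac) mul0r expR_ge0.
  rewrite cnt_powR ?massC_gt0// ?ler_expR; last by rewrite /cntC ac.
  by apply: le_trans (termC_le ac hC) _; rewrite /X CE; lra.
have tR : (cntR k)%:R * massR k `^ q <= expR X.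
  rewrite cnt_powR ?massR_gt0 ?cntR_gt0// ler_expR.
  apply: le_trans (termR_le q k) _.
  have := ler_wpM2l (ltW bk) hr; rewrite /X CE; lra.
have tot : psum_powR q k <= (2 + ncell k)%:R * expR X.
  rewrite psum_powRE natrD mulrDl.
  have : \sum_(0 <= j < ncell k) (cntC k j)%:R * massC k j `^ q <= (ncell k)%:R * expR X.
    apply: (@le_trans _ _ (\sum_(0 <= j < ncell k) expR X)); first by apply: ler_sum => j _.
    by rewrite sumr_const_nat subn0 -[leLHS]mulr_natl.
  by move: tD tR; lra.
apply: le_trans (ln_mono (psum_powR_gt0 q k) tot) _.
rewrite lnM ?posrE ?expR_gt0 ?ltr0n// expRK.
have h5 : ln (2 + ncell k)%:R <= 2 * err k :> R.
  have : ln (2 + ncell k)%:R <= ln (k.+4%:R ^+ 2) :> R.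
    apply: ln_mono; first by rewrite ltr0n.
    by rewrite -natrX ler_nat ncell_le.
  rewrite lnXn ?ltr0n// -[ln _ *+ 2]mulr_natl /err; lra.
move: h; rewrite mulrDl /X; lra.
Qed.

Lemma psum_ge_term (c : nat) v q k : (0 < c)%N -> 0 < v ->
  c%:R * v `^ q <= psum_powR q k -> ln c%:R + q * ln v <= ln (psum_powR q k).
Proof.
by move=> c0 v0; rewrite cnt_powR// => /(ln_mono (expR_gt0 _)); rewrite expRK.
Qed.

(** The light letters alone suffice: for q < 0 the q-th power of their weight exceeds every power of
    Q as [rho] tends to infinity. *)
Lemma ln_psum_oo q : q < 0 -> (forall b, evt (fun k => b <= rho k)) ->
  forall t e, 0 < e -> evt (fun k => (- t - e) * logMk k <= ln (psum_powR q k)).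
Proof.
move=> q0 hrho t e e0.
apply: evt_mono2 (hrho ((`|t| + 1) / - q)) (err_small (`|t| * Ca) ltr01) => k hr h.
have bk := blk_gt0 k; have /andP[lM1 lM2] := logMk_bounds k.
have lM : 0 <= logMk k by apply: le_trans lM1; exact: ltW.
have := @psum_ge_term (cntR k) (massR k) q k (cntR_gt0 k) (massR_gt0 k).
have le : (cntR k)%:R * massR k `^ q <= psum_powR q k.
  rewrite psum_powRE lerDr addr_ge0//; first by rewrite mulr_ge0// powR_ge0.
  by apply: sumr_ge0 => j _; rewrite mulr_ge0// powR_ge0.
move=> /(_ le); apply: le_trans.
have lc : 0 <= ln (cntR k)%:R :> R by apply: ln_ge0; rewrite ler1n cntR_gt0.
have h2 : - q * (blk k * rho k) <= q * ln (massR k).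
  by rewrite mulNr -mulrN ler_nM2l//; exact: ln_massR_le.
have h3 : (`|t| + 1) * blk k <= - q * (blk k * rho k).
  move: hr; rewrite ler_pdivrMr ?oppr_gt0// => hr.
  have -> : - q * (blk k * rho k) = blk k * (rho k * - q) by ring.
  by rewrite [leLHS]mulrC ler_pM2l.
have h4 : (- t - e) * logMk k <= `|t| * logMk k.
  by apply: ler_wpM2r => //; have := ler_norm (- t); rewrite normrN; lra.
have h5 : `|t| * logMk k <= `|t| * (blk k + Ca * err k) by apply: ler_wpM2l.
lra.
Qed.

(** At q = 0 the sum is the number of letters. The case is separate because tau need not have a
    supporting line at 0 when its domain is the half line. *)
Lemma ln_psum_ge0 : forall e, 0 < e ->
  evt (fun k => (s0 - e) * logMk k <= ln (psum_powR 0 k)).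
Proof.
move=> e e0; apply: evt_mono (blk_ge_logM s0 0 e0) => k; rewrite mul0r subr0.
move=> h; apply: le_trans h _.
have -> : psum_powR 0 k = (mdig k ^ d)%:R.
  rewrite /psum_powR (eq_bigr (fun=> 1)); last by move=> i _; rewrite powRr0.
  by rewrite sumr_const_nat subn0.
by rewrite mulrC; case/andP: (ln_mdig k).
Qed.

(** * Letters of a given exponent *)

Definition cidx (a : R) k : nat := Num.trunc (a * k.+1%:R).

Lemma cidxP a : domL a ->
  evt (fun k => [/\ (cidx a k < ncell k)%N, act k (cidx a k), cell k (cidx a k) a &
    `|blk k * a - blk k * expo k (cidx a k)| <= 1]).
Proof.
move=> da; have [a0 _ _ _] := ls_bounds da.
exists (Num.trunc a) => k hk; have k0 : (0 : R) < k.+1%:R by rewrite ltr0n.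
have ak : 0 <= a * k.+1%:R by rewrite mulr_ge0// ltW.
have /andP[h1 h2] := truncn_itv ak.
have ca : cell k (cidx a k) a by split => //; rewrite h1 h2.
split => //.
- rewrite -(@ltr_nat R); apply: le_lt_trans h1 _.
  have /andP[_ h3] := truncn_itv a0.
  rewrite /ncell natrX expr2 ltr_pM2r//; apply: lt_le_trans h3 _.
  by rewrite ler_nat ltnS.
- by apply/asboolP; exists a.
have e1 : expo k (cidx a k) <= a by rewrite /expo ler_pdivrMr.
have e2 : a <= expo k (cidx a k) + k.+1%:R^-1.
  by rewrite /expo -[X in _ + X]mul1r -mulrDl natr1 ler_pdivlMr// ltW.
have bk := blk_gt0 k; rewrite -mulrBr ger0_norm; last by rewrite mulr_ge0 ?subr_ge0// ltW.
apply: (@le_trans _ _ (blk k * k.+1%:R^-1)); first by rewrite ler_pM2l// lerBlDl.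
by rewrite /blk mulrAC mulfV ?mul1r ?ln2_le1// gt_eqF.
Qed.

Lemma cntC_ge a k j : cell k j a -> expR (blk k * ls a) <= (cntC k j)%:R.
Proof.
move=> ca; have ac : act k j by apply/asboolP; exists a.
have [b0 _ _] := bdim_bounds ac; have bk := blk_gt0 k.
have /andP[h _] := @cnt_bounds (blk k * bdim k j) (mulr_ge0 (ltW bk) b0).
by rewrite /cntC ac; apply: le_trans h; rewrite ler_expR ler_pM2l// bdim_ub.
Qed.

(** One cell suffices: that of an exponent a for which Young's inequality is an equality at q. *)
Lemma ln_psum_ge a q t : domL a -> ls a = a * q - t ->
  forall e, 0 < e -> evt (fun k => (- t - e) * logMk k <= ln (psum_powR q k)).
Proof.
move=> da E e e0.
apply: evt_mono2 (cidxP da) (blk_ge_logM (- t) (6 * `|q|) e0) => k [j1 j2 j3 j4] h.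
apply: le_trans h _.
have cg := cntC_ge j3; have c0 : (0 : R) < (cntC k (cidx a k))%:R.
  by apply: lt_le_trans cg; exact: expR_gt0.
have c0' : (0 < cntC k (cidx a k))%N by rewrite -(@ltr0n R).
have le : (cntC k (cidx a k))%:R * massC k (cidx a k) `^ q <= psum_powR q k.
  rewrite psum_powRE addrAC addrC big_mkord (bigD1 (Ordinal j1))//= -addrA lerDl addr_ge0//.
    by apply: sumr_ge0 => j _; rewrite mulr_ge0// powR_ge0.
  by rewrite addr_ge0// mulr_ge0// powR_ge0.
apply: le_trans (psum_ge_term c0' (massC_gt0 _ _) le).
have := ln_mono (expR_gt0 _) cg; rewrite expRK => lc.
rewrite ln_massC; have e1 := err_ge1 k.
have a1 : - q * - (5 * ln k.+4%:R) <= `|q| * (5 * ln k.+4%:R).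
  by rewrite -(normrN q); apply: mulr_le_norm; rewrite normrN ger0_norm// mulr_ge0// ln_k4_ge0.
have a2 := mulr_le_norm (- q) j4; rewrite normrN in a2.
have a3 : `|q| * (5 * ln k.+4%:R) <= `|q| * (5 * err k - 5) by apply: ler_wpM2l => //; rewrite /err; lra.
have q0 : `|q| <= `|q| * err k by rewrite ler_peMr.
have q1 := normr_ge0 q; rewrite E in lc; lra.
Qed.

Lemma count_ge_logM (J : nat -> pred nat) (c : nat -> nat) b :
  (forall k, (c k <= count (J k) (iota 0 (mdig k ^ d)))%N) \/
  evt (fun k => (c k <= count (J k) (iota 0 (mdig k ^ d)))%N) ->
  0 <= b -> evt (fun k => expR (blk k * b) <= (c k)%:R) ->
  forall s, s < b -> evt (fun k => s * logMk k <= ln (count (J k) (iota 0 (mdig k ^ d)))%:R).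
Proof.
move=> H b0 cb s sb; have {}H : evt (fun k => (c k <= count (J k) (iota 0 (mdig k ^ d)))%N).
  by case: H => // H; exists 0%N.
have e0 : 0 < b - s by rewrite subr_gt0.
apply: evt_mono2 (evtI H cb) (blk_ge_logM b 0 e0) => k [h1 h2]; rewrite mul0r subr0.
rewrite (_ : b - (b - s) = s); last by lra.
move=> h; apply: le_trans h _; rewrite mulrC -[leLHS]expRK; apply: ln_mono; first exact: expR_gt0.
by apply: le_trans h2 _; rewrite ler_nat.
Qed.

Definition JD k : pred nat := fun i => weight k i == massD k.
(* Levels at which the cells miss a impose no condition, so that JC a k is never empty. *)
Definition JC (a : R) k : pred nat := fun i => (cidx a k < ncell k)%N && act k (cidx a k) ==>
   (weight k i == massC k (cidx a k)).
Definition JR k : pred nat := fun i => weight k i == massR k.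

Let wexp := letters_exponent d mdig Mscale weight.

Lemma exponent_bound (v : nat -> R) (J : nat -> pred nat) a C :
  (forall k i, J k i -> weight k i = v k) \/ evt (fun k => forall i, J k i -> weight k i = v k) ->
  evt (fun k => `|ln (v k) + blk k * a| <= C * err k) -> wexp J a%:E.
Proof.
move=> H Hv e e0; have {}H : evt (fun k => forall i, J k i -> weight k i = v k).
  by case: H => // H; exists 0%N => k _ i; exact: H.
apply: evt_mono2 (evtI H Hv) (err_small_logM (C + `|a| * Ca) e0) => k [h1 h2] h i _ /h1 ->.
apply: le_trans h; have /andP[l1 l2] := logMk_bounds k.
have -> : ln (v k) + a * logM R Mscale k = ln (v k) + blk k * a + a * (logMk k - blk k).
  by rewrite /logMk /Mk; ring.
apply: le_trans (ler_normD _ _) _; rewrite mulrDl lerD//.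
rewrite normrM -mulrA ler_wpM2l// ger0_norm ?subr_ge0//; lra.
Qed.

Lemma JD_exponent : wexp JD D%:E.
Proof.
apply: (@exponent_bound massD JD D 5); first by left => k i /eqP.
exists 0%N => k _; have /andP[h1 h2] := ln_cntD k; have /andP[h3 h4] := ln_massD k.
have l2 := ln2_le1; have l4 := ln4_le; have l0 := ln2_gt0; have e1 := err_ge1 k.
rewrite ler_norml; lra.
Qed.

Lemma JC_exponent a : domL a -> wexp (JC a) a%:E.
Proof.
move=> da; apply: (@exponent_bound (fun k => massC k (cidx a k)) _ a 6).
  right; apply: evt_mono (cidxP da) => k [j1 j2 _ _] i; rewrite /JC j1 j2.
  by move=> /eqP.
apply: evt_mono (cidxP da) => k [_ _ _]; rewrite ln_massC ler_norml => /andP[h1 h2].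
have := ln_k4_ge0 k; rewrite /err ler_norml => h; apply/andP; split; lra.
Qed.

Lemma ln_massR_oo : (forall b, evt (fun k => b <= rho k)) -> wexp JR +oo%E.
Proof.
move=> hrho b; apply: evt_mono2 (hrho (`|b| + 1)) (err_small (`|b| * Ca) ltr01) => k hr h i _ /eqP ->.
apply: le_trans (ln_massR_le k) _; have bk := blk_gt0 k; have /andP[l1 l2] := logMk_bounds k.
have lM : 0 <= logMk k by apply: le_trans l1; exact: ltW.
have h1 : b * logMk k <= `|b| * logMk k by apply: ler_wpM2r => //; exact: ler_norm.
have h2 : `|b| * logMk k <= `|b| * (blk k + Ca * err k) by apply: ler_wpM2l.
have h3 : blk k * (`|b| + 1) <= blk k * rho k by rewrite ler_pM2l.
rewrite -/(logMk k) mulNr; lra.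
Qed.

Lemma JC_has a k : has (JC a k) (iota 0 (mdig k ^ d)).
Proof.
rewrite /JC; case: (boolP (_ && _)) => [/andP[h1 h2]|_].
  rewrite has_count; apply: leq_trans (count_C h1).
  by rewrite /cntC h2.
by apply/hasP; exists 0%N; rewrite ?mem_iota ?add0n ?expn_gt0 ?mdig_gt0.
Qed.

Lemma JC_count a : domL a -> forall s, s < ls a ->
  evt (fun k => s * logMk k <= ln (count (JC a k) (iota 0 (mdig k ^ d)))%:R).
Proof.
move=> da; have [_ l0 _ _] := ls_bounds da.
apply: (@count_ge_logM (JC a) (fun k => cntC k (cidx a k))) => //.
  right; apply: evt_mono (cidxP da) => k [j1 j2 _ _].
  by apply: leq_trans (count_C j1) _; apply: sub_count => i; rewrite /JC j1 j2.
by apply: evt_mono (cidxP da) => k [_ _ j3 _]; exact: cntC_ge.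
Qed.

Lemma JR_has k : has (JR k) (iota 0 (mdig k ^ d)).
Proof. by rewrite has_count; apply: leq_trans (count_R k); exact: cntR_gt0. Qed.

Lemma JR_count s : s < s0 ->
  evt (fun k => s * logMk k <= ln (count (JR k) (iota 0 (mdig k ^ d)))%:R).
Proof.
apply: (@count_ge_logM JR cntR); [by left; exact: count_R|exact: s0_ge0|].
by exists 0%N => k _; exact: cntR_ge.
Qed.

Lemma Zsum_expR q n :
  Zsum d mdig weight q n = expR (\sum_(k < n) ln (psum_powR q k)).
Proof.
rewrite /Zsum (@sum_cylmass_powR R (fun k => (mdig k ^ d)%N) weight).
- by rewrite expR_sum; apply: eq_bigr => k _; rewrite lnK// posrE; exact: psum_powR_gt0.
- by move=> k i /weight_gt0/ltW.
- exact: weight_sum.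
Qed.

Lemma Zsum_le q t :
  (forall e, 0 < e -> evt (fun k => ln (psum_powR q k) <= (- t + e) * logMk k)) ->
  forall e, 0 < e -> evt (fun n => Zsum d mdig weight q n <= expR ((- t + e) * scale R Mscale n)).
Proof.
move=> H e e0; have := @sum_scale_le R Mscale Mscale_ge4 Mscale_oo _ (- t) H e e0.
by apply: evt_mono => n; rewrite Zsum_expR ler_expR.
Qed.

Lemma Zsum_ge q t :
  (forall e, 0 < e -> evt (fun k => (- t - e) * logMk k <= ln (psum_powR q k))) ->
  forall e, 0 < e -> evt (fun n => expR ((- t - e) * scale R Mscale n) <= Zsum d mdig weight q n).
Proof.
move=> H e e0; have := @sum_scale_ge R Mscale Mscale_ge4 Mscale_oo _ (- t) H e e0.
by apply: evt_mono => n; rewrite Zsum_expR ler_expR.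
Qed.

End Block.

(** * Choice of the parameters and conclusion *)

Unset Implicit Arguments.

Theorem theorem1p1 (R : realType) (d : nat) (tau : R -> \bar R) (D : R) :
  (1 <= d)%N ->
  (forall q, tau q != +oo%E) ->
  concave_ext tau -> nondecr_ext tau ->
  tau 1%R = 0%E -> ((- d%:R)%:E <= tau 0%R)%E -> (tau 0%R <= 0)%E ->
  ((forall q, tau q != -oo%E) \/ (forall q, tau q != -oo%E <-> 0 <= q)) ->
  (forall a : \bar R, a != -oo%E -> LF tau a != -oo%E -> (0 <= LF tau a)%E) ->
  rderiv1 tau <= D <= lderiv1 tau ->
  exists mu : {measure set (BorelV R d) -> \bar R},
    (mu setT < +oo)%E /\ compact (supp mu) /\
    HM mu /\ exact_dim mu D /\
    Lq mu = tau /\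
    (forall a : \bar R, a != -oo%E -> fH mu a = LF (Lq mu) a).
Proof.
move=> d_gt0 tau_oo tau_cc tau_nd tau1 tau0_ge tau0_le tau_dom LF_ge0 D_der.
have domge := @dom_ge0 R tau tau_dom.
have tau0 : tau 0 != -oo%E by exact: domge.
have Dsup := @D_support R tau D tau_oo tau_cc tau_nd tau1 tau_dom D_der.
pose T := ftau tau; pose s0 := - T 0.
pose ls a := fine (LF tau a%:E); pose domL a := LF tau a%:E != -oo%E.
have /andP[T0d T00] : - d%:R <= T 0 <= 0 by exact: ftau0_bounds.
have D_s0 : 0 <= D <= s0 by rewrite (@D_ge0 R tau D)// (@D_le R tau D).
have s0_d : s0 <= d%:R by rewrite /s0; lra.
have lsE a : domL a -> LF tau a%:E = (ls a)%:E by move=> h; exact: LF_real_fin.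
have ls_le a q : domL a -> tau q != -oo%E -> ls a <= a * q - T q.
  by move=> da tq; rewrite -lee_fin -lsE//; exact: LF_real_le.
have ls_bounds a : domL a -> [/\ 0 <= a, 0 <= ls a, ls a <= a & ls a <= s0].
  move=> da; split.
  - rewrite leNgt; apply/negP => a0; move: da; rewrite /domL.
    by rewrite (LF_neg tau_oo tau1 tau_dom LF_ge0 a0) eqxx.
  - by rewrite -lee_fin -lsE//; apply: LF_ge0.
  - by have := ls_le a 1 da (domge _ ler01); rewrite mulr1 /T /ftau tau1 subr0.
  - by have := ls_le a 0 da tau0; rewrite mulr0 sub0r.
(* The light letters must respect s0 - rho q <= -tau(q) up to e. On the whole line a supporting
   slope at 0 does this; on the half line any sequence tending to infinity does, and it also makes
   the sums blow up for q < 0. *)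
have [rho [rho_ge rhoU rho_oo]] : exists rho : nat -> R, [/\ forall k, s0 <= rho k,
    forall q, tau q != -oo%E -> forall e, 0 < e -> evt (fun k => s0 - rho k * q <= - T q + e) &
    (forall q, tau q != -oo%E) \/
    ((forall q, tau q != -oo%E <-> 0 <= q) /\ forall b, evt (fun k => b <= rho k))].
  case: (tau_dom) => [tau_fin|tau_half].
    have [|a0 _ ha] := @support_slope R tau tau_oo tau_cc tau_nd tau_dom 0.
      by exists (- 1) => //; rewrite ltrN10.
    exists (fun=> a0); split; [|move=> q tq e e0|by left].
      (* The supporting line at 0, evaluated at 1 where tau vanishes, gives [s0 <= a0]. *)
      by move=> _; have := ha 1 (tau_fin 1); rewrite /s0 /T {1}/ftau tau1 /=; lra.
    by apply: evtW => _; have := ha q tq; rewrite /s0 /T; lra.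
  have rho_oo (b : R) : evt (fun k => b <= d%:R + k%:R).
    exists (Num.trunc `|b|).+1 => k hk; apply: le_trans (ler_norm b) _.
    have /andP[_ /ltW h] := truncn_itv (normr_ge0 b); apply: le_trans h _.
    by rewrite -natrD ler_nat; apply: leq_trans hk (leq_addl _ _).
  exists (fun k => d%:R + k%:R); split; [| |by right].
    by move=> k; apply: le_trans s0_d _; rewrite lerDl.
  move=> q /tau_half; rewrite le_eqVlt => /orP[/eqP <-|q0] e e0.
    by apply: evtW => k; rewrite mulr0 /s0; lra.
  apply: evt_mono (rho_oo ((s0 + T q) / q)) => k.
  by rewrite ler_pdivrMr//; lra.
pose m := @mdig R d s0; pose M := Mscale d; pose p := weight d s0 D ls domL rho.
have m_gt0 k : (0 < m k)%N by exact: mdig_gt0.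
have mM k : (4 * d * m k <= M k)%N by exact: (mdig_Mscale d_gt0 D_s0 s0_d).
have M_oo := Mscale_oo d_gt0 D_s0 s0_d.
have M_small := fun e => @Mscale_small R d s0 D d_gt0 D_s0 s0_d e.
have p_gt0 k i : (i < m k ^ d)%N -> 0 < p k i.
  exact: (weight_gt0 d_gt0 D_s0 s0_d ls_bounds rho_ge).
have p_half k i : (i < m k ^ d)%N -> p k i <= 2^-1.
  exact: (weight_half d_gt0 D_s0 s0_d ls_bounds rho_ge).
have p_sum k : \sum_(0 <= i < m k ^ d) p k i = 1.
  exact: (weight_sum rho d_gt0 D_s0 s0_d ls_bounds).
have Z_le q : tau q != -oo%E -> forall e, 0 < e ->
    evt (fun n => Zsum d m p q n <= expR ((- fine (tau q) + e) * scale R M n)).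
  move=> tq; apply: (Zsum_le d_gt0 D_s0 s0_d ls_bounds rho_ge).
  apply: (ln_psum_le d_gt0 D_s0 s0_d ls_bounds rho_ge); [exact: Dsup| |exact: rhoU].
  by move=> a da; exact: ls_le.
have Z_ge q : tau q != -oo%E -> forall e, 0 < e ->
    evt (fun n => expR ((- fine (tau q) - e) * scale R M n) <= Zsum d m p q n).
  move=> tq; apply: (Zsum_ge d_gt0 D_s0 s0_d ls_bounds rho_ge).
  have [->|q0] := eqVneq q 0; first exact: (ln_psum_ge0 ls domL rho d_gt0 D_s0 s0_d).
  have [|a a0 ha] := @support_slope R tau tau_oo tau_cc tau_nd tau_dom q.
    case: (tau_dom) => [tau_fin|tau_half]; first by exists (q - 1) => //; rewrite gtrDl ltrN10.
    by exists 0 => //; rewrite lt_neqAle eq_sym q0; apply/tau_half.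
  have LFa := LF_support tau_oo tq ha.
  apply: (@ln_psum_ge R d s0 D ls domL rho d_gt0 D_s0 s0_d ls_bounds a).
    by rewrite /domL LFa.
  by rewrite /ls LFa.
have Z_oo q : tau q = -oo%E -> forall t e, 0 < e ->
    evt (fun n => expR ((- t - e) * scale R M n) <= Zsum d m p q n).
  move=> tq t; apply: (Zsum_ge d_gt0 D_s0 s0_d ls_bounds rho_ge) => e e0.
  case: rho_oo => [tau_fin|[tau_half rho_oo]]; first by have := tau_fin q; rewrite tq.
  apply: (ln_psum_oo d_gt0 D_s0 s0_d ls_bounds) => //.
  by rewrite ltNge; apply/negP => /tau_half; rewrite tq.
have J_ex (a : \bar R) : a != -oo%E -> LF tau a != -oo%E ->
    exists beta J, [/\ LF tau a = beta%:E, forall k, has (J k) (iota 0 (m k ^ d)),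
    letters_exponent d m M p J a & forall s, s < beta ->
      evt (fun k => s * logM R M k <= ln (count (J k) (iota 0 (m k ^ d)))%:R)].
  case: a => [a||]// _ La.
    exists (ls a), (JC d s0 D ls domL rho a); split.
    - exact: lsE.
    - by move=> k; exact: (JC_has rho d_gt0 D_s0 s0_d ls_bounds a k).
    - exact: (JC_exponent D rho d_gt0 ls_bounds La).
    - exact: (JC_count rho d_gt0 D_s0 s0_d ls_bounds La).
  case: rho_oo => [tau_fin|[tau_half rho_oo]].
    by move: La; rewrite (LF_oo_all tau_oo tau_fin).
  exists s0, (JR d s0 D ls domL rho); split.
  - exact: (LF_oo_half tau_oo tau_dom tau_half).
  - by move=> k; exact: (JR_has rho d_gt0 D_s0 s0_d ls_bounds k).
  - exact: (ln_massR_oo ls domL d_gt0 D_s0 s0_d rho_oo).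
  - exact: (JR_count rho d_gt0 D_s0 s0_d ls_bounds).
have [mu muE] := exists_coded_measure d_gt0 m_gt0 mM p_gt0 p_sum.
have LqE : Lq mu = tau.
  exact: (Lq_tau d_gt0 m_gt0 mM M_oo M_small p_gt0 p_sum muE tau_oo Z_le Z_ge Z_oo).
exists mu; split; first by rewrite (mu_setT muE) ltry.
split; first exact: (compact_supp d_gt0 m_gt0 mM p_gt0 p_sum muE).
split; first exact: (mu_HM d_gt0 m_gt0 mM M_oo M_small p_gt0 p_half p_sum muE tau_oo tau0 Z_le J_ex).
split.
  apply: (exact_dim_J d_gt0 m_gt0 mM M_oo M_small p_gt0 p_sum muE).
    exact: (JD_exponent d_gt0 D_s0 s0_d ls_bounds rho_ge).
  exact: (weight_notD d_gt0 D_s0 s0_d ls_bounds rho_ge).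
split=> // a a_neq; rewrite LqE.
exact: (fH_LF d_gt0 m_gt0 mM M_oo M_small p_gt0 p_sum muE tau_oo tau0 Z_le J_ex a_neq).
Qed.
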